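(* Let $\Omega\subseteq\mathbb R^d$ be open, $m\in\mathbb N$, $l\in\{0,\dots,m\}$, $\varepsilon_n\to0^+$, and let $u_n\rightharpoonup 0$ weakly in $L^2_{\rm loc}(\Omega;\mathbb C^r)$ satisfy $$\sum_{l\le|\alpha|\le m}\varepsilon_n^{|\alpha|-l}\,\partial_\alpha(A^\alpha u_n)=f_n\quad\text{in }\Omega,$$ where $A^\alpha\in C(\Omega;\mathrm M_{q\times r}(\mathbb C))$, and $(f_n)$ is a sequence in $H^{-m}_{\rm loc}(\Omega;\mathbb C^q)$ such that for every $\varphi\in C_c^\infty(\Omega)$ $$\frac{\widehat{\varphi f_n}}{1+\sum_{s=l}^m\varepsilon_n^{s-l}|\xi|^s}\longrightarrow 0\quad\text{strongly in }L^2(\mathbb R^d;\mathbb C^q).$$ Let $\mu$ be the one-scale H-measure with characteristic length $(\varepsilon_n)$ associated to (a subsequence of) $(u_n)$. Then $$p_1\,\mu^\top=0\quad\text{on }\Omega\times \mathrm K_{0,\infty}(\mathbb R^d),\qquad p_1(x,\xi)=\sum_{l\le|\alpha|\le m}(2\pi i)^{|\alpha|}\frac{\xi^\alpha}{|\xi|^l+|\xi|^m}A^\alpha(x).$$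
   Context: Conventions: functions on $\Omega$ are extended by zero to $\mathbb R^d$; $\hat u(\xi)=\int_{\mathbb R^d}e^{-2\pi i x\cdot\xi}u(x)\,dx$; $(a\otimes b)_{ij}=a_i\overline{b_j}$. $f\in H^{-m}_{\rm loc}(\Omega)$ means $\varphi f\in H^{-m}(\mathbb R^d)$ for all $\varphi\in C_c^\infty(\Omega)$. Compactification: $\mathrm K_{0,\infty}(\mathbb R^d)$ is the compactification of $\mathbb R^d\setminus\{0\}$ obtained by adjoining a unit sphere $\Sigma_0=\{0^e:e\in S^{d-1}\}$ at the origin and a unit sphere $\Sigma_\infty=\{\infty^e:e\in S^{d-1}\}$ at infinity, with the topology of $S^{d-1}\times[0,\infty]$ (the point $re$ corresponds to $(e,r)$, $0^e$ to $(e,0)$, $\infty^e$ to $(e,\infty)$). Thus $C(\mathrm K_{0,\infty}(\mathbb R^d))$ is identified with the space of continuous $\psi$ on $\mathbb R^d\setminus\{0\}$ for which there are $\psi_0,\psi_\infty\in C(S^{d-1})$ with $\psi(\xi)-\psi_0(\xi/|\xi|)\to0$ as $|\xi|\to0$ and $\psi(\xi)-\psi_\infty(\xi/|\xi|)\to0$ as $|\xi|\to\infty$; then $\psi(0^e)=\psi_0(e)$, $\psi(\infty^e)=\psi_\infty(e)$. The functions $\xi\mapsto\xi^\alpha/(|\xi|^l+|\xi|^m)$, $l\le|\alpha|\le m$, belong to $C(\mathrm K_{0,\infty}(\mathbb R^d))$ and are understood as extended by continuity to $\Sigma_0\cup\Sigma_\infty$. One-scale H-measure: if $u_n\rightharpoonup0$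 in $L^2_{\rm loc}(\Omega;\mathbb C^r)$ and $\omega_n\to0^+$, then, after passing to a subsequence, there is a (unique) $r\times r$ hermitian non-negative matrix Radon measure $\mu$ on $\Omega\times\mathrm K_{0,\infty}(\mathbb R^d)$ such that for all $\varphi_1,\varphi_2\in C_c(\Omega)$, $\psi\in C(\mathrm K_{0,\infty}(\mathbb R^d))$, $$\lim_n\int_{\mathbb R^d}\big(\widehat{\varphi_1u_n}(\xi)\otimes\widehat{\varphi_2u_n}(\xi)\big)\psi(\omega_n\xi)\,d\xi=\int_{\Omega\times\mathrm K_{0,\infty}(\mathbb R^d)}\varphi_1(x)\overline{\varphi_2(x)}\psi(\xi)\,d\bar\mu(x,\xi),$$ where $\bar\mu$ is the entrywise complex conjugate. $\mu$ is called the one-scale H-measure with characteristic length $(\omega_n)$ associated to the (sub)sequence. *)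

(* Defs.v *)
From HB Require Import structures.
From mathcomp Require Import all_boot all_order all_algebra.
From mathcomp Require Import complex.
From mathcomp Require Import all_classical all_reals all_analysis.
Set Implicit Arguments.
Unset Strict Implicit.
Unset Printing Implicit Defensive.
Import Order.TTheory GRing.Theory Num.Theory.
Import numFieldNormedType.Exports.
Local Open Scope classical_set_scope.
Local Open Scope ring_scope.

(* The usual topology of R[i], which the library only provides on R[i]^o. *)
HB.instance Definition _ (R : realType) := NormedModule.copy R[i] R[i]^o.

Section LebesgueMeasure.
Variable R : realType.
Let RT := measurableTypeR R.

Definition tcons n (p : RT * n.-tuple RT) : n.+1.-tuple RT :=
  [tuple of p.1 :: p.2].

Lemma measurable_tcons n : measurable_fun setT (@tcons n).
Proof. by apply: measurable_cons. Qed.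

Definition tuncons n (t : n.+1.-tuple RT) : RT * n.-tuple RT :=
  (tnth t ord0, [tuple of behead t]).

Lemma measurable_tuncons n : measurable_fun setT (@tuncons n).
Proof.
apply: measurable_fun_pair; first exact: measurable_tnth.
exact: measurable_behead.
Qed.

Lemma tconsK n : cancel (@tcons n) (@tuncons n).
Proof.
by case=> x t; rewrite /tuncons /tcons /=; congr pair; apply/val_inj.
Qed.

Section step.
Variables (n : nat) (m : {sigma_finite_measure set (n.-tuple RT) -> \bar R}).

Let prod : {measure set (RT * n.-tuple RT)%type -> \bar R} :=
  ((@lebesgue_measure R) \x m)%E.

Definition leb_step : set (n.+1.-tuple RT) -> \bar R :=
  pushforward ((@lebesgue_measure R) \x m)%E (@tcons n).

Let push : {measure set (n.+1.-tuple RT) -> \bar R} :=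
  measure_function_pushforward__canonical__measure_function_Measure
    prod (@measurable_tcons n).

HB.instance Definition _ := isMeasure.Build _ _ _ leb_step
  (measure0 push) (measure_ge0 push) (@measure_semi_sigma_additive _ _ _ push).

Let leb_step_sigma_finite : sigma_finite setT leb_step.
Proof.
have /sigma_finiteP[F [TF ndF Foo]] := sigma_finiteT (@lebesgue_measure R).
have /sigma_finiteP[G [TG ndG Goo]] := sigma_finiteT m.
have preK (A : set (RT * n.-tuple RT)%type) :
    @tcons n @^-1` (@tuncons n @^-1` A) = A.
  by apply/seteqP; split => p; rewrite /preimage /= tconsK.
exists (fun k => @tuncons n @^-1` (F k `*` G k)).
  apply/seteqP; split => // t _.
  have [k1 _ Fk1] : (\bigcup_k F k) (tuncons t).1 by rewrite -TF.
  have [k2 _ Gk2] : (\bigcup_k G k) (tuncons t).2 by rewrite -TG.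
  exists (maxn k1 k2) => //; split.
    by move: Fk1; exact/subsetPset/ndF/leq_maxl.
  by move: Gk2; exact/subsetPset/ndG/leq_maxr.
move=> k; have [mF Fk] := Foo k; have [mG Gk] := Goo k; split.
  rewrite -[X in measurable X]setTI.
  by apply: measurable_tuncons => //; exact: measurableX.
rewrite /leb_step /pushforward preK product_measure1E//.
by rewrite lte_mul_pinfty// ge0_fin_numE.
Qed.

HB.instance Definition _ :=
  Measure_isSigmaFinite.Build _ _ _ leb_step leb_step_sigma_finite.

End step.

(* Lebesgue measure on R^n, as an iterated product. *)
Fixpoint leb n : {sigma_finite_measure set (n.-tuple RT) -> \bar R} :=
  match n with
  | 0 => dirac ([tuple] : 0.-tuple RT)
  | n'.+1 => leb_step (leb n')
  end.

Lemma leb_box n (A : 'I_n -> set RT) : (forall i, measurable (A i)) ->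
  leb n [set t | forall i, A i (tnth t i)] =
  (\prod_(i < n) @lebesgue_measure R (A i))%E.
Proof.
elim: n A => [|n IH] A mA.
  rewrite big_ord0 /= diracE (_ : [set _ | _] = setT) ?in_setT//.
  by apply/seteqP; split => // t _ [].
rewrite big_ord_recl/= /leb_step /pushforward.
rewrite -(IH (fun i => A (lift ord0 i)))//.
rewrite (_ : _ @^-1` _ =
  A ord0 `*` [set t | forall i, A (lift ord0 i) (tnth t i)]); last first.
  apply/seteqP; split => -[x t] /=; rewrite /tcons/=.
    by move=> H; split => [|i]; [exact: (H ord0)|have := H (lift ord0 i); rewrite tnthS].
  by move=> [Hx Ht] i; case: (unliftP ord0 i) => [j ->|->] //; rewrite tnthS.
rewrite product_measure1E//.
rewrite (_ : [set t | _] = \bigcap_(i in [set: 'I_n])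
    ((fun t : n.-tuple RT => tnth t i) @^-1` A (lift ord0 i))); last first.
  by apply/seteqP; split => t /= H i => [_|]; exact: H.
apply: fin_bigcap_measurable => // i _.
by rewrite -[X in measurable X]setTI; exact: measurable_tnth.
Qed.

End LebesgueMeasure.

Local Open Scope complex_scope.
Local Open Scope ring_scope.

Section Notions.
Variables (R : realType) (d : nat).
Local Notation C := R[i].
Local Notation E := 'rV[R]_d.
Local Notation Re := (@complex.Re R).
Local Notation Im := (@complex.Im R).

Definition cis (t : R) : C := cos t +i* sin t.
Definition csq (z : C) : R := Re z ^+ 2 + Im z ^+ 2.

Definition dotp (x y : E) : R := \sum_i x 0 i * y 0 i.
(* The norm `|x| provided by the library on 'rV[R]_d is the sup norm. *)
Definition enorm (x : E) : R := Num.sqrt (dotp x x).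

(* The library puts a measurable structure on d-tuples, not on 'rV[R]_d:
   functions on 'rV[R]_d are integrated through vec. *)
Definition vec (t : d.-tuple (measurableTypeR R)) : E := \row_i tnth t i.

Definition cmeasurable (D : set E) (f : E -> C) :=
  measurable_fun (vec @^-1` D) (fun t => Re (f (vec t)) : measurableTypeR R) /\
  measurable_fun (vec @^-1` D) (fun t => Im (f (vec t)) : measurableTypeR R).

Definition nnint (D : set E) (f : E -> R) : \bar R :=
  (\int[@leb R d]_(t in vec @^-1` D) (f (vec t))%:E)%E.

Definition cintegrable (f : E -> C) :=
  (@leb R d).-integrable setT (fun t => (Re (f (vec t)))%:E) /\
  (@leb R d).-integrable setT (fun t => (Im (f (vec t)))%:E).

Definition cint (f : E -> C) : C :=
  (\int[@leb R d]_t Re (f (vec t))) +i* (\int[@leb R d]_t Im (f (vec t))).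

Definition fourier (f : E -> C) : E -> C :=
  fun xi => cint (fun x => cis (- (2 * pi * dotp x xi)) * f x).

Definition basis_vec (i : 'I_d) : E := delta_mx 0 i.

Definition partial (i : 'I_d) (f : E -> C) : E -> C := fun x =>
  'D_(basis_vec i) (fun y => Re (f y)) x +i* 'D_(basis_vec i) (fun y => Im (f y)) x.

Definition partials (s : seq 'I_d) (f : E -> C) : E -> C := foldr partial f s.

Definition smooth (f : E -> C) := forall s : seq 'I_d,
  continuous (partials s f) /\
  forall i x, derivable (fun y => Re (partials s f y)) x (basis_vec i) /\
              derivable (fun y => Im (partials s f y)) x (basis_vec i).

(* Multi-indices bounded by m in each entry, which covers all those of
   length at most m. *)
Definition mindex (m : nat) := {ffun 'I_d -> 'I_m.+1}.
Definition mlen m (a : mindex m) : nat := \sum_i a i.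
Definition mono m (a : mindex m) (x : E) : R := \prod_i x 0 i ^+ a i.
Definition mpartial m (a : mindex m) (f : E -> C) : E -> C :=
  partials (flatten [seq nseq (a i) i | i <- enum 'I_d]) f.

Definition supported_in (Omega : set E) (f : E -> C) :=
  exists K : set E,
    [/\ compact K, K `<=` Omega & forall x, ~ K x -> f x = 0].

(* C_c(Omega) and C_c^oo(Omega), as functions extended by zero to R^d *)
Definition Cc (Omega : set E) (f : E -> C) :=
  continuous f /\ supported_in Omega f.
Definition test (Omega : set E) (f : E -> C) :=
  smooth f /\ supported_in Omega f.

Definition schwartz (g : E -> C) := smooth g /\
  forall (s : seq 'I_d) (N : nat), exists M : R,
    forall x, enorm x ^+ N * Normc.normc (partials s g x) <= M.

(* T is given as a total functional, but only its values on C_c^oo(Omega)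
   matter. *)
Definition distribution (Omega : set E) (T : (E -> C) -> C) :=
  (forall (a : C) (f g : E -> C), test Omega f -> test Omega g ->
     T (fun x => a * f x + g x) = a * T f + T g) /\
  (forall K : set E, compact K -> K `<=` Omega ->
     exists (N : nat) (B : R), forall f, smooth f ->
       (forall x, ~ K x -> f x = 0) ->
       forall M : R,
         (forall (s : seq 'I_d) x, (size s <= N)%N ->
            Normc.normc (partials s f x) <= M) ->
         Normc.normc (T f) <= B * M).

(* The product of the distribution T by the test function phi, as a functional
   on Schwartz functions. *)
Definition localize (phi : E -> C) (T : (E -> C) -> C) : (E -> C) -> C :=
  fun g => T (fun x => phi x * g x).

(* The Fourier transform of T, which is defined by duality on Schwartz
   functions, is the function h. *)
Definition is_fourier (T : (E -> C) -> C) (h : E -> C) :=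
  cmeasurable setT h /\
  forall g, schwartz g ->
    cintegrable (fun xi => h xi * g xi) /\
    T (fourier g) = cint (fun xi => h xi * g xi).

(* H^{-m}(R^d); temperedness of T follows from the weighted bound on h. *)
Definition Hneg (m : nat) (T : (E -> C) -> C) := exists2 h : E -> C,
  is_fourier T h &
  (nnint setT (fun xi => (csq (h xi) / (1 + enorm xi ^+ 2) ^+ m)%R) < +oo)%E.

Definition Hneg_loc (Omega : set E) (m : nat) (T : (E -> C) -> C) :=
  distribution Omega T /\
  forall phi, test Omega phi -> Hneg m (localize phi T).

Definition L2loc (Omega : set E) r (u : E -> 'cV[C]_r) :=
  (forall j, cmeasurable Omega (fun x => u x j 0)) /\
  forall K : set E, compact K -> K `<=` Omega ->
    (nnint K (fun x => (\sum_j csq (u x j 0))%R) < +oo)%E.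

(* The dual of L^2_loc(Omega; C^r) consists of the L^2 functions with compact
   support in Omega. *)
Definition weakly_to0 (Omega : set E) r (u : nat -> E -> 'cV[C]_r) :=
  (forall n, L2loc Omega (u n)) /\
  forall g : E -> 'cV[C]_r,
    (forall j, cmeasurable setT (fun x => g x j 0)) ->
    (nnint setT (fun x => (\sum_j csq (g x j 0))%R) < +oo)%E ->
    (forall j, supported_in Omega (fun x => g x j 0)) ->
    cint (fun x => \sum_j u n x j 0 * (g x j 0)^*) @[n --> \oo] --> (0 : C).

Definition solves (Omega : set E) l m q r (eps : R)
    (A : mindex m -> E -> 'M[C]_(q, r)) (u : E -> 'cV[C]_r)
    (f : 'I_q -> (E -> C) -> C) :=
  forall (phi : E -> C) (i : 'I_q), test Omega phi ->
    \sum_(a : mindex m | (l <= mlen a <= m)%N)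
      (eps ^+ (mlen a - l))%:C * (-1) ^+ mlen a *
      cint (fun x => (A a x *m u x) i 0 * mpartial a phi x)
    = f i phi.

Definition weight l m (eps : R) (xi : E) : R :=
  1 + \sum_(l <= s < m.+1) eps ^+ (s - l) * enorm xi ^+ s.

Definition weighted_fourier_to0 (Omega : set E) l m q (eps : nat -> R)
    (f : nat -> 'I_q -> (E -> C) -> C) :=
  forall phi, test Omega phi -> exists h : nat -> 'I_q -> E -> C,
    (forall n i, is_fourier (localize phi (f n i)) (h n i)) /\
    nnint setT (fun xi => \sum_i csq (h n i xi / (weight l m (eps n) xi)%:C))
      @[n --> \oo] --> 0%E.

(* The compactification K_{0,oo}(R^d), realised as S^{d-1} x [0, +oo]: the
   point (e, r) stands for r e if 0 < r < +oo, for 0^e if r = 0 and for oo^e if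
   r = +oo. *)
Definition K0oo : set (E * \bar R) :=
  [set p | enorm p.1 = 1 /\ (0 <= p.2)%E].

Definition polar (xi : E) : E * \bar R :=
  ((enorm xi)^-1 *: xi, (enorm xi)%:E).

(* Extension by continuity to K_{0,oo} of a function on R^d \ {0}; the value at
   0^e (resp. oo^e) is the limit along the ray of e at 0 (resp. +oo). *)
Definition extK (g : E -> R) (p : E * \bar R) : R :=
  match p.2 with
  | r%:E => if r == 0 then lim (g (t *: p.1) @[t --> 0^'+]) else g (r *: p.1)
  | +oo%E => lim (g (t *: p.1) @[t --> +oo])
  | -oo%E => 0
  end.

Definition symb l m (a : mindex m) (xi : E) : R :=
  mono a xi / (enorm xi ^+ l + enorm xi ^+ m).

Definition p1 l m q r (A : mindex m -> E -> 'M[C]_(q, r))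
    (z : E * (E * \bar R)) : 'M[C]_(q, r) :=
  \sum_(a : mindex m | (l <= mlen a <= m)%N)
    ((0 +i* (2 * pi)) ^+ mlen a * (extK (symb l a) z.2)%:C) *: A a z.1.

(* Complex Radon measures on a subset X of a topological space, as linear
   functionals on C_c(X) with the usual continuity (Bourbaki). The functional
   applied to Phi is the integral of Phi. *)

Section Radon.
Variable T : topologicalType.
Implicit Types (X : set T) (L : (T -> C) -> C) (Phi : T -> C).

Definition CcX X Phi := {within X, continuous Phi} /\
  exists K : set T,
    [/\ compact K, K `<=` X & forall z, X z -> ~ K z -> Phi z = 0].

(* By the second clause, L Phi only depends on the restriction of Phi to X. *)
Definition radon X L :=
  (forall (a : C) Phi Psi, CcX X Phi -> CcX X Psi ->
     L (fun z => a * Phi z + Psi z) = a * L Phi + L Psi) /\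
  (forall K : set T, compact K -> K `<=` X ->
     exists B : R, forall Phi, CcX X Phi ->
       (forall z, X z -> ~ K z -> Phi z = 0) ->
       forall M : R, 0 <= M -> (forall z, X z -> Normc.normc (Phi z) <= M) ->
         Normc.normc (L Phi) <= B * M).

Definition conj_radon L : (T -> C) -> C :=
  fun Phi => (L (fun z => (Phi z)^*))^*.

Definition hermitian_nonneg X r (mu : 'I_r -> 'I_r -> (T -> C) -> C) :=
  forall Phi, CcX X Phi -> (forall z, X z -> 0 <= Phi z) ->
    (forall j k, mu j k Phi = (mu k j Phi)^*) /\
    (forall v : 'I_r -> C,
       0 <= \sum_j \sum_k (v j)^* * mu j k Phi * v k).

(* The q x r matrix measure p mu^T *)
Definition mul_radon_tr q r (p : T -> 'M[C]_(q, r))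
    (mu : 'I_r -> 'I_r -> (T -> C) -> C) : 'I_q -> 'I_r -> (T -> C) -> C :=
  fun i j Phi => \sum_k mu j k (fun z => p z i k * Phi z).

End Radon.

Definition one_scale_Hmeasure (Omega : set E) r (u : nat -> E -> 'cV[C]_r)
    (omega : nat -> R) (mu : 'I_r -> 'I_r -> (E * (E * \bar R) -> C) -> C) :=
  [/\ forall j k, radon (Omega `*` K0oo) (mu j k),
      hermitian_nonneg (Omega `*` K0oo) mu &
      forall phi1 phi2 : E -> C, Cc Omega phi1 -> Cc Omega phi2 ->
      forall psi : E * \bar R -> C, {within K0oo, continuous psi} ->
      forall j k : 'I_r,
        cint (fun xi => fourier (fun x => phi1 x * u n x j 0) xi *
                        (fourier (fun x => phi2 x * u n x k 0) xi)^* *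
                        psi (polar (omega n *: xi))) @[n --> \oo]
        --> conj_radon (mu j k)
              (fun z => phi1 z.1 * (phi2 z.1)^* * psi z.2)].

End Notions.

(* Main.v *)
Require Import Defs.
From mathcomp Require Import all_boot all_order all_algebra.
From mathcomp Require Import complex ring lra zify.
From mathcomp Require Import all_classical all_reals all_analysis measurable_realfun.
Import Order.TTheory GRing.Theory Num.Theory.
Import numFieldNormedType.Exports.
Set Implicit Arguments.
Unset Strict Implicit.
Unset Printing Implicit Defensive.
Local Open Scope classical_set_scope.
Local Open Scope ring_scope.
Local Open Scope complex_scope.
Local Open Scope ring_scope.
Local Notation Re := (@complex.Re _).
Local Notation Im := (@complex.Im _).
Local Notation normc := Normc.normc.

(* Let phi be a product of one-dimensional bumps supported in a box in Omega.
   Testing the equation against phi times a Fourier transform and using the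
   Leibniz rule, the Fourier transform of phi f_n is almost everywhere the sum
   over al and over be <= al of
     eps^(|al|-l) (-1)^|al| binom(al, be) (-2 pi i xi)^(al-be) F(A^al (d^be phi) u_n)
   (F being the Fourier transform). Divide it by
   D(xi) = |xi|^l + eps^(m-l) |xi|^m, which is comparable with the weight of the
   hypothesis for |xi| >= 1. The terms with be = 0 become the symbol of p_1 at
   eps xi applied to F(phi A^al u_n); those with be <> 0 gain a factor 1/|xi|.
   For |xi| < 1 the symbols are bounded by 1. Hence all the errors are controlled
   in L^2 by F(theta u_n) / sqrt (1 + |xi|^2) with theta in C_c(Omega), which
   tends to 0: F(theta u_n) tends to 0 pointwise by weak convergence, it is
   bounded in L^2 (take psi = 1 in the definition of the H-measure), and it is
   bounded uniformly, as the convolution of F(theta u_n / chi) with an L^2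
   function of Fourier transform chi. So
   sum_al (2 pi i)^|al| symb_al(eps xi) F(phi A^al u_n) tends to 0 in L^2, and
   pairing it with F(phi2 u_n) psi(eps xi) gives, in the limit, that p_1 mu^T
   vanishes on phi phi2^* psi. The span of such products is dense, by a partition
   of unity made of the bumps phi and compactness of K_{0,oo}, and Radon measures
   are continuous, so p_1 mu^T = 0. *)

(** * Integrals of complex functions *)

Section ComplexNumbers.
Variable R : realType.
Local Notation C := R[i].
Implicit Types z w : C.

(** The Fourier analysis rests on two facts: the exchange formula [FT_dual], which is Fubini, and
    the square-integrability of transforms of compactly supported functions, which is Bessel's
    inequality applied on all translates of a lattice. Bumps are products so that derivatives,
    integrals and transforms reduce to one variable. The equation holds in the sense of
    distributions and the coefficients are merely continuous, so every derivative must fall on the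
    test function; taking it to be phi F(G), with G smooth and compactly supported, lets the
    exchange formula turn each term into an integral against G, and such G determine a function
    almost everywhere. Weak convergence is exploited one frequency at a time, and the uniform bounds
    that dominated convergence requires come out of the existence of the H-measure. The weight of
    the hypothesis does not have the shape of the symbol: its summand 1 and its intermediate powers
    are traded for D, which degenerates at the origin when l > 0. Hence the separate treatment of
    |xi| < 1, where 1 / (1 + |xi|^2) is bounded below. *)

Lemma ReD z w : Re (z + w) = Re z + Re w. Proof. by case: z w => [? ?] []. Qed.
Lemma ImD z w : Im (z + w) = Im z + Im w. Proof. by case: z w => [? ?] []. Qed.
Lemma ReN z : Re (- z) = - Re z. Proof. by case: z. Qed.
Lemma ImN z : Im (- z) = - Im z. Proof. by case: z. Qed.
Lemma ReM z w : Re (z * w) = Re z * Re w - Im z * Im w.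
Proof. by case: z w => [? ?] []. Qed.
Lemma ImM z w : Im (z * w) = Re z * Im w + Im z * Re w.
Proof. by case: z w => [? ?] []. Qed.
Lemma ReJ z : Re z^* = Re z. Proof. by case: z. Qed.
Lemma ImJ z : Im z^* = - Im z. Proof. by case: z. Qed.

Lemma complexP z w : Re z = Re w -> Im z = Im w -> z = w.
Proof. by case: z w => [a b] [c e] /= -> ->. Qed.

Lemma conjC_R (x : R) : (x%:C)^* = x%:C :> C.
Proof. by apply: complexP; rewrite ?ReJ ?ImJ /= ?oppr0. Qed.

Lemma Re_sum I (s : seq I) (P : pred I) (F : I -> C) :
  Re (\sum_(i <- s | P i) F i) = \sum_(i <- s | P i) Re (F i).
Proof. by elim/big_rec2: _ => // i x y _ <-; rewrite ReD. Qed.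
Lemma Im_sum I (s : seq I) (P : pred I) (F : I -> C) :
  Im (\sum_(i <- s | P i) F i) = \sum_(i <- s | P i) Im (F i).
Proof. by elim/big_rec2: _ => // i x y _ <-; rewrite ImD. Qed.

Lemma csqE z : csq z = normc z ^+ 2.
Proof. by case: z => a b; rewrite /csq /= sqr_sqrtr// addr_ge0 ?sqr_ge0. Qed.

Lemma csq_ge0 z : 0 <= csq z. Proof. by rewrite csqE sqr_ge0. Qed.

Lemma csqM z w : csq (z * w) = csq z * csq w.
Proof. by rewrite !csqE Normc.normcM exprMn. Qed.

Lemma csqJ z : csq z^* = csq z.
Proof. by case: z => a b; rewrite /csq /= sqrrN. Qed.

Lemma csq0 : csq (0 : C) = 0. Proof. by rewrite /csq /= expr0n addr0. Qed.

Lemma csq_cis (t : R) : csq (cis t) = 1.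
Proof. by rewrite /csq /cis /= cos2Dsin2. Qed.

Lemma normc_ge0 z : 0 <= normc z.
Proof. by case: z => a b; exact: sqrtr_ge0. Qed.

Lemma normc_cis (t : R) : normc (cis t) = 1.
Proof. by rewrite /cis /= cos2Dsin2 sqrtr1. Qed.

Lemma normc_Re z : `|Re z| <= normc z.
Proof.
by case: z => a b; rewrite -sqrtr_sqr ler_wsqrtr//= lerDl sqr_ge0.
Qed.

Lemma normc_Im z : `|Im z| <= normc z.
Proof.
by case: z => a b; rewrite -sqrtr_sqr ler_wsqrtr//= lerDr sqr_ge0.
Qed.

Lemma normc_ReIm z : normc z <= `|Re z| + `|Im z|.
Proof.
have h : 0 <= `|Re z| + `|Im z| by rewrite addr_ge0.
rewrite -(@ler_pXn2r _ 2)// ?nnegrE ?normc_ge0// -csqE /csq.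
rewrite sqrrD !real_normK ?num_real//.
by rewrite lerD2r lerDl mulrn_wge0// mulr_ge0.
Qed.

Lemma normcC (x : R) : normc x%:C = `|x|.
Proof. by rewrite /= expr0n addr0 sqrtr_sqr. Qed.

Lemma normcJ z : normc z^* = normc z.
Proof. by case: z => a b; rewrite /= sqrrN. Qed.

Lemma normc_sum I (s : seq I) (P : pred I) (F : I -> C) :
  normc (\sum_(i <- s | P i) F i) <= \sum_(i <- s | P i) normc (F i).
Proof.
elim/big_rec2: _ => [|i x y _ h]; first by rewrite Normc.normc0.
by rewrite (le_trans (le_normcD _ _))// lerD2l.
Qed.

Lemma csqD z w : csq (z + w) <= 2 * csq z + 2 * csq w.
Proof.
rewrite /csq ReD ImD; move: (Re z) (Im z) (Re w) (Im w) => a b c e.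
have := sqr_ge0 (a - c); have := sqr_ge0 (b - e); rewrite !sqrrB !sqrrD; lra.
Qed.

(** Iterating [csqD] doubles the constant at each summand, whence [2 ^+ size s]. *)
Lemma csq_sum I (s : seq I) (P : pred I) (F : I -> C) :
  csq (\sum_(i <- s | P i) F i) <=
    2 ^+ size s * \sum_(i <- s | P i) csq (F i).
Proof.
elim: s => [|i s IH]; first by rewrite !big_nil csq0 mulr0.
have S0 : 0 <= \sum_(j <- s | P j) csq (F j).
  by apply: sumr_ge0 => j _; exact: csq_ge0.
have e1 : 1 <= (2 : R) ^+ size s by rewrite exprn_ege1// ler1n.
rewrite !big_cons /=; case: ifP => _.
  apply: (le_trans (csqD _ _)).
  move: IH (csq_ge0 (F i)) S0; rewrite exprS.
  by move: (csq (F i)) (\sum_(j <- s | P j) csq (F j)) (csq _) => a b c; nra.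
apply: (le_trans IH); rewrite exprS -mulrA ler_peMl ?ler1n//.
by rewrite mulr_ge0// (le_trans _ e1).
Qed.

Lemma cisD (s t : R) : cis (s + t) = cis s * cis t.
Proof.
rewrite /cis sinD cosD; apply: complexP => /=; first by [].
by rewrite addrC.
Qed.

Lemma cis0 : cis (0 : R) = 1.
Proof. by rewrite /cis sin0 cos0. Qed.

Lemma cisN (t : R) : cis (- t) = (cis t)^*.
Proof. by rewrite /cis sinN cosN. Qed.

Lemma cis_sum I (s : seq I) (P : pred I) (F : I -> R) :
  cis (\sum_(i <- s | P i) F i) = \prod_(i <- s | P i) cis (F i).
Proof. by elim/big_rec2: _ => [|i x y _ <-]; rewrite ?cis0 ?cisD. Qed.

End ComplexNumbers.

Section ComplexIntegral.
Context {d} {T : measurableType d} {R : realType}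
  (mu : {measure set T -> \bar R}).
Local Notation C := R[i].
Implicit Types f g : T -> C.

Lemma ge0_integrable (h : T -> R) : measurable_fun setT h ->
  (forall t, 0 <= h t) -> (\int[mu]_t (h t)%:E < +oo)%E ->
  mu.-integrable setT (fun t => (h t)%:E).
Proof.
move=> mh h0 hoo; apply/integrableP; split; first exact/measurable_EFinP.
rewrite (eq_integral (fun t => (h t)%:E))// => t _.
by rewrite /= ger0_norm.
Qed.

Definition cmeas f :=
  measurable_fun setT (fun t => Re (f t)) /\
  measurable_fun setT (fun t => Im (f t)).

Definition CI f :=
  mu.-integrable setT (fun t => (Re (f t))%:E) /\
  mu.-integrable setT (fun t => (Im (f t))%:E).

(** Defined over an arbitrary measure because it serves on the line, on tuples and on products; for
    [leb R d] and a function composed with [vec] it unfolds to the [cint] of the statement. *)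
Definition CInt f : C :=
  (\int[mu]_t Re (f t)) +i* (\int[mu]_t Im (f t)).

Lemma cmeas_cst (a : C) : cmeas (cst a).
Proof. by split; exact: measurable_cst. Qed.

Lemma cmeasD f g : cmeas f -> cmeas g -> cmeas (fun t => f t + g t).
Proof.
move=> [f1 f2] [g1 g2]; split.
  under eq_fun do rewrite ReD; exact: measurable_funD.
under eq_fun do rewrite ImD; exact: measurable_funD.
Qed.

Lemma cmeasM f g : cmeas f -> cmeas g -> cmeas (fun t => f t * g t).
Proof.
move=> [f1 f2] [g1 g2]; split.
  under eq_fun do rewrite ReM.
  by apply: measurable_funB; exact: measurable_funM.
under eq_fun do rewrite ImM.
by apply: measurable_funD; exact: measurable_funM.
Qed.

Lemma cmeasJ f : cmeas f -> cmeas (fun t => (f t)^*).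
Proof.
move=> [f1 f2]; split.
  by under eq_fun do rewrite ReJ.
under eq_fun do rewrite ImJ; exact: measurableT_comp.
Qed.

Lemma cmeas_sum I (s : seq I) (P : pred I) (F : I -> T -> C) :
  (forall i, P i -> cmeas (F i)) ->
  cmeas (fun t => \sum_(i <- s | P i) F i t).
Proof.
move=> h; elim: s => [|i s IH].
  rewrite (_ : (fun t => _) = cst 0); first exact: cmeas_cst.
  by apply/funext => t; rewrite big_nil.
rewrite (_ : (fun t => _) = fun t => if P i then F i t + \sum_(j <- s | P j) F j t
                                     else \sum_(j <- s | P j) F j t);
  last by apply/funext => t; rewrite big_cons.
by case: (boolP (P i)) => // Pi; apply: cmeasD => //; exact: h.
Qed.

Lemma cmeas_prod I (s : seq I) (P : pred I) (F : I -> T -> C) :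
  (forall i, P i -> cmeas (F i)) ->
  cmeas (fun t => \prod_(i <- s | P i) F i t).
Proof.
move=> h; elim: s => [|i s IH].
  rewrite (_ : (fun t => _) = cst 1); first exact: cmeas_cst.
  by apply/funext => t; rewrite big_nil.
rewrite (_ : (fun t => _) = fun t => if P i then F i t * \prod_(j <- s | P j) F j t
                                     else \prod_(j <- s | P j) F j t);
  last by apply/funext => t; rewrite big_cons.
by case: (boolP (P i)) => // Pi; apply: cmeasM => //; exact: h.
Qed.

Lemma cmeasC (h : T -> R) :
  measurable_fun setT h -> cmeas (fun t => (h t)%:C).
Proof. by move=> mh; split => //=; exact: measurable_cst. Qed.

Lemma cmeas_cis (h : T -> R) :
  measurable_fun setT h -> cmeas (fun t => cis (h t)).
Proof.
move=> mh; split => /=.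
  apply: (measurableT_comp _ mh).
  by apply: continuous_measurable_fun; exact: continuous_cos.
apply: (measurableT_comp _ mh).
by apply: continuous_measurable_fun; exact: continuous_sin.
Qed.

Lemma measurable_csq f : cmeas f -> measurable_fun setT (fun t => csq (f t)).
Proof.
move=> [f1 f2]; rewrite /csq.
by apply: measurable_funD; exact: measurable_funX.
Qed.

Lemma measurable_normc f :
  cmeas f -> measurable_fun setT (fun t => normc (f t)).
Proof.
move=> mf; have -> : (fun t => normc (f t)) = (fun t => Num.sqrt (csq (f t))).
  by apply/funext => t; rewrite /csq; case: (f t).
apply: (measurableT_comp _ (measurable_csq mf)).
by apply: continuous_measurable_fun; exact: sqrt_continuous.
Qed.

Lemma CI_meas f : CI f -> cmeas f.
Proof.
by move=> [/measurable_int/measurable_EFinP ? /measurable_int/measurable_EFinP ?].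
Qed.

Lemma CI_dom f (G : T -> R) : cmeas f ->
  mu.-integrable setT (fun t => (G t)%:E) ->
  (forall t, normc (f t) <= G t) -> CI f.
Proof.
move=> [f1 f2] iG fG; split.
  apply: (le_integrable _ _ _ iG) => //; first exact/measurable_EFinP.
  move=> t _; rewrite /= lee_fin (le_trans (normc_Re _))//.
  by rewrite (le_trans (fG t))// ler_norm.
apply: (le_integrable _ _ _ iG) => //; first exact/measurable_EFinP.
move=> t _; rewrite /= lee_fin (le_trans (normc_Im _))//.
by rewrite (le_trans (fG t))// ler_norm.
Qed.

Lemma CI_normc f : CI f -> mu.-integrable setT (fun t => (normc (f t))%:E).
Proof.
move=> If; have [f1 f2] := If.
have i12 : mu.-integrable setT (fun t => (`|Re (f t)| + `|Im (f t)|)%:E).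
  under eq_fun do rewrite EFinD.
  by apply: integrableD => //; exact: integrable_norm.
apply: (le_integrable _ _ _ i12) => //.
  by apply/measurable_EFinP/measurable_normc; exact: CI_meas.
move=> t _; rewrite /= lee_fin (ger0_norm (normc_ge0 _)).
rewrite [leRHS]ger0_norm ?addr_ge0//.
exact: normc_ReIm.
Qed.

Lemma CI_le f g : cmeas f -> CI g ->
  (forall t, normc (f t) <= normc (g t)) -> CI f.
Proof. by move=> mf /CI_normc ig fg; exact: CI_dom ig fg. Qed.

Lemma CI0 : CI (fun=> 0).
Proof. by split; exact: integrable0. Qed.

Lemma CI_D f g : CI f -> CI g -> CI (fun t => f t + g t).
Proof.
move=> [f1 f2] [g1 g2]; split.
  under eq_fun do rewrite ReD EFinD; exact: integrableD.
under eq_fun do rewrite ImD EFinD; exact: integrableD.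
Qed.

Lemma CI_Z (a : C) f : CI f -> CI (fun t => a * f t).
Proof.
move=> If; have mf := CI_meas If.
have iN : mu.-integrable setT (fun t => (normc a * normc (f t))%:E).
  under eq_fun do rewrite EFinM.
  by apply: integrableZl => //; exact: CI_normc.
apply: (CI_dom _ iN) => [|t]; last by rewrite Normc.normcM.
by apply: cmeasM => //; exact: cmeas_cst.
Qed.

Lemma CI_J f : CI f -> CI (fun t => (f t)^*).
Proof.
move=> If; apply: (CI_le _ If); first by apply: cmeasJ; exact: CI_meas.
by move=> t; rewrite normcJ.
Qed.

Lemma CI_sum I (s : seq I) (P : pred I) (F : I -> T -> C) :
  (forall i, P i -> CI (F i)) ->
  CI (fun t => \sum_(i <- s | P i) F i t).
Proof.
move=> h; elim: s => [|i s IH].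
  rewrite (_ : (fun t => _) = fun=> 0); first exact: CI0.
  by apply/funext => t; rewrite big_nil.
rewrite (_ : (fun t => _) = fun t => if P i then F i t + \sum_(j <- s | P j) F j t
                                     else \sum_(j <- s | P j) F j t);
  last by apply/funext => t; rewrite big_cons.
by case: (boolP (P i)) => // Pi; apply: CI_D => //; exact: h.
Qed.

Lemma CInt_D f g : CI f -> CI g ->
  CInt (fun t => f t + g t) = CInt f + CInt g.
Proof.
move=> [f1 f2] [g1 g2]; apply: complexP; rewrite /CInt /=.
  by under eq_Rintegral do rewrite ReD; rewrite RintegralD.
by under eq_Rintegral do rewrite ImD; rewrite RintegralD.
Qed.

Lemma CInt_Z (a : C) f : CI f -> CInt (fun t => a * f t) = a * CInt f.
Proof.
move=> [f1 f2].
have h (x : R) (k : T -> R) : mu.-integrable setT (EFin \o k) ->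
    mu.-integrable setT (EFin \o (fun t => x * k t)).
  by move=> ik; rewrite /comp; under eq_fun do rewrite EFinM;
     exact: integrableZl.
apply: complexP; rewrite ?ReM ?ImM /CInt /=.
  under eq_Rintegral do rewrite ReM.
  by rewrite RintegralB// ?RintegralZl//; exact: h.
under eq_Rintegral do rewrite ImM.
by rewrite RintegralD// ?RintegralZl//; exact: h.
Qed.

Lemma CInt0 : CInt (fun=> 0) = 0.
Proof. by apply: complexP; rewrite /CInt /= /Rintegral integral0. Qed.

Lemma CInt_J f : CI f -> CInt (fun t => (f t)^*) = (CInt f)^*.
Proof.
move=> [f1 f2]; apply: complexP; rewrite ?ReJ ?ImJ /CInt /=.
  by under eq_Rintegral do rewrite ReJ.
under eq_Rintegral do rewrite ImJ -mulN1r.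
by rewrite RintegralZl// mulN1r.
Qed.

Lemma CInt_sum I (s : seq I) (P : pred I) (F : I -> T -> C) :
  (forall i, P i -> CI (F i)) ->
  CInt (fun t => \sum_(i <- s | P i) F i t) = \sum_(i <- s | P i) CInt (F i).
Proof.
move=> h; elim: s => [|i s IH].
  rewrite big_nil -[RHS]CInt0; congr CInt; apply/funext => t.
  by rewrite big_nil.
rewrite (_ : (fun t => _) = fun t => if P i then F i t + \sum_(j <- s | P j) F j t
                                     else \sum_(j <- s | P j) F j t);
  last by apply/funext => t; rewrite big_cons.
rewrite big_cons; case: (boolP (P i)) => // Pi.
rewrite CInt_D ?IH//; first exact: h.
exact: CI_sum.
Qed.

Lemma eq_CInt f g : f =1 g -> CInt f = CInt g.
Proof. by move=> /funext ->. Qed.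

Lemma CI_ReIm f (fr fi : T -> R) :
  (forall x, Re (f x) = fr x) -> (forall x, Im (f x) = fi x) ->
  mu.-integrable setT (fun x => (fr x)%:E) ->
  mu.-integrable setT (fun x => (fi x)%:E) ->
  CI f /\ CInt f = (\int[mu]_x fr x) +i* (\int[mu]_x fi x).
Proof.
move=> /funext hr /funext hi ir ii.
have er := congr1 (fun k : T -> R => (fun t => (k t)%:E)) hr.
have ei := congr1 (fun k : T -> R => (fun t => (k t)%:E)) hi.
by split; [split; rewrite ?er ?ei|rewrite /CInt hr hi].
Qed.

(* The factor 2 comes from bounding the real and imaginary parts separately. *)
Lemma normc_CInt f (G : T -> R) : CI f ->
  mu.-integrable setT (fun t => (G t)%:E) ->
  (forall t, normc (f t) <= G t) -> normc (CInt f) <= 2 * \int[mu]_t G t.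
Proof.
move=> [f1 f2] iG fG.
apply: (le_trans (normc_ReIm _)); rewrite mulrDl !mul1r lerD//.
  apply: (le_trans (le_normr_Rintegral _ _)) => //.
  apply: le_Rintegral => //; first exact: integrable_norm.
  by move=> t _; rewrite (le_trans (normc_Re _)).
apply: (le_trans (le_normr_Rintegral _ _)) => //.
apply: le_Rintegral => //; first exact: integrable_norm.
by move=> t _; rewrite (le_trans (normc_Im _)).
Qed.

End ComplexIntegral.

Section Fubini.
Context {d1 d2} {T1 : measurableType d1} {T2 : measurableType d2} {R : realType}.
Variables (m1 : {sigma_finite_measure set T1 -> \bar R})
          (m2 : {sigma_finite_measure set T2 -> \bar R}).

Let abse_fine_le (e : \bar R) : (`|(fine e)%:E| <= `|e|)%E.
Proof. by case: e => //=; rewrite normr0 leey. Qed.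

(** The real inner integral agrees with the extended one wherever the latter is finite, that is
    almost everywhere; elsewhere [fine] returns 0, which can only decrease the absolute value and so
    preserves integrability. *)
Lemma Rfubini1 (f : T1 * T2 -> R) :
  (m1 \x m2)%E.-integrable setT (fun z => (f z)%:E) ->
  m1.-integrable setT (fun x => (\int[m2]_y f (x, y))%:E) /\
  \int[m1]_x \int[m2]_y f (x, y) = \int[(m1 \x m2)%E]_z f z.
Proof.
move=> If; have iF := integrable_fubini_F If.
have ae : ae_eq m1 setT (fubini_F m2 (fun z => (f z)%:E))
    (fun x => (\int[m2]_y f (x, y))%:E).
  apply: filterS (integrable_ae measurableT iF) => x /(_ I) fx _.
  by rewrite /Rintegral fineK.
have mF : measurable_fun setT (fun x => (\int[m2]_y f (x, y))%:E).
  apply/measurable_EFinP; rewrite /Rintegral.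
  by apply: (measurableT_comp (fine_measurable measurableT));
    exact: measurable_int iF.
split; last first.
  rewrite /Rintegral -(integral12_prod_meas1 If); congr fine.
  by apply: ae_eq_integral => //; [exact: measurable_int iF|exact: ae_eq_sym].
apply: (le_integrable _ mF _ iF) => // x _ /=.
exact: abse_fine_le.
Qed.

Lemma Rfubini2 (f : T1 * T2 -> R) :
  (m1 \x m2)%E.-integrable setT (fun z => (f z)%:E) ->
  m2.-integrable setT (fun y => (\int[m1]_x f (x, y))%:E) /\
  \int[m2]_y \int[m1]_x f (x, y) = \int[(m1 \x m2)%E]_z f z.
Proof.
move=> If; have mf := measurable_int _ If.
have iF : m2.-integrable setT (fubini_G m1 (fun z => (f z)%:E)).
  apply/integrableP; split; first exact: measurable_fubini_G If.
  apply: (le_lt_trans _ ((integrable21ltyP m1 m2 mf).1 If)).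
  have mG := measurable_fubini_G If.
  apply: ge0_le_integral => //.
  - exact: measurableT_comp.
  - apply: (measurable_fun_fubini_tonelli_G (fun z => `|(f z)%:E|%E)) => //.
    exact: measurableT_comp.
  - move=> y ?; apply: le_abse_integral => //.
    by apply: (measurableT_comp mf); exact: pair2_measurable.
have ae : ae_eq m2 setT (fubini_G m1 (fun z => (f z)%:E))
    (fun y => (\int[m1]_x f (x, y))%:E).
  apply: filterS (integrable_ae measurableT iF) => x /(_ I) fx _.
  by rewrite /Rintegral fineK.
have mF : measurable_fun setT (fun y => (\int[m1]_x f (x, y))%:E).
  apply/measurable_EFinP; rewrite /Rintegral.
  by apply: (measurableT_comp (fine_measurable measurableT));
    exact: measurable_int iF.
split; last first.
  rewrite /Rintegral -(integral21_prod_meas1 If); congr fine.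
  by apply: ae_eq_integral => //; [exact: measurable_int iF|exact: ae_eq_sym].
apply: (le_integrable _ mF _ iF) => // x _ /=.
exact: abse_fine_le.
Qed.

Lemma Cfubini1 (f : T1 * T2 -> R[i]) : CI (m1 \x m2)%E f ->
  CI m1 (fun x => CInt m2 (fun y => f (x, y))) /\
  CInt m1 (fun x => CInt m2 (fun y => f (x, y))) = CInt (m1 \x m2)%E f.
Proof.
move=> [/Rfubini1[r1 r2] /Rfubini1[i1 i2]]; split; first by split.
by rewrite /CInt /= r2 i2.
Qed.

Lemma Cfubini2 (f : T1 * T2 -> R[i]) : CI (m1 \x m2)%E f ->
  CI m2 (fun y => CInt m1 (fun x => f (x, y))) /\
  CInt m2 (fun y => CInt m1 (fun x => f (x, y))) = CInt (m1 \x m2)%E f.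
Proof.
move=> [/Rfubini2[r1 r2] /Rfubini2[i1 i2]]; split; first by split.
by rewrite /CInt /= r2 i2.
Qed.

(** The majorant factorises, so Tonelli makes its integral the product of two finite ones. *)
Lemma CI_prod_bound (f : T1 * T2 -> R[i]) (a : T1 -> R[i]) (b : T2 -> R[i]) :
  cmeas f -> CI m1 a -> CI m2 b ->
  (forall x y, normc (f (x, y)) <= normc (a x) * normc (b y)) ->
  CI (m1 \x m2)%E f.
Proof.
move=> mf Ia Ib fab.
pose G (z : T1 * T2) := normc (a z.1) * normc (b z.2).
have mG : measurable_fun setT G.
  apply: measurable_funM.
    exact: (measurableT_comp (measurable_normc (CI_meas Ia))).
  exact: (measurableT_comp (measurable_normc (CI_meas Ib))).
have iG : (m1 \x m2)%E.-integrable setT (fun z => (G z)%:E).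
  apply/integrable12ltyP; first exact/measurable_EFinP.
  have /integrableP[ma la] := CI_normc Ia.
  have /integrableP[mb lb] := CI_normc Ib.
  have eqi x : (\int[m2]_y `|(G (x, y))%:E| =
      (normc (a x))%:E * \int[m2]_y (normc (b y))%:E)%E.
    rewrite -ge0_integralZl//; last 2 first.
      by move=> *; rewrite lee_fin normc_ge0.
      by rewrite lee_fin normc_ge0.
    apply: eq_integral => y _; rewrite /G /= ger0_norm ?EFinM//.
    by rewrite mulr_ge0// normc_ge0.
  under eq_integral do rewrite eqi.
  have eqb : (\int[m2]_y (normc (b y))%:E = \int[m2]_y `|(normc (b y))%:E|)%E.
    by apply: eq_integral => y _ /=; rewrite ger0_norm// normc_ge0.
  have eqa : (\int[m1]_y (normc (a y))%:E = \int[m1]_y `|(normc (a y))%:E|)%E.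
    by apply: eq_integral => y _ /=; rewrite ger0_norm// normc_ge0.
  rewrite ge0_integralZr//; last 2 first.
    by move=> *; rewrite lee_fin normc_ge0.
    by apply: integral_ge0 => *; rewrite lee_fin normc_ge0.
  by rewrite eqa eqb lte_mul_pinfty ?integral_ge0// ge0_fin_numE ?integral_ge0.
by apply: (CI_dom mf iG) => -[x y]; exact: fab.
Qed.

End Fubini.

Section LebesgueTuple.
Variable R : realType.
Local Notation RT := (measurableTypeR R).
Local Notation C := R[i].

Lemma integral_leb_step n (f : n.+1.-tuple RT -> \bar R) :
  measurable_fun setT f -> (forall t, (0 <= f t)%E) ->
  (\int[leb R n.+1]_t f t =
   \int[((@lebesgue_measure R) \x leb R n)%E]_p f (tcons p))%E.
Proof.
move=> mf f0.
have := @ge0_integral_pushforward _ _ _ _ _ _ (@measurable_tcons R n)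
  ((@lebesgue_measure R) \x leb R n)%E setT f measurableT mf (fun y _ => f0 y).
rewrite preimage_setT => <-.
by apply: eq_measure_integral => //; exact: measurable_tcons.
Qed.

Lemma Rintegral_leb_step n (f : n.+1.-tuple RT -> R) :
  measurable_fun setT f ->
  ((@lebesgue_measure R) \x leb R n)%E.-integrable setT
    (fun p => (f (tcons p))%:E) ->
  (leb R n.+1).-integrable setT (fun t => (f t)%:E) /\
  \int[leb R n.+1]_t f t =
   \int[((@lebesgue_measure R) \x leb R n)%E]_p f (tcons p).
Proof.
move=> mf If; split.
  apply/integrableP; split; first exact/measurable_EFinP.
  rewrite integral_leb_step//; last by do 2!apply: measurableT_comp => //.
  by case/integrableP : If.
have mf' : measurable_fun setT (fun t => (f t)%:E) by exact/measurable_EFinP.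
have := @integral_pushforward _ _ _ _ _ _ (@measurable_tcons R n)
  ((@lebesgue_measure R) \x leb R n)%E setT _ mf'.
rewrite preimage_setT => /(_ If measurableT) h.
rewrite /Rintegral -[X in _ = fine X]h; congr fine.
Qed.

(** Fubini along [tcons] peels off one coordinate at a time, down to a Dirac mass whose integral of
    1 is the empty product. The explicit integrals in several variables (orthogonality, kernels,
    transforms of bumps) are products and pass through here. *)
Lemma CI_tensor n (F : 'I_n -> R -> C) :
  (forall i, CI (@lebesgue_measure R) (F i)) ->
  CI (leb R n) (fun t => \prod_i F i (tnth t i)) /\
  CInt (leb R n) (fun t => \prod_i F i (tnth t i)) =
    \prod_i CInt (@lebesgue_measure R) (F i).
Proof.
elim: n F => [|n IH] F IF.
  rewrite big_ord0.
  have -> : (fun t : 0.-tuple RT => \prod_i F i (tnth t i)) = cst 1.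
    by apply/funext => t; rewrite big_ord0.
  have i1 (c : R) : (leb R 0).-integrable setT (fun=> c%:E).
    apply/integrableP; split; first exact: measurable_cst.
    by rewrite integral_dirac//= diracT mul1e ltey.
  have d1 : leb R 0 setT = 1%E by rewrite /= diracT.
  have c1 (c : R) : \int[leb R 0]_t c = c.
    by rewrite Rintegral_cst// [X in fine X]d1 mulr1.
  split; first by split => /=; exact: i1.
  by apply: complexP; exact: c1.
have [IG EG] := IH (fun i => F (lift ord0 i)) (fun i => IF _).
pose h p := F ord0 p.1 * \prod_i F (lift ord0 i) (tnth (p.2 : n.-tuple RT) i).
have mP : cmeas (fun t : n.+1.-tuple RT => \prod_i F i (tnth t i)).
  apply: cmeas_prod => i _; have [/measurable_int/measurable_EFinP m1
    /measurable_int/measurable_EFinP m2] := IF i.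
  by split; [apply: (measurableT_comp m1)|apply: (measurableT_comp m2)];
    exact: measurable_tnth.
have Ph p : \prod_i F i (tnth (tcons p) i) = h p.
  rewrite big_ord_recl /h /=; congr (_ * _).
  by apply: eq_bigr => i _; rewrite tnthS.
have mh : cmeas h.
  have -> : h = (fun t : n.+1.-tuple RT => \prod_i F i (tnth t i)) \o @tcons R n.
    by apply/funext => p /=; rewrite Ph.
  by case: mP => m1 m2; split; [apply: (measurableT_comp m1)|
    apply: (measurableT_comp m2)]; exact: measurable_tcons.
have Ih : CI ((@lebesgue_measure R) \x leb R n)%E h.
  have := @CI_prod_bound _ _ _ _ _ (@lebesgue_measure R) (leb R n) h _ _ mh (IF ord0) IG.
  apply => x y.
  by rewrite /h /= Normc.normcM.
have [[Ir Er] [Ii Ei]] : ((leb R n.+1).-integrable setT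
    (fun t => (Re (\prod_i F i (tnth t i)))%:E) /\
    \int[leb R n.+1]_t Re (\prod_i F i (tnth t i)) =
    \int[((@lebesgue_measure R) \x leb R n)%E]_p Re (h p)) /\
   ((leb R n.+1).-integrable setT
    (fun t => (Im (\prod_i F i (tnth t i)))%:E) /\
    \int[leb R n.+1]_t Im (\prod_i F i (tnth t i)) =
    \int[((@lebesgue_measure R) \x leb R n)%E]_p Im (h p)).
  case: mP Ih => m1 m2 [h1 h2]; split.
    under [X in _ /\ _ = X]eq_Rintegral do rewrite -Ph.
    apply: (Rintegral_leb_step m1).
    by under eq_fun do rewrite Ph.
  under [X in _ /\ _ = X]eq_Rintegral do rewrite -Ph.
  apply: (Rintegral_leb_step m2).
  by under eq_fun do rewrite Ph.
split; first by split.
have -> : CInt (leb R n.+1) (fun t => \prod_i F i (tnth t i)) =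
    CInt ((@lebesgue_measure R) \x leb R n)%E h by rewrite /CInt Er Ei.
have [_ /esym eh] := @Cfubini1 _ _ _ _ _ (@lebesgue_measure R) (leb R n) h Ih.
apply: (etrans eh).
rewrite big_ord_recl -EG mulrC -CInt_Z//.
apply: eq_CInt => x; rewrite mulrC -CInt_Z//.
Qed.

End LebesgueTuple.

(** * Lebesgue measure on tuples *)

Section Boxes.
Variable R : realType.
Local Notation RT := (measurableTypeR R).
Variable n : nat.
Implicit Types (a b : 'I_n -> R) (t s : n.-tuple RT).

Definition obox a b : set (n.-tuple RT) :=
  [set t | forall i, a i < tnth t i < b i].

Lemma oboxE a b :
  obox a b = [set t | forall i, (`]a i, b i[%classic : set R) (tnth t i)].
Proof. by apply/seteqP; split => t h i; have := h i; rewrite /= in_itv. Qed.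

Lemma measurable_obox a b : measurable (obox a b).
Proof.
have -> : obox a b = \bigcap_(i in [set: 'I_n])
    ((fun t => tnth t i) @^-1` (`]a i, b i[%classic : set R)).
  by rewrite oboxE; apply/seteqP; split => t /= h i => [_|]; exact: h.
apply: fin_bigcap_measurable => // i _.
rewrite -[X in measurable X]setTI; exact: (measurable_tnth i).
Qed.

Lemma leb_obox a b : leb R n (obox a b) =
  (\prod_(i < n) @lebesgue_measure R `]a i, b i[%classic)%E.
Proof.
rewrite oboxE.
apply: (@leb_box R n (fun i => `]a i, b i[%classic)) => i.
exact: measurable_itv.
Qed.

Lemma leb_obox_fin a b : (leb R n (obox a b) < +oo)%E.
Proof.
rewrite leb_obox.
suff : ((0%R <= \prod_(i < n) @lebesgue_measure R `]a i, b i[%classic) &&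
  (\prod_(i < n) @lebesgue_measure R `]a i, b i[%classic < +oo))%E.
  by move=> /andP[].
elim/big_ind: _ => [|x y /andP[x0 hx] /andP[y0 hy]|i _].
- by rewrite lee01 ltey.
- by rewrite mule_ge0// lte_mul_pinfty// ge0_fin_numE.
- rewrite measure_ge0 lebesgue_measure_itv/=.
  by case: ifP => // _; rewrite ?ltey// -EFinB ltey.
Qed.

Definition oboxes : set (set (n.-tuple RT)) :=
  [set A | exists a b, A = obox a b].

Lemma setI_closed_oboxes : setI_closed oboxes.
Proof.
move=> _ _ [a [b ->]] [a' [b' ->]].
exists (fun i => Num.max (a i) (a' i)), (fun i => Num.min (b i) (b' i)).
apply/seteqP; split => t /=.
  by move=> [h h'] i; rewrite gt_max lt_min; move: (h i) (h' i) => /andP[-> ->].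
move=> h; split => i; move: (h i); rewrite gt_max lt_min.
  by move=> /andP[/andP[-> _] /andP[-> _]].
by move=> /andP[/andP[_ ->] /andP[_ ->]].
Qed.

Definition cube (k : R) := obox (fun=> - k) (fun=> k).

Lemma cube_tuple t : exists k : nat, cube k%:R t.
Proof.
have [k hk] : exists k : nat, \sum_i `|tnth t i| < k%:R.
  exists (Num.truncn (\sum_i `|tnth t i|)).+1; exact: truncnS_gt.
exists k => i; rewrite -ltr_norml (le_lt_trans _ hk)//.
by rewrite (bigD1 i)//= lerDl sumr_ge0.
Qed.

Lemma bigcup_cube : \bigcup_k cube k%:R = setT.
Proof.
apply/seteqP; split => // t _.
by have [k hk] := cube_tuple t; exists k.
Qed.

Lemma measurable_oboxes : @measurable _ (n.-tuple RT) = <<s oboxes >>.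
Proof.
apply/seteqP; split; last first.
  apply: smallest_sub; first exact: sigma_algebra_measurable.
  by move=> _ [a [b ->]]; exact: measurable_obox.
move=> A mA.
have : measurable_fun setT (id : g_sigma_algebraType oboxes -> n.-tuple RT).
  apply/measurable_fun_tnthP => i.
  have := @measurability _ _ (g_sigma_algebraType oboxes) RT setT
    (fun t : g_sigma_algebraType oboxes => tnth (t : n.-tuple RT) i) _ (RGenOInfty.measurableE R).
  apply.
  move=> _ [_ [x ->] <-]; rewrite setTI.
  (* A half-space is a countable union of boxes: one side starts at [x], all the others grow with
     [k]. *)
  rewrite (_ : _ @^-1` _ = \bigcup_k
    obox (fun j => if j == i then x else - k%:R) (fun=> k%:R)).
    apply: bigcupT_measurable => k; apply: sub_sigma_algebra.
    by eexists; eexists.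
  apply/seteqP; split => t /=.
    rewrite in_itv /= andbT => xt; have [k hk] := cube_tuple t.
    exists k => // j; have /andP[h1 h2] := hk j.
    case: eqVneq => [->|_]; last by rewrite h1 h2.
    by rewrite xt; have /andP[] := hk i.
  by move=> [k _ /(_ i)]; rewrite eqxx in_itv /= andbT => /andP[].
by move=> /(_ measurableT A mA); rewrite setTI.
Qed.

Lemma measure_unique_oboxes (m : {measure set (n.-tuple RT) -> \bar R}) :
  (forall a b, m (obox a b) = leb R n (obox a b)) ->
  forall A, measurable A -> m A = leb R n A.
Proof.
move=> h A mA; apply/esym.
apply: (measure_unique oboxes (fun k => cube k%:R)) => //.
- exact: measurable_oboxes.
- exact: setI_closed_oboxes.
- by move=> k; eexists; eexists.
- exact: bigcup_cube.
- by move=> _ [a [b ->]].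
- by move=> k; exact: leb_obox_fin.
Qed.

Definition tadd s t : n.-tuple RT := [tuple (tnth t i + tnth s i : RT) | i < n].

Lemma measurable_tadd s : measurable_fun setT (tadd s).
Proof.
apply/measurable_fun_tnthP => i.
rewrite (_ : _ \o _ = fun t => tnth t i + tnth s i); last first.
  by apply/funext => t; rewrite /= tnth_mktuple.
by apply: measurable_funD => //; exact: measurable_tnth.
Qed.

(** The push-forward under a translation has the same values on open boxes, and these form a
    generating pi-system exhausted by cubes of finite measure. *)
Lemma leb_tadd s A : measurable A -> leb R n (tadd s @^-1` A) = leb R n A.
Proof.
pose m : {measure set (n.-tuple RT) -> \bar R} :=
  measure_function_pushforward__canonical__measure_function_Measure
    (leb R n) (measurable_tadd s).
move=> mA; rewrite -[RHS](@measure_unique_oboxes m)// => {mA A} a b.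
rewrite [LHS](_ : _ =
    leb R n (obox (fun i => a i - tnth s i) (fun i => b i - tnth s i))).
  rewrite !leb_obox; apply: eq_bigr => i _.
  rewrite !lebesgue_measure_itv /= !lte_fin ltrBlDr subrK.
  by case: ifP => // _; rewrite -!EFinB; congr EFin; lra.
rewrite /m /= /pushforward; congr (leb R n _).
apply/seteqP; split => t /= h i; have := h i; rewrite tnth_mktuple.
  by rewrite ltrBlDr ltrBrDr.
by rewrite ltrBlDr ltrBrDr.
Qed.

Lemma integral_tadd s (f : n.-tuple RT -> \bar R) :
  measurable_fun setT f -> (forall t, (0 <= f t)%E) ->
  (\int[leb R n]_t f (tadd s t) = \int[leb R n]_t f t)%E.
Proof.
move=> mf f0.
have := @ge0_integral_pushforward _ _ _ _ _ _ (measurable_tadd s)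
  (leb R n) setT f measurableT mf (fun y _ => f0 y).
rewrite preimage_setT => <-.
apply: eq_measure_integral; first exact: measurable_tadd.
by move=> *; exact: leb_tadd.
Qed.

(** The measurable sets over which [w] integrates to 0 form a Dynkin system: closure under
    complement requires a total integral 0, which holds because [w] vanishes off one of the
    boxes. *)
Lemma ae_eq0_oboxes (w : n.-tuple RT -> R) a0 b0 :
  (leb R n).-integrable setT (fun t => (w t)%:E) ->
  (forall t, ~ obox a0 b0 t -> w t = 0) ->
  (forall a b, (\int[leb R n]_(t in obox a b) (w t)%:E = 0)%E) ->
  ae_eq (leb R n) setT (fun t => (w t)%:E) (cst 0%E).
Proof.
move=> Iw w0 hw; have mw := measurable_int _ Iw.
have wT : (\int[leb R n]_t (w t)%:E = 0)%E.
  rewrite -(hw a0 b0) [RHS]integral_mkcond; apply: eq_integral => t _.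
  by rewrite patchE; case: ifPn => // /negP; rewrite inE => /w0 ->.
have h S : measurable S -> (\int[leb R n]_(t in S) (w t)%:E = 0)%E.
  rewrite measurable_oboxes.
  apply: (dynkin_induction (G := oboxes)
    (P := fun S => (\int[leb R n]_(t in S) (w t)%:E = 0)%E)).
  - exact: measurable_oboxes.
  - exact: setI_closed_oboxes.
  - exact: wT.
  - by move=> _ [a [b ->]].
  - move=> {}S mS S0.
    have dS : [disjoint S & ~` S] by rewrite disj_set2E; apply/eqP; exact: setICr.
    have := integral_setU (leb R n) mS (measurableC mS) _ dS.
    by rewrite setUv => /(_ _ mw); rewrite S0 add0e wT => ->.
  - move=> F mF tF F0; rewrite integral_bigcup//.
      by rewrite eseries0.
    apply: integrableS Iw => //; exact: bigcup_measurable.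
apply: integral_ae_eq => // E _ mE.
by rewrite h// integral0.
Qed.

End Boxes.

Section ContinuousMeasurable.
Variables (R : realType) (n : nat).
Local Notation RT := (measurableTypeR R).

Lemma vecE (t : n.-tuple RT) i : vec t 0 i = tnth t i.
Proof. by rewrite mxE. Qed.

Lemma vec_mktuple (x : 'rV[R]_n) : vec [tuple (x 0 i : RT) | i < n] = x.
Proof. by apply/rowP => i; rewrite vecE tnth_mktuple. Qed.

(** An open set is the union of the countably many rational boxes inside it. This links the topology
    of row vectors with the product sigma-algebra of tuples. *)
Lemma measurable_open_vec (O : set 'rV[R]_n) :
  open O -> measurable (@vec R n @^-1` O).
Proof.
move=> oO.
pose B (p : {ffun 'I_n -> rat * rat}) : set (n.-tuple RT) :=
  obox (fun i => ratr (p i).1) (fun i => ratr (p i).2).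
rewrite (_ : _ @^-1` _ = \bigcup_(p in [set p | B p `<=` @vec R n @^-1` O]) B p).
  rewrite bigcup_mkcond.
  apply: countable_bigcupT_measurable; first exact: countableP.
  by move=> p; case: ifP => // _; exact: measurable_obox.
apply/seteqP; split => [t /= Ot|t [p /= pO]]; last exact: pO.
have [e /= e0 eO] := (nbhs_ballP _ _).1 (open_nbhs_nbhs (conj oO Ot)).
have lt1 i : tnth t i - e < tnth t i by rewrite ltrBlDr ltrDl.
have lt2 i : tnth t i < tnth t i + e by rewrite ltrDl.
exists [ffun i => (xchoose (rat_in_itvoo (lt1 i)), xchoose (rat_in_itvoo (lt2 i)))].
  move=> s /= hs; apply: eO; split => // i j; rewrite !mxE.
  have := hs j; rewrite ffunE /=.
  have /itvP h1 := xchooseP (rat_in_itvoo (lt1 j)).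
  have /itvP h2 := xchooseP (rat_in_itvoo (lt2 j)).
  rewrite /ball /= => /andP[s1 s2]; rewrite ltr_norml; apply/andP; split.
    by rewrite ltrBrDr addrC -ltrBrDr opprK (lt_trans s2)// h2.
  by rewrite ltrBlDr -ltrBlDl (lt_trans _ s1)// h1.
move=> i; rewrite ffunE /=.
have /itvP h1 := xchooseP (rat_in_itvoo (lt1 i)).
have /itvP h2 := xchooseP (rat_in_itvoo (lt2 i)).
by rewrite h1 h2.
Qed.

End ContinuousMeasurable.

(** * Fourier transforms of integrable functions *)

Section OneVariableIntegrals.
Variable R : realType.
Local Notation RT := (measurableTypeR R).
Local Notation leb1 := (@lebesgue_measure R).

Definition inb (a b x : R) : R := ((a < x < b)%R)%:R.

Lemma inbE a b x : inb a b x = \1_(`]a, b[%classic : set R) x.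
Proof. by rewrite /inb indicE mem_setE in_itv. Qed.

Lemma measurable_inb a b : measurable_fun setT (inb a b).
Proof.
rewrite (_ : inb a b = \1_(`]a, b[%classic : set R)).
  by apply: measurable_indic; exact: measurable_itv.
by apply/funext => x; exact: inbE.
Qed.

Lemma FTC_inb (F f : R -> R) (a b : R) : a < b ->
  (forall x : R, is_derive x (1 : R) F (f x)) -> continuous f ->
  leb1.-integrable setT (fun x => (inb a b x * f x)%:E) /\
  \int[leb1]_x (inb a b x * f x) = F b - F a.
Proof.
move=> ab dF cf.
have eqp : (fun x => (inb a b x * f x)%:E) = (EFin \o f) \_ `]a, b[.
  apply/funext => x; rewrite inbE indicE patchE.
  by case: ifP => _; rewrite ?mul1r ?mul0r.
have If : leb1.-integrable `[a, b] (EFin \o f).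
  apply: continuous_compact_integrable; first exact: segment_compact.
  by apply: continuous_subspaceT.
have cF : continuous F.
  move=> x; have [h _] := dF x.
  exact/differentiable_continuous/derivable1_diffP.
have Io : leb1.-integrable `]a, b[ (EFin \o f).
  by apply: integrableS If => //; exact: subset_itv_oo_cc.
split; first by rewrite eqp -integrable_mkcond.
rewrite /Rintegral eqp -integral_mkcond.
rewrite -(@integral_itv_bndoo _ _ _ _ true false); last exact: measurable_int Io.
rewrite (@continuous_FTC2 _ f F)//; first exact: continuous_subspaceT.
  split; first by move=> x _; have [] := dF x.
    by apply: cvg_at_right_filter; exact: cF.
  by apply: cvg_at_left_filter; exact: cF.
by move=> x _; rewrite derive1E; have [] := dF x.
Qed.

Lemma sin_int_pi (p : int) : sin (pi *~ p) = 0 :> R.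
Proof.
have h (k : nat) : sin (pi *+ k) = 0 :> R.
  elim: k => [|k IH]; first by rewrite mulr0n sin0.
  by rewrite mulrS addrC sinD IH sinpi mulr0 mul0r addr0.
by case: p => k; rewrite ?NegzE ?mulrNz -?pmulrn ?sinN h ?oppr0.
Qed.

(** One-variable orthogonality of the exponentials of period 2 L. The frequency 0 is separated
    because the primitives of the other ones divide by the frequency. *)
Lemma CInt_cis_period (L : R) (p : int) : 0 < L ->
  CI leb1 (fun x => (inb (- L) L x)%:C * cis (pi * p%:~R * x / L)) /\
  CInt leb1 (fun x => (inb (- L) L x)%:C * cis (pi * p%:~R * x / L)) =
    (if p == 0 then 2 * L else 0)%:C.
Proof.
move=> L0; have LL : - L < L by rewrite (lt_trans _ L0)// oppr_lt0.
have L0' : L != 0 by rewrite gt_eqF.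
pose w : R := pi * p%:~R / L.
have wE x : pi * p%:~R * x / L = w * x by rewrite /w; ring.
have dw (x : R) : is_derive x 1 (fun x => w * x) w.
  by apply: is_derive_eq; rewrite /GRing.scale /= mulr1.
pose S x := if p == 0 then x else w^-1 * sin (w * x).
pose K x := if p == 0 then 0 else - (w^-1 * cos (w * x)).
have w0 : p != 0 -> w != 0.
  by move=> p0; rewrite /w !mulf_neq0 ?invr_eq0// ?intr_eq0// gt_eqF// pi_gt0.
have dS (x : R) : is_derive x 1 S (cos (w * x)).
  rewrite /S; case: eqVneq => [p0|p0].
    by rewrite /w p0 mulr0 mul0r mul0r cos0; apply: is_derive_id.
  have dc := @is_derive1_comp _ sin (fun x => w * x) x _ _ _ (dw x).
  by apply: is_derive_eq; rewrite /GRing.scale /=; field; exact: w0.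
have dK (x : R) : is_derive x 1 K (sin (w * x)).
  rewrite /K; case: eqVneq => [p0|p0].
    by rewrite /w p0 mulr0 mul0r mul0r sin0; apply: is_derive_cst.
  have dc := @is_derive1_comp _ cos (fun x => w * x) x _ _ _ (dw x).
  by apply: is_derive_eq; rewrite /GRing.scale /=; field; exact: w0.
have cw : continuous (fun x : R => w * x) by exact: mulrl_continuous.
have cc : continuous (fun x => cos (w * x)).
  by move=> x; apply: (continuous_comp (cw x)); exact: continuous_cos.
have cs : continuous (fun x => sin (w * x)).
  by move=> x; apply: (continuous_comp (cw x)); exact: continuous_sin.
have [Ic Ec] := FTC_inb LL dS cc.
have [Is Es] := FTC_inb LL dK cs.
have wL : w * L = pi *~ p by rewrite /w divfK// mulrzr.
have ReE x : Re ((inb (- L) L x)%:C * cis (pi * p%:~R * x / L)) =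
    inb (- L) L x * cos (w * x) by rewrite ReM /= wE mul0r subr0.
have ImE x : Im ((inb (- L) L x)%:C * cis (pi * p%:~R * x / L)) =
    inb (- L) L x * sin (w * x) by rewrite ImM /= wE mul0r addr0.
have [h ->] := @CI_ReIm _ _ _ leb1
  (fun x => (inb (- L) L x)%:C * cis (pi * p%:~R * x / L))
  (fun x => inb (- L) L x * cos (w * x)) (fun x => inb (- L) L x * sin (w * x))
  ReE ImE Ic Is; split=> //.
rewrite Ec Es /S /K; apply: complexP => /=; case: eqVneq => p0.
- by ring.
- by rewrite mulrN sinN wL sin_int_pi oppr0 !mulr0 subr0.
- by rewrite subr0.
- by rewrite mulrN cosN subrr.
Qed.

(* The truncated exponential is used because its Fourier transform vanishes
   nowhere and has a continuous inverse given by an elementary formula. *)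
Lemma CInt_expcis (y : R) :
  CI leb1 (fun x => (inb 0 1 x * expR (- x))%:C * cis (- (2 * pi * y * x))) /\
  CInt leb1 (fun x => (inb 0 1 x * expR (- x))%:C * cis (- (2 * pi * y * x))) =
    (1 - (expR (-1))%:C * cis (- (2 * pi * y))) / (1 +i* (2 * pi * y)).
Proof.
pose w := 2 * pi * y.
have dw (x : R) : is_derive x 1 (fun x => w * x) w.
  by apply: is_derive_eq; rewrite /GRing.scale /= mulr1.
have de (x : R) : is_derive x 1 (fun x => expR (- x)) (- expR (- x)).
  by apply: is_derive_eq; rewrite /GRing.scale /=; ring.
have W0 : 1 + w ^+ 2 != 0 by rewrite gt_eqF// ltr_pwDl// sqr_ge0.
(* [S] and [K] are the real and imaginary parts of the primitive - exp (- (1 + i w) x) / (1 + i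
   w). *)
pose S x := expR (- x) * ((1 + w ^+ 2)^-1 * (w * sin (w * x) - cos (w * x))).
pose K x := expR (- x) * ((1 + w ^+ 2)^-1 * (w * cos (w * x) + sin (w * x))).
have ds (x : R) := @is_derive1_comp _ sin (fun x => w * x) x _ _ _ (dw x).
have dc (x : R) := @is_derive1_comp _ cos (fun x => w * x) x _ _ _ (dw x).
have dS (x : R) : is_derive x 1 S (expR (- x) * cos (w * x)).
  have h1 := ds x; have h2 := dc x; have h3 := de x.
  by apply: is_derive_eq; rewrite /GRing.scale /=; field.
have dK (x : R) : is_derive x 1 K (- (expR (- x) * sin (w * x))).
  have h1 := ds x; have h2 := dc x; have h3 := de x.
  by apply: is_derive_eq; rewrite /GRing.scale /=; field.
have cw : continuous (fun x : R => w * x) by exact: mulrl_continuous.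
have ce : continuous (fun x : R => expR (- x)).
  move=> x; apply: continuous_comp; last exact: continuous_expR.
  exact: oppr_continuous.
have cc : continuous (fun x => expR (- x) * cos (w * x)).
  move=> x; apply: cvgM; first exact: ce.
  by apply: (continuous_comp (cw x)); exact: continuous_cos.
have cs : continuous (fun x => - (expR (- x) * sin (w * x))).
  move=> x; apply: cvgN; apply: cvgM; first exact: ce.
  by apply: (continuous_comp (cw x)); exact: continuous_sin.
have [Ic Ec] := FTC_inb ltr01 dS cc.
have [Is Es] := FTC_inb ltr01 dK cs.
have ReE x : Re ((inb 0 1 x * expR (- x))%:C * cis (- (2 * pi * y * x))) =
    inb 0 1 x * (expR (- x) * cos (w * x)).
  by rewrite ReM /= cosN mul0r subr0 mulrA.
have ImE x : Im ((inb 0 1 x * expR (- x))%:C * cis (- (2 * pi * y * x))) =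
    inb 0 1 x * - (expR (- x) * sin (w * x)).
  by rewrite ImM /= sinN mul0r addr0 /w; ring.
have [h ->] := @CI_ReIm _ _ _ leb1
  (fun x => (inb 0 1 x * expR (- x))%:C * cis (- (2 * pi * y * x)))
  (fun x => inb 0 1 x * (expR (- x) * cos (w * x)))
  (fun x => inb 0 1 x * - (expR (- x) * sin (w * x)))
  ReE ImE Ic Is; split=> //.
have n0 : 1 +i* w != 0 by rewrite eq_complex /= oner_eq0.
apply: (mulIf n0); rewrite -/w divfK//.
rewrite Ec Es /S /K mulr0 mulr1 oppr0 expR0 cos0 sin0.
apply: complexP; rewrite ?ReM ?ImM /=.
  by rewrite cosN; field.
by rewrite sinN; field.
Qed.

End OneVariableIntegrals.

Lemma cmeas_comp (R : realType) d1 d2 (S1 : measurableType d1)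
    (S2 : measurableType d2) (f : S2 -> R[i]) (phi : S1 -> S2) :
  cmeas f -> measurable_fun setT phi -> cmeas (fun x => f (phi x)).
Proof.
by move=> [f1 f2] mphi; split; [exact: (measurableT_comp f1 mphi)|
  exact: (measurableT_comp f2 mphi)].
Qed.

Section FourierTransform.
Variables (R : realType) (n : nat).
Local Notation RT := (measurableTypeR R).
Local Notation C := R[i].
Local Notation T := (n.-tuple RT).
Local Notation leb := (leb R n).
Implicit Types f g : T -> C.

Definition dott (t s : T) : R := \sum_i tnth t i * tnth s i.

Definition FT f (s : T) : C :=
  CInt leb (fun t => cis (- (2 * pi * dott t s)) * f t).

Lemma dottC t s : dott t s = dott s t.
Proof. by apply: eq_bigr => i _; rewrite mulrC. Qed.

Lemma measurable_dott d (S : measurableType d) (a b : S -> T) :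
  measurable_fun setT a -> measurable_fun setT b ->
  measurable_fun setT (fun z => dott (a z) (b z)).
Proof.
move=> ma mb; apply: measurable_sum => i.
by apply: measurable_funM; apply: (measurableT_comp (measurable_tnth i)).
Qed.

Lemma cmeas_FTker d (S : measurableType d) (a b : S -> T) :
  measurable_fun setT a -> measurable_fun setT b ->
  cmeas (fun z => cis (- (2 * pi * dott (a z) (b z))) : C).
Proof.
move=> ma mb; apply: cmeas_cis; apply: measurable_funN.
by apply: measurable_funM => //; exact: measurable_dott.
Qed.

(** For a merely measurable [h], Tonelli handles the positive and negative parts separately, and the
    real integral is [fine] of their difference. *)
Lemma measurable_Rint1 d1 d2 (S1 : measurableType d1) (S2 : measurableType d2)
    (m : {sigma_finite_measure set S2 -> \bar R}) (h : S1 * S2 -> R) :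
  measurable_fun setT h -> measurable_fun setT (fun x => \int[m]_y h (x, y)).
Proof.
move=> mh; apply: (measurableT_comp (fine_measurable measurableT)).
under eq_fun do rewrite integralE.
have mE : measurable_fun setT (fun z => (h z)%:E) by exact/measurable_EFinP.
apply: emeasurable_funB.
  have e x : ((fun y => (h (x, y))%:E)^\+ = (fun z => (h z)%:E)^\+ \o pair x)%E.
    by rewrite -funepos_comp.
  under eq_fun do rewrite e.
  apply: measurable_fun_fubini_tonelli_F => //; exact: measurable_funepos.
have e x : ((fun y => (h (x, y))%:E)^\- = (fun z => (h z)%:E)^\- \o pair x)%E.
  by rewrite -funeneg_comp.
under eq_fun do rewrite e.
apply: measurable_fun_fubini_tonelli_F => //; exact: measurable_funeneg.
Qed.

Lemma cmeas_CInt1 d1 d2 (S1 : measurableType d1) (S2 : measurableType d2)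
    (m : {sigma_finite_measure set S2 -> \bar R}) (h : S1 * S2 -> C) :
  cmeas h -> cmeas (fun x => CInt m (fun y => h (x, y))).
Proof.
by move=> [h1 h2]; split; [exact: (measurable_Rint1 m h1)|
  exact: (measurable_Rint1 m h2)].
Qed.

Lemma cmeas_FT f : cmeas f -> cmeas (FT f).
Proof.
move=> mf; apply: (@cmeas_CInt1 _ _ _ _ leb
  (fun z : T * T => cis (- (2 * pi * dott z.2 z.1)) * f z.2)).
apply: cmeasM; first exact: cmeas_FTker.
exact: (cmeas_comp mf measurable_snd).
Qed.

Lemma CI_FTker f s : CI leb f -> CI leb (fun t => cis (- (2 * pi * dott t s)) * f t).
Proof.
move=> If; apply: (CI_le _ If) => [|t].
  apply: cmeasM; last exact: CI_meas If.
  by apply: cmeas_FTker => //; exact: measurable_cst.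
by rewrite Normc.normcM normc_cis mul1r.
Qed.

Lemma normc_FT f s : CI leb f -> normc (FT f s) <= 2 * \int[leb]_t normc (f t).
Proof.
move=> If; apply: normc_CInt; [exact: CI_FTker|exact: CI_normc|move=> t].
by rewrite Normc.normcM normc_cis mul1r.
Qed.

Lemma CI_bounded f g (M : R) : CI leb f -> cmeas g ->
  (forall t, normc (g t) <= M) -> CI leb (fun t => f t * g t).
Proof.
move=> If mg gM; have IM := CI_Z M%:C If.
apply: (CI_le _ IM) => [|t]; first by apply: cmeasM => //; exact: CI_meas If.
rewrite !Normc.normcM mulrC ler_wpM2r ?normc_ge0//.
by rewrite normcC (le_trans (gM t))// ler_norm.
Qed.

(** Both integrals are iterated integrals of exp (-2 pi i x.y) f(x) g(y), integrable on the product
    since the exponential has modulus 1. *)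
Lemma FT_dual f g : CI leb f -> CI leb g ->
  [/\ CI leb (fun t => f t * FT g t), CI leb (fun t => FT f t * g t) &
      CInt leb (fun t => f t * FT g t) = CInt leb (fun t => FT f t * g t)].
Proof.
move=> If Ig; have mf := CI_meas If; have mg := CI_meas Ig.
have I1 : CI leb (fun t => f t * FT g t).
  apply: (CI_bounded If); first exact: cmeas_FT.
  by move=> t; exact: normc_FT.
have I2 : CI leb (fun t => FT f t * g t).
  under eq_fun do rewrite mulrC; apply: (CI_bounded Ig); first exact: cmeas_FT.
  by move=> t; exact: normc_FT.
split => //.
pose h (z : T * T) := cis (- (2 * pi * dott z.1 z.2)) * f z.1 * g z.2.
have Ih : CI (leb \x leb)%E h.
  apply: (CI_prod_bound _ If Ig) => [|x y]; last first.
    by rewrite /h /= !Normc.normcM normc_cis mul1r.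
  apply: cmeasM; first apply: cmeasM.
  - exact: cmeas_FTker.
  - exact: (cmeas_comp mf measurable_fst).
  - exact: (cmeas_comp mg measurable_snd).
have e1 := (Cfubini1 Ih).2; have e2 := (Cfubini2 Ih).2.
transitivity (CInt (leb \x leb)%E h).
  apply: etrans e1; apply: eq_CInt => x; rewrite -CInt_Z.
    by apply: eq_CInt => y; rewrite /h /= dottC; ring.
  exact: CI_FTker.
rewrite -e2; apply: eq_CInt => y; rewrite mulrC -CInt_Z.
  by apply: eq_CInt => x; rewrite /h /=; ring.
exact: CI_FTker.
Qed.

Lemma dottD t s s' : dott t (tadd s s') = dott t s + dott t s'.
Proof.
by rewrite -big_split; apply: eq_bigr => i _; rewrite tnth_mktuple mulrDr addrC.
Qed.

Lemma FT_tadd f s s' : FT f (tadd s s') =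
  FT (fun t => cis (- (2 * pi * dott t s)) * f t) s'.
Proof.
apply: eq_CInt => t; rewrite dottD mulrA -cisD; congr (cis _ * _); ring.
Qed.

End FourierTransform.

(** * Bessel's inequality *)

Section Bessel.
Variables (R : realType) (n : nat).
Local Notation RT := (measurableTypeR R).
Local Notation C := R[i].
Local Notation T := (n.-tuple RT).
Local Notation leb := (leb R n).

Lemma csq_mulJ (z : C) : (csq z)%:C = z * z^*.
Proof.
by case: z => a b; apply: complexP; rewrite /csq /=; ring.
Qed.

Lemma integrable_obox (a b : 'I_n -> R) (M : R) :
  leb.-integrable setT (fun t => (M * \1_(obox a b) t)%:E).
Proof.
under eq_fun do rewrite EFinM.
apply: integrableZl => //; apply/integrableP; split.
  by apply/measurable_EFinP; apply: measurable_indic; exact: measurable_obox.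
under eq_integral do rewrite gee0_abs ?lee_fin//.
rewrite integral_indic//; last exact: measurable_obox.
by rewrite setIT; exact: leb_obox_fin.
Qed.

Lemma CI_of_csq (f : T -> C) a b : cmeas f ->
  leb.-integrable setT (fun t => (csq (f t))%:E) ->
  (forall t, ~ obox a b t -> f t = 0) -> CI leb f.
Proof.
move=> mf If f0.
have I2 := integrableD measurableT (integrable_obox a b 1) If.
apply: (CI_dom (G := fun t => 1 * \1_(obox a b) t + csq (f t)) mf) => [|t].
  by apply: eq_integrable I2 => // t _; rewrite EFinD.
rewrite mul1r indicE; case: (boolP (t \in _)) => [_|/negP]; rewrite ?inE.
  rewrite csqE /=; move: (normc _) => x.
  (* The square of x - 1/2 being nonnegative, x <= 1 + x^2: on a bounded box, L^2 is contained in
     L^1. *)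
  by have := sqr_ge0 (x - 2^-1); rewrite sqrrB; lra.
by move=> /f0 ->; rewrite Normc.normc0 csq0 addr0.
Qed.

Variable (L : R).
Hypothesis L0 : 0 < L.

Definition expo (k : 'I_n -> int) (t : T) : C :=
  \prod_i cis (pi * (k i)%:~R * tnth t i / L).

Lemma normc_expo k t : normc (expo k t) = 1.
Proof.
rewrite /expo; elim/big_ind: _ => [|x y hx hy|i _].
- exact: Normc.normc1.
- by rewrite Normc.normcM hx hy mulr1.
- exact: normc_cis.
Qed.

Lemma cmeas_expo k : cmeas (expo k).
Proof.
apply: cmeas_prod => i _; apply: cmeas_cis.
apply: measurable_funM => //; apply: measurable_funM => //.
exact: measurable_tnth.
Qed.

Definition indcube (t : T) : R := \prod_i inb (- L) L (tnth t i).

Lemma indcubeE t : indcube t = \1_(cube L) t.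
Proof.
rewrite /indcube indicE; case: (boolP (t \in _)) => [|/negP]; rewrite ?inE.
  by move=> h; apply: big1 => i _; rewrite /inb h.
move=> h; suff [i hi] : exists i, inb (- L) L (tnth t i) = 0.
  by rewrite (bigD1 i)//= hi mul0r.
apply: contra_notP h => /forallNP h i; have := h i; rewrite /inb.
by case: (_ < _ < _).
Qed.

Lemma expo_orthogonal (k j : 'I_n -> int) :
  CI leb (fun t => (indcube t)%:C * (expo k t * (expo j t)^*)) /\
  CInt leb (fun t => (indcube t)%:C * (expo k t * (expo j t)^*)) =
    (\prod_i (if k i == j i then 2 * L else 0))%:C.
Proof.
have h i := CInt_cis_period (k i - j i) L0.
have [] := CI_tensor (fun i => (h i).1).
have e : (fun t : T => \prod_i ((inb (- L) L (tnth t i))%:C *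
      cis (pi * (k i - j i)%:~R * tnth t i / L))) =
    (fun t => (indcube t)%:C * (expo k t * (expo j t)^*)).
  apply/funext => t; rewrite /indcube /expo !rmorph_prod -!big_split /=.
  apply: eq_bigr => i _; rewrite -cisN -cisD; congr (_ * cis _).
  by rewrite intrB; ring.
rewrite e => h1 h2; split => //; rewrite h2.
rewrite rmorph_prod; apply: eq_bigr => i _; rewrite (h i).2.
by rewrite subr_eq0.
Qed.

(** Let E be the combination of the exponentials, cut off to the cube, with the coefficients of [g],
    and V = (2 L)^n. Orthogonality gives that |E|^2 integrates to V S and E times the conjugate of g
    to S, where S is the left-hand side. Integrating Re (E conj g) <= (V |g|^2 + |E|^2 / V) / 2
    yields S <= (V J + S) / 2, with J the integral of |g|^2. *)
Lemma Bessel (I : finType) (k : I -> 'I_n -> int) (g : T -> C) :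
  (forall x y, k x =1 k y -> x = y) ->
  CI leb g -> leb.-integrable setT (fun t => (csq (g t))%:E) ->
  (forall t, ~ cube L t -> g t = 0) ->
  \sum_x csq (CInt leb (fun t => (expo (k x) t)^* * g t)) <=
    (2 * L) ^+ n * \int[leb]_t csq (g t).
Proof.
move=> kinj Ig Ig2 g0.
set c := fun x => CInt leb (fun t => (expo (k x) t)^* * g t).
set S := \sum_x csq (c x); pose V := (2 * L) ^+ n.
have V0 : 0 < V by rewrite exprn_gt0// mulr_gt0.
have Ic x : CI leb (fun t => (expo (k x) t)^* * g t).
  apply: (CI_le _ Ig) => [|t].
    apply: cmeasM; last exact: CI_meas Ig.
    by apply: cmeasJ; exact: cmeas_expo.
  by rewrite Normc.normcM normcJ normc_expo mul1r.
pose E t := \sum_x c x * ((indcube t)%:C * expo (k x) t).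
have mE : cmeas E.
  apply: cmeas_sum => x _; apply: cmeasM; first exact: cmeas_cst.
  apply: cmeasM; last exact: cmeas_expo.
  apply: cmeasC; apply: measurable_prod => i _.
  exact: (measurableT_comp (measurable_inb _ _) (measurable_tnth i)).
have gE t : E t * (g t)^* = \sum_x c x * (expo (k x) t * (g t)^*).
  rewrite mulr_suml; apply: eq_bigr => x _.
  have [h|h] := pselect (cube L t).
    by rewrite indcubeE indicE mem_set// mul1r mulrA.
  by rewrite g0// rmorph0 !mulr0.
have EE t : E t * (E t)^* = \sum_x \sum_y (c x * (c y)^*) *
    ((indcube t)%:C * (expo (k x) t * (expo (k y) t)^*)).
  rewrite mulr_suml; apply: eq_bigr => x _.
  rewrite rmorph_sum mulr_sumr; apply: eq_bigr => y _ /=.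
  rewrite !rmorphM /= conjC_R.
  have ii : (indcube t)%:C * (indcube t)%:C = (indcube t)%:C :> C.
    rewrite indcubeE -rmorphM indicE; case: (_ \in _); by rewrite /= ?mulr1 ?mulr0.
  by rewrite -[in RHS]ii; ring.
have IEE : CI leb (fun t => E t * (E t)^*) /\
    CInt leb (fun t => E t * (E t)^*) = (V * S)%:C.
  under eq_fun do rewrite EE.
  have Ixy x y := CI_Z (c x * (c y)^*) (expo_orthogonal (k x) (k y)).1.
  have Ix x : CI leb (fun t => \sum_y (c x * (c y)^*) *
      ((indcube t)%:C * (expo (k x) t * (expo (k y) t)^*))).
    by apply: CI_sum => y _; exact: Ixy.
  split; first by apply: CI_sum => x _; exact: Ix.
  rewrite CInt_sum; last first.
    move=> x _. exact: Ix.
  rewrite rmorphM rmorph_sum mulr_sumr; apply: eq_bigr => x _ /=.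
  rewrite CInt_sum; last by move=> y _; exact: Ixy.
  rewrite (bigD1 x)//= big1 => [|y yx].
    rewrite addr0 CInt_Z; last exact: (expo_orthogonal _ _).1.
    rewrite (expo_orthogonal _ _).2 csq_mulJ mulrC; congr (_%:C * _).
    under eq_bigr do rewrite eqxx.
    by rewrite prodr_const card_ord.
  rewrite CInt_Z; last exact: (expo_orthogonal _ _).1.
  rewrite (expo_orthogonal _ _).2.
  have [i kxy] : exists i, k x i != k y i.
    apply: contrapT => /forallNP h; move/eqP: yx; apply; apply/esym/kinj => i.
    by apply/eqP/negPn/negP; exact: h.
  by rewrite (bigD1 i)//= (negbTE kxy) mul0r mulr0.
have IE2 : leb.-integrable setT (fun t => (csq (E t))%:E) /\
    \int[leb]_t csq (E t) = V * S.
  have e t : csq (E t) = Re (E t * (E t)^*) by rewrite -csq_mulJ.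
  case: IEE => -[h _] /(congr1 (@complex.Re R)) /= <-; split.
    by under eq_fun do rewrite e.
  by under eq_Rintegral do rewrite e.
have IgE : CI leb (fun t => E t * (g t)^*) /\
    CInt leb (fun t => E t * (g t)^*) = S%:C.
  under eq_fun do rewrite gE.
  have Ix x : CI leb (fun t => c x * (expo (k x) t * (g t)^*)).
    apply: CI_Z; have := CI_J (Ic x).
    by under eq_fun do rewrite rmorphM /= conjCK.
  split; first by apply: CI_sum => x _; exact: Ix.
  rewrite CInt_sum//= rmorph_sum; apply: eq_bigr => x _ /=.
  rewrite CInt_Z; last first.
    by have := CI_J (Ic x); under eq_fun do rewrite rmorphM /= conjCK.
  rewrite csq_mulJ; congr (_ * _); rewrite /c -CInt_J//.
  by apply: eq_CInt => t; rewrite rmorphM /= conjCK.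
have SE : S = \int[leb]_t Re (E t * (g t)^*).
  by case: IgE => _ /(congr1 (@complex.Re R)).
have Z (r : R) (h : T -> R) : leb.-integrable setT (fun t => (h t)%:E) ->
    leb.-integrable setT (fun t => (r * h t)%:E).
  by move=> ik; under eq_fun do rewrite EFinM; exact: integrableZl.
have I3a := Z (2^-1 * V) _ Ig2; have I3b := Z (2^-1 * V^-1) _ IE2.1.
have I3 : leb.-integrable setT
    (fun t => (2^-1 * V * csq (g t) + 2^-1 * V^-1 * csq (E t))%:E).
  by under eq_fun do rewrite EFinD; exact: integrableD.
have : S <= \int[leb]_t (2^-1 * V * csq (g t) + 2^-1 * V^-1 * csq (E t)).
  rewrite SE; apply: le_Rintegral => //; first by case: IgE => -[].
  move=> t _; rewrite /csq ReM ReJ ImJ.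
  move: (Re (E t)) (Im (E t)) (Re (g t)) (Im (g t)) => a b u v.
  have VV : V * V^-1 = 1 by rewrite mulfV// gt_eqF.
  rewrite -(ler_pM2l (x := 2 * V)) ?mulr_gt0//.
  have -> : 2 * V * (2^-1 * V * (u ^+ 2 + v ^+ 2) +
      2^-1 * V^-1 * (a ^+ 2 + b ^+ 2)) =
      V ^+ 2 * (u ^+ 2 + v ^+ 2) + (a ^+ 2 + b ^+ 2).
    by field; rewrite gt_eqF.
  have := sqr_ge0 (V * u - a); have := sqr_ge0 (V * v - b); nra.
rewrite RintegralD//.
rewrite !RintegralZl//; last exact: IE2.1.
have -> : 2^-1 * V^-1 * \int[leb]_t csq (E t) = 2^-1 * S.
  by rewrite IE2.2 -mulrA mulKf// gt_eqF.
by rewrite -/V; move: (\int[leb]_t csq (g t)) => J; lra.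
Qed.

End Bessel.

Section FourierL2.
Variables (R : realType) (n : nat).
Local Notation RT := (measurableTypeR R).
Local Notation C := R[i].
Local Notation T := (n.-tuple RT).
Local Notation leb := (leb R n).

Lemma subset_cube (a b : R) : a <= b -> @cube R n a `<=` cube b.
Proof.
move=> ab t h i; have /andP[h1 h2] := h i.
by rewrite (le_lt_trans _ h1) ?lerN2// (lt_le_trans h2).
Qed.

Lemma le_integral_cubes (F : T -> \bar R) (c : R) (D : \bar R) : 0 < c ->
  measurable_fun setT F -> (forall t, (0 <= F t)%E) ->
  (forall N : nat, (\int[leb]_(t in cube (N%:R * c)) F t <= D)%E) ->
  (\int[leb]_t F t <= D)%E.
Proof.
move=> c0 mF F0 FD.
have nd : nondecreasing_seq (fun N => @cube R n (N%:R * c)).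
  move=> i j ij; rewrite subsetEset; apply: subset_cube.
  by rewrite ler_wpM2r ?ler_nat// ltW.
have mc i : measurable (@cube R n (i%:R * c)) by exact: measurable_obox.
have := ge0_nondecreasing_set_cvg_integral (mu := leb) (f := F) nd mc
  (fun i => measurable_funTS mF) (fun i x _ => F0 x).
have -> : \bigcup_i @cube R n (i%:R * c) = setT.
  apply/seteqP; split => // t _; have [k hk] := cube_tuple t.
  have [N hN] : exists N : nat, k%:R / c < N%:R.
    by exists (Num.truncn (k%:R / c)).+1; exact: truncnS_gt.
  exists N => //; apply: subset_cube hk; rewrite ltW//.
  by rewrite -ltr_pdivrMr.
move=> h; rewrite -(cvg_lim _ h)//; apply: lime_le; first by apply/cvg_ex; exists (\int[leb]_t F t)%E.
by apply: nearW => N; exact: FD.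
Qed.

(** The values of the transform on the lattice s + Z^n / (2 L) are the coefficients, in the
    exponentials of period 2 L, of the modulated function exp (-2 pi i x.s) f(x). By Bessel the sum
    of their squares is at most [B], for every s; integrating s over one cell of the lattice gives
    the whole integral. *)
Lemma integrable_csq_FT (f : T -> C) (L : R) : 0 < L -> cmeas f ->
  leb.-integrable setT (fun t => (csq (f t))%:E) ->
  (forall t, ~ cube L t -> f t = 0) ->
  leb.-integrable setT (fun s => (csq (FT f s))%:E).
Proof.
move=> L0 mf I2 f0; have If := CI_of_csq mf I2 f0.
have mF := cmeas_FT mf.
have mcF : measurable_fun setT (fun s => (csq (FT f s))%:E).
  by apply/measurable_EFinP; exact: measurable_csq.
set c := (2 * L)^-1; have c0 : 0 < c by rewrite invr_gt0 mulr_gt0.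
pose B := (2 * L) ^+ n * \int[leb]_t csq (f t).
have B0 : 0 <= B.
  apply: mulr_ge0; first by rewrite exprn_ge0// mulr_ge0// ltW.
  by apply: Rintegral_ge0 => t _; exact: csq_ge0.
pose q : T -> R := \1_[set s : T | forall i, 0 <= tnth s i < c].
have mq : measurable_fun setT q.
  apply: measurable_indic.
  rewrite (_ : [set s | _] = \bigcap_(i in [set: 'I_n])
    ((fun t : T => tnth t i) @^-1` (`[0, c[%classic : set R))); last first.
    apply/seteqP; split => t /= h i => [_|].
      by rewrite /preimage /= in_itv; exact: h.
    by have := h i I; rewrite /preimage /= in_itv.
  apply: fin_bigcap_measurable => // i _.
  by rewrite -[X in measurable X]setTI; exact: (measurable_tnth i).
have q0 s : 0 <= q s by rewrite /q indicE.
have Iq : (\int[leb]_s (q s)%:E < +oo)%E.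
  apply: (@le_lt_trans _ _ (\int[leb]_s (\1_(cube (2 * c)) s)%:E)%E).
    apply: ge0_le_integral => //.
    - by move=> s _; rewrite lee_fin.
    - exact/measurable_EFinP.
    - apply/measurable_EFinP/measurable_indic; exact: measurable_obox.
    - move=> s _; rewrite lee_fin /q !indicE ler_nat.
      case: (boolP (s \in _)); rewrite ?inE//= => h.
      rewrite mem_set// => i; have /andP[h1 h2] := h i.
      by rewrite (lt_le_trans _ h1) ?oppr_lt0 ?mulr_gt0// (lt_trans h2)// ltr_pMl// ltr1n.
  rewrite integral_indic//; last exact: measurable_obox.
  by rewrite setIT; exact: leb_obox_fin.
suff : (\int[leb]_s (csq (FT f s))%:E <= B%:E * \int[leb]_s (q s)%:E)%E.
  move=> h; apply/integrableP; split=> //.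
  under eq_integral do rewrite gee0_abs ?lee_fin ?csq_ge0//.
  by rewrite (le_lt_trans h)// lte_mul_pinfty ?lee_fin.
apply: (le_integral_cubes c0) => // [s|N]; first by rewrite lee_fin csq_ge0.
(* Lattice vectors with entries from - N to N - 1, encoded as ordinals shifted by N: exactly the
   cells needed to cover [cube (N%:R * c)]. *)
pose K := {ffun 'I_n -> 'I_(2 * N)}.
pose k (x : K) i : int := (x i : nat)%:Z - N%:Z.
pose v (x : K) : T := [tuple ((k x i)%:~R * c : RT) | i < n].
pose w (x : K) : T := [tuple (- ((k x i)%:~R * c) : RT) | i < n].
have kinj x y : k x =1 k y -> x = y.
  move=> h; apply/ffunP => i; apply/val_inj => /=.
  by have := h i; rewrite /k => /addIr [].
have wv x s : tadd (tadd (w x) s) (v x) = s.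
  apply/eq_from_tnth => i; rewrite !tnth_mktuple.
  rewrite addrC; exact: subrK.
have bes s : \sum_x csq (FT f (tadd s (v x))) <= B.
  pose g t := cis (- (2 * pi * dott t s)) * f t.
  have Ig : CI leb g by exact: CI_FTker.
  have gf t : csq (g t) = csq (f t) by rewrite csqM csq_cis mul1r.
  have Ig2 : leb.-integrable setT (fun t => (csq (g t))%:E).
    by under eq_fun do rewrite gf.
  have g0 t : ~ cube L t -> g t = 0 by move=> /f0 h; rewrite /g h mulr0.
  have := Bessel L0 kinj Ig Ig2 g0.
  under eq_Rintegral do rewrite gf.
  apply: le_trans; rewrite le_eqVlt; apply/orP; left; apply/eqP.
  apply: eq_bigr => x _; congr csq; rewrite FT_tadd.
  apply: eq_CInt => t; congr (_ * _).
  rewrite /expo rmorph_prod /=.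
  under eq_bigr do rewrite -cisN.
  rewrite -cis_sum; congr cis; rewrite /dott mulr_sumr -sumrN.
  by apply: eq_bigr => i _; rewrite tnth_mktuple /c; field; rewrite gt_eqF.
pose F x s := ((q s * csq (FT f (tadd s (v x))))%:E).
have mFx x : measurable_fun setT (F x).
  apply/measurable_EFinP; apply: measurable_funM => //.
  apply: measurable_csq; apply: (cmeas_comp mF).
  apply/measurable_fun_tnthP => i.
  rewrite (_ : _ \o _ = fun s => tnth (v x) i + tnth s i); last first.
    by apply/funext => s /=; rewrite tnth_mktuple.
  by apply: measurable_funD => //; exact: measurable_tnth.
have Fx0 x s : (0 <= F x s)%E by rewrite lee_fin mulr_ge0// csq_ge0.
(* The shifted cells cover the cube, so the integrand is dominated by the sum of its restrictions to
   them. Undoing each shift by translation invariance brings all the terms over a single cell, where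
   [bes] applies. *)
apply: (@le_trans _ _ (\int[leb]_s \sum_x F x (tadd (w x) s))%E).
  rewrite integral_mkcond; apply: ge0_le_integral => //.
  - move=> s _; rewrite patchE; case: ifP => // _.
    by rewrite lee_fin csq_ge0.
  - apply/(measurable_restrictT _ _).1; first exact: measurable_obox.
    exact: measurable_funTS.
  - apply: emeasurable_sum => x; apply: (measurableT_comp (mFx x)).
    exact: measurable_tadd.
  - move=> s _; rewrite patchE; case: ifPn; rewrite ?inE => hs; last first.
      by apply: sume_ge0 => x _; exact: Fx0.
    (* The cell containing [s] is found by rounding down each coordinate measured in units of
       [c]. *)
    have [x0 hx0] : exists x : K, forall i,
        k x i = Num.floor (tnth s i * (2 * L)).
      suff : forall i, exists y : 'I_(2 * N),
          (y : nat)%:Z - N%:Z = Num.floor (tnth s i * (2 * L)).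
        move=> /fin_all_exists[y hy]; exists [ffun i => y i] => i.
        by rewrite /k ffunE.
      move=> i; set a := tnth s i * (2 * L).
      have [a1 a2] : - N%:R < a /\ a < N%:R.
        have /andP[h1 h2] := hs i.
        have LL : 0 < 2 * L by rewrite mulr_gt0.
        by split; [rewrite /a -ltr_pdivrMr// mulNr|rewrite /a -ltr_pdivlMr].
      have z1 : - N%:Z <= Num.floor a.
        by rewrite floor_ge_int intrN ltW.
      have z2 : Num.floor a < N%:Z by rewrite floor_lt_int.
      move: (Num.floor a) z1 z2 => z z1 z2; clear -z1 z2.
      have h : (absz (z + N%:Z)%R < 2 * N)%N by lia.
      by exists (Ordinal h) => /=; lia.
    rewrite /F sumEFin lee_fin (bigD1 x0)//= wv.
    have -> : q (tadd (w x0) s) = 1.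
      rewrite /q indicE mem_set// => i /=; rewrite tnth_mktuple tnth_mktuple hx0.
      set a := tnth s i * (2 * L).
      have -> : tnth s i = a * c by rewrite /a mulfK// gt_eqF// mulr_gt0.
      rewrite -mulrBl; have := floor_itv a => /andP[a1 a2].
      rewrite mulr_ge0 ?subr_ge0// ?ltW//=.
      by rewrite gtr_pMl// ltrBlDr addrC -intrD1.
    rewrite mul1r lerDl; apply: sumr_ge0 => x _.
    by rewrite mulr_ge0// csq_ge0.
have mFt x : measurable_fun setT (fun s => F x (tadd (w x) s)).
  by apply: (measurableT_comp (mFx x)); exact: measurable_tadd.
rewrite ge0_integral_sum//.
under eq_bigr do rewrite integral_tadd//.
have mqE : measurable_fun setT (fun s => (q s)%:E) by exact/measurable_EFinP.
have q0E s : setT s -> (0 <= (q s)%:E)%E by rewrite lee_fin.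
have B0E : (0 <= B%:E)%E by rewrite lee_fin.
rewrite -ge0_integral_sum// -ge0_integralZl//.
apply: ge0_le_integral => //.
- by move=> s _; apply: sume_ge0 => x _.
- by apply: emeasurable_sum => x; exact: mFx.
- by apply/measurable_EFinP; apply: measurable_funM.
move=> s _; rewrite /F sumEFin -EFinM lee_fin -mulr_sumr mulrC ler_wpM2r//.
Qed.

End FourierL2.

(** * Uniform bounds and weighted convergence *)

Section SupBound.
Variables (R : realType) (n : nat).
Local Notation RT := (measurableTypeR R).
Local Notation C := R[i].
Local Notation T := (n.-tuple RT).
Local Notation leb := (leb R n).

(** The transform of exp (- x) on ]0, 1[, computed in [CInt_expcis]; its numerator is nonzero
    because exp (-1) < 1. *)
Definition chi1 (y : R) : C :=
  (1 - (expR (-1))%:C * cis (- (2 * pi * y))) / (1 +i* (2 * pi * y)).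

Definition chi (t : T) : C := \prod_i chi1 (tnth t i).

Definition expkernel (t : T) : C :=
  \prod_i (inb 0 1 (tnth t i) * expR (- tnth t i))%:C.

Lemma CI_expkernel : CI leb expkernel.
Proof.
apply: (CI_tensor (F := fun _ x => (inb 0 1 x * expR (- x))%:C) _).1 => _.
have [h _] := CInt_expcis (0 : R).
apply: (CI_le _ h) => [|t].
  apply: cmeasC; apply: measurable_funM.
    exact: measurable_inb.
  apply: continuous_measurable_fun => x; apply: continuous_comp.
    exact: oppr_continuous.
  exact: continuous_expR.
by rewrite Normc.normcM normc_cis mulr1.
Qed.

Lemma FT_expkernel : FT expkernel = chi.
Proof.
apply/funext => s; rewrite /FT /chi.
have [_ e] := CI_tensor (fun i => (CInt_expcis (tnth s i)).1).
transitivity (CInt leb (fun t => \prod_i ((inb 0 1 (tnth t i) *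
    expR (- tnth t i))%:C * cis (- (2 * pi * tnth s i * tnth t i))))).
  apply: eq_CInt => t; rewrite /expkernel /dott mulr_sumr -sumrN cis_sum.
  rewrite -big_split; apply: eq_bigr => i _ /=; rewrite mulrC.
  by congr (_ * cis _); ring.
by rewrite e; apply: eq_bigr => i _; exact: (CInt_expcis (tnth s i)).2.
Qed.

Lemma normc_expkernel t : normc (expkernel t) <= \1_(obox (fun=> 0) (fun=> 1)) t.
Proof.
rewrite indicE; case: (boolP (t \in _)) => [|/negP]; rewrite ?inE /= => h.
  rewrite /expkernel; elim/big_ind: _ => [|x y hx hy|i _].
  - by rewrite Normc.normc1.
  - by rewrite Normc.normcM mulr_ile1// normc_ge0.
  - rewrite normcC /inb h mul1r ger0_norm ?expR_ge0//.
    by rewrite -expR0 ler_expR oppr_le0 ltW//; have /andP[] := h i.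
have [i hi] : exists i, inb 0 1 (tnth t i) = 0.
  apply: contra_notP h => /forallNP h i; have := h i; rewrite /inb.
  by case: (_ < _ < _).
by rewrite /expkernel (bigD1 i)//= hi mul0r /= mul0r Normc.normc0.
Qed.

(** By [FT_dual], the transform of chi g at [s] is the integral over t of F(g)(s + t) times a kernel
    bounded by the indicator of the unit box. There |F(g)| <= 1 + |F(g)|^2, and translation
    invariance makes the resulting bound independent of [s]. *)
Lemma FT_sup_bound (g : T -> C) (s : T) : CI leb g ->
  leb.-integrable setT (fun s => (csq (FT g s))%:E) ->
  normc (FT (fun t => chi t * g t) s) <=
    2 * (fine (leb (obox (fun=> 0) (fun=> 1))) + \int[leb]_t csq (FT g t)).
Proof.
move=> Ig IF; have mF : cmeas (FT g) by apply: cmeas_FT; exact: CI_meas Ig.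
pose h t := cis (- (2 * pi * dott t s)) * g t.
have Ih : CI leb h by exact: CI_FTker.
have [I1 I2 E] := FT_dual Ih CI_expkernel.
have -> : FT (fun t => chi t * g t) s = CInt leb (fun t => FT h t * expkernel t).
  by rewrite -E; apply: eq_CInt => t; rewrite FT_expkernel /h; ring.
pose G t := 1 * \1_(obox (fun=> 0) (fun=> 1)) t + csq (FT g (tadd s t)).
have mG2 : measurable_fun setT (fun t => csq (FT g (tadd s t))).
  by apply: measurable_csq; apply: (cmeas_comp mF); exact: measurable_tadd.
have tr : (\int[leb]_t (csq (FT g (tadd s t)))%:E =
    \int[leb]_t (csq (FT g t))%:E)%E.
  apply: (integral_tadd s (f := fun t => (csq (FT g t))%:E)) => [|t].
    by apply/measurable_EFinP; exact: measurable_csq.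
  by rewrite lee_fin csq_ge0.
have IG2 : leb.-integrable setT (fun t => (csq (FT g (tadd s t)))%:E).
  apply: ge0_integrable; [exact: mG2|move=> t; exact: csq_ge0|].
  by rewrite tr integrable_lty.
have IG1 := integrable_obox (fun=> 0) (fun=> 1) (1 : R) : leb.-integrable _ _.
have IG : leb.-integrable setT (fun t => (G t)%:E).
  by under eq_fun do rewrite EFinD; exact: integrableD.
apply: (le_trans (normc_CInt I2 IG _)).
  move=> t; rewrite Normc.normcM /h -FT_tadd /G mul1r.
  have := normc_expkernel t; rewrite csqE indicE.
  have := normc_ge0 (expkernel t); have := normc_ge0 (FT g (tadd s t)).
  move: (normc (FT g _)) (normc (expkernel t)) => x y.
  case: (_ \in _) => /= x0 y0 y1.
    have := sqr_ge0 (x - 2^-1); rewrite sqrrB => h1.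
    by apply: (@le_trans _ _ x); [rewrite ler_piMr|lra].
  have -> : y = 0 by apply/eqP; rewrite eq_le y0 y1.
  by rewrite mulr0 add0r sqr_ge0.
rewrite ler_pM2l; last exact: ltr0n.
rewrite (RintegralD measurableT IG1 IG2).
have -> : \int[leb]_t csq (FT g (tadd s t)) = \int[leb]_t csq (FT g t).
  exact: (congr1 fine tr).
rewrite lerD2r /Rintegral; under eq_integral do rewrite mul1r.
rewrite integral_indic; [|exact: measurableT|exact: measurable_obox].
by rewrite setIT; exact: lexx.
Qed.

End SupBound.

Section WeightedL2.
Variables (R : realType) (n : nat).
Local Notation RT := (measurableTypeR R).
Local Notation C := R[i].
Local Notation T := (n.-tuple RT).
Local Notation leb := (leb R n).

(** Inside a large cube dominated convergence applies, with the uniform bound [M] on a set of finite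
    measure; outside it the weight [k] is small and multiplies an integral bounded by [B]. *)
Lemma weighted_L2_cvg0 (F : nat -> T -> C) (k : T -> R) (B M : R) :
  (forall N, cmeas (F N)) ->
  (forall N, (\int[leb]_t (csq (F N t))%:E <= B%:E)%E) ->
  (forall N t, csq (F N t) <= M) ->
  (forall t, csq (F N t) @[N --> \oo] --> (0 : R)) ->
  measurable_fun setT k -> (forall t, 0 <= k t <= 1) ->
  (forall e, 0 < e -> exists L, forall t, ~ cube L t -> k t <= e) ->
  (\int[leb]_t (k t * csq (F N t))%:E @[N --> \oo] --> 0)%E.
Proof.
move=> mF FB FM F0 mk k01 ksmall.
have mcF N : measurable_fun setT (fun t => csq (F N t)) by exact: measurable_csq.
have k0 t : 0 <= k t by case/andP: (k01 t).
have B0 : 0 <= B.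
  rewrite -lee_fin; apply: (le_trans _ (FB 0)).
  by apply: integral_ge0 => t _; rewrite lee_fin csq_ge0.
have loc L : (\int[leb]_t (\1_(cube L) t * csq (F N t))%:E @[N --> \oo] --> 0)%E.
  have mi : measurable_fun setT (\1_(@cube R n L) : T -> R).
    by apply: measurable_indic; exact: measurable_obox.
  have h1 N : measurable_fun setT (fun t => (\1_(cube L) t * csq (F N t))%:E).
    by apply/measurable_EFinP; exact: measurable_funM.
  have h2 : {ae leb, forall t, setT t ->
      (\1_(cube L) t * csq (F N t))%:E @[N --> \oo] --> 0%E}.
    apply: aeW => t _; apply: cvg_EFin; first exact: nearW.
    rewrite -[X in _ --> X](mulr0 (\1_(@cube R n L) t)).
    by apply: cvgM; [exact: cvg_cst|exact: F0].
  have h3 : {ae leb, forall t N, setT t ->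
      (`|(\1_(cube L) t * csq (F N t))%:E| <= (M * \1_(cube L) t)%:E)%E}.
    apply: aeW => t N _; rewrite gee0_abs ?lee_fin ?mulr_ge0 ?csq_ge0//.
    by rewrite mulrC ler_wpM2r.
  have [_ _] := dominated_convergence measurableT h1 (measurable_cst (0 : \bar R))
    h2 (integrable_obox _ _ M) h3.
  by rewrite integral0.
have main (e : R) : 0 < e -> \forall N \near \oo,
    (\int[leb]_t (k t * csq (F N t))%:E <= e%:E)%E.
  move=> e0; pose d := e / (2 * (B + 1)).
  have B1 : 0 < B + 1 by rewrite ltr_wpDl.
  have d0 : 0 < d by rewrite divr_gt0// mulr_gt0.
  have [L hL] := ksmall d d0.
  have e20 : 0 < e / 2 by rewrite divr_gt0.
  have := loc L => /fine_cvgP[fin /cvgrPdist_lt/(_ _ e20)] near2.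
  near=> N.
  have mi : measurable_fun setT (\1_(@cube R n L) : T -> R).
    by apply: measurable_indic; exact: measurable_obox.
  have i0 t : (0 : R) <= \1_(@cube R n L) t by rewrite indicE.
  apply: (@le_trans _ _ (\int[leb]_t ((\1_(cube L) t * csq (F N t))%:E +
      d%:E * (csq (F N t))%:E))%E).
    apply: ge0_le_integral => //.
    - by move=> t _; rewrite lee_fin mulr_ge0// csq_ge0.
    - by apply/measurable_EFinP; exact: measurable_funM.
    - apply: emeasurable_funD; apply/measurable_EFinP; first exact: measurable_funM.
      by apply: measurable_funM.
    move=> t _; rewrite -EFinM -EFinD lee_fin -mulrDl ler_wpM2r ?csq_ge0//.
    rewrite indicE; case: (boolP (t \in _)) => [_|/negP]; rewrite ?inE /=.
      by case/andP: (k01 t) => _ /le_trans; apply; rewrite lerDl ltW.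
    by rewrite add0r => /hL.
  rewrite ge0_integralD//; last 4 first.
  - by move=> t _; rewrite lee_fin mulr_ge0// csq_ge0.
  - by apply/measurable_EFinP; exact: measurable_funM.
  - by move=> t _; rewrite -EFinM lee_fin mulr_ge0 ?csq_ge0// ltW.
  - by apply/measurable_EFinP; exact: measurable_funM.
  have -> : (e%:E = (e / 2)%:E + (e / 2)%:E)%E by rewrite -EFinD -splitr.
  apply: leeD.
    have ffin : (\int[leb]_t (\1_(cube L) t * csq (F N t))%:E)%E \is a fin_num.
      by near: N.
    have : `|0 - fine (\int[leb]_t (\1_(cube L) t * csq (F N t))%:E)%E| < e / 2.
      by near: N.
    rewrite sub0r normrN => h; rewrite -(fineK ffin) lee_fin ltW//.
    by rewrite (le_lt_trans (ler_norm _) h).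
  rewrite ge0_integralZl//; last 3 first.
  - exact/measurable_EFinP.
  - by move=> t _; rewrite lee_fin csq_ge0.
  - by rewrite lee_fin ltW.
  apply: (@le_trans _ _ (d%:E * B%:E)%E); first by rewrite lee_pmul2l.
  rewrite -EFinM lee_fin /d.
  rewrite -[leRHS]mulr1 invfM -!mulrA ler_pM2l// ler_pM2l// ?invr_gt0//.
  by rewrite mulrC ler_pdivrMr// mul1r lerDl.
apply/fine_cvgP; split.
  have := main 1 ltr01; apply: filterS => N h; rewrite ge0_fin_numE.
    by rewrite (le_lt_trans h)// ltry.
  by apply: integral_ge0 => t _; rewrite lee_fin mulr_ge0// csq_ge0.
apply/cvgrPdist_le => e e0; have := main e e0; apply: filterS => N h.
have h0 : (0 <= \int[leb]_t (k t * csq (F N t))%:E)%E.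
  by apply: integral_ge0 => t _; rewrite lee_fin mulr_ge0// csq_ge0.
rewrite sub0r normrN ger0_norm ?fine_ge0//.
by rewrite -lee_fin fineK// ge0_fin_numE// (le_lt_trans h)// ltry.
Unshelve. all: by end_near. Qed.

End WeightedL2.

(** * Limits of complex functions *)

Section ComplexLimits.
Variable R : realType.
Local Notation C := R[i].

Lemma cvgC_ReIm {T} {F : set_system T} {FF : Filter F} (f : T -> C) (z : C) :
  f @ F --> z <-> (Re (f t) @[t --> F] --> Re z) /\ (Im (f t) @[t --> F] --> Im z).
Proof.
split=> [/cvgrPdist_lt h|[/cvgrPdist_lt h1 /cvgrPdist_lt h2]].
  have h' e : 0 < e -> \forall t \near F, normc (z - f t) < e.
    move=> e0; have e0' : 0 < e%:C by rewrite ltcR.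
    by apply: filterS (h _ e0') => t; rewrite normc_def ltcR; case: (z - f t).
  split; apply/cvgrPdist_lt => e /h'; apply: filterS => t.
    by apply: le_lt_trans; rewrite -ReN -ReD normc_Re.
  by apply: le_lt_trans; rewrite -ImN -ImD normc_Im.
(* In the order of [R[i]] a positive radius has imaginary part 0, so it is a positive real. *)
apply/cvgrPdist_lt => -[e e'] /[dup]; rewrite {1}ltcE /= => /andP[/eqP -> e0] _.
have e20 : 0 < e / 2 by rewrite divr_gt0.
apply: filterS2 (h1 _ e20) (h2 _ e20) => t a b.
rewrite -[ltRHS]/(e%:C) normc_def ltcR.
have -> : Num.sqrt ((Re (z - f t)) ^+ 2 + (Im (z - f t)) ^+ 2) = normc (z - f t).
  by case: (z - f t).
apply: (le_lt_trans (normc_ReIm _)).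
by rewrite ReD ImD ReN ImN [e]splitr ltrD.
Qed.

Section filter.
Context {T : Type} {F : set_system T} {FF : Filter F}.
Implicit Types (f g : T -> C) (a b : C).

Lemma cvgCD f g a b : f @ F --> a -> g @ F --> b ->
  f t + g t @[t --> F] --> a + b.
Proof.
move=> /cvgC_ReIm[f1 f2] /cvgC_ReIm[g1 g2]; apply/cvgC_ReIm.
rewrite ReD ImD; split.
  by under eq_fun do rewrite ReD; exact: cvgD.
by under eq_fun do rewrite ImD; exact: cvgD.
Qed.

Lemma cvgCM f g a b : f @ F --> a -> g @ F --> b ->
  f t * g t @[t --> F] --> a * b.
Proof.
move=> /cvgC_ReIm[f1 f2] /cvgC_ReIm[g1 g2]; apply/cvgC_ReIm.
rewrite ReM ImM; split.
  by under eq_fun do rewrite ReM; apply: cvgB; exact: cvgM.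
by under eq_fun do rewrite ImM; apply: cvgD; exact: cvgM.
Qed.

Lemma cvgCJ f a : f @ F --> a -> (f t)^* @[t --> F] --> a^*.
Proof.
move=> /cvgC_ReIm[f1 f2]; apply/cvgC_ReIm; rewrite ReJ ImJ; split.
  by under eq_fun do rewrite ReJ.
by under eq_fun do rewrite ImJ; exact: cvgN.
Qed.

Lemma cvgCR (h : T -> R) (r : R) : h @ F --> r -> (h t)%:C @[t --> F] --> r%:C.
Proof. by move=> hr; apply/cvgC_ReIm; split => //=; exact: cvg_cst. Qed.

Lemma cvgC_sum I (s : seq I) (P : pred I) (f : I -> T -> C) (a : I -> C) :
  (forall i, P i -> f i @ F --> a i) ->
  \sum_(i <- s | P i) f i t @[t --> F] --> \sum_(i <- s | P i) a i.
Proof.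
move=> h; elim: s => [|i s IH].
  rewrite big_nil (_ : (fun t => _) = cst 0); first exact: cvg_cst.
  by apply/funext => t; rewrite big_nil.
rewrite big_cons (_ : (fun t => _) = fun t => if P i then f i t +
    \sum_(j <- s | P j) f j t else \sum_(j <- s | P j) f j t); last first.
  by apply/funext => t; rewrite big_cons.
case: (boolP (P i)) => Pi; last exact: IH.
by apply: cvgCD; [exact: h|exact: IH].
Qed.

Lemma cvgC_prod I (s : seq I) (P : pred I) (f : I -> T -> C) (a : I -> C) :
  (forall i, P i -> f i @ F --> a i) ->
  \prod_(i <- s | P i) f i t @[t --> F] --> \prod_(i <- s | P i) a i.
Proof.
move=> h; elim: s => [|i s IH].
  rewrite big_nil (_ : (fun t => _) = cst 1); first exact: cvg_cst.
  by apply/funext => t; rewrite big_nil.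
rewrite big_cons (_ : (fun t => _) = fun t => if P i then f i t *
    \prod_(j <- s | P j) f j t else \prod_(j <- s | P j) f j t); last first.
  by apply/funext => t; rewrite big_cons.
case: (boolP (P i)) => Pi; last exact: IH.
by apply: cvgCM; [exact: h|exact: IH].
Qed.

Lemma cvgC_normc f a : f @ F --> a -> normc (f t) @[t --> F] --> normc a.
Proof.
move=> /cvgC_ReIm[f1 f2].
have e w : normc w = Num.sqrt (csq w) :> R by rewrite /csq; case: w.
rewrite e; under eq_fun do rewrite e.
apply: cvg_comp; last exact: sqrt_continuous.
rewrite /csq; apply: cvgD.
  by rewrite expr2; under eq_fun do rewrite expr2; exact: cvgM.
by rewrite expr2; under eq_fun do rewrite expr2; exact: cvgM.
Qed.

Lemma cvgC_csq f a : f @ F --> a -> csq (f t) @[t --> F] --> csq a.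
Proof.
move=> /cvgC_normc h; rewrite csqE; under eq_fun do rewrite csqE.
by rewrite expr2; under eq_fun do rewrite expr2; exact: cvgM.
Qed.

Lemma cvgC_cis (h : T -> R) (r : R) :
  h @ F --> r -> cis (h t) @[t --> F] --> cis r.
Proof.
move=> hr; apply/cvgC_ReIm; split => /=.
  by apply: cvg_comp hr _; exact: continuous_cos.
by apply: cvg_comp hr _; exact: continuous_sin.
Qed.

End filter.

End ComplexLimits.

(** * Cut-offs of locally square-integrable functions *)

Section SupportedFunctions.
Variables (R : realType) (d : nat).
Local Notation RT := (measurableTypeR R).
Local Notation C := R[i].
Local Notation E := 'rV[R]_d.
Local Notation leb := (leb R d).

Lemma measurable_continuous_vec (h : E -> R) :
  continuous h -> measurable_fun setT (fun t => h (vec t) : RT).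
Proof.
move=> ch.
have := @measurability _ _ (d.-tuple RT) RT setT (fun t => h (vec t)) _
  (RGenOInfty.measurableE R).
apply.
move=> _ [_ [x ->] <-]; rewrite setTI.
apply: (@measurable_open_vec R d (h @^-1` `]x, +oo[)).
by apply: open_comp => // y _; exact: ch.
Qed.

Lemma continuous_cmeas (f : E -> C) :
  continuous f -> cmeas (fun t => f (vec t)).
Proof.
move=> cf; split.
  apply: (@measurable_continuous_vec (fun x => Re (f x))) => x.
  by have /cvgC_ReIm[] := cf x.
apply: (@measurable_continuous_vec (fun x => Im (f x))) => x.
by have /cvgC_ReIm[] := cf x.
Qed.

Lemma measurable_closed_vec (K : set E) :
  closed K -> measurable (@vec R d @^-1` K).
Proof.
move=> cK; rewrite -[K]setCK preimage_setC; apply: measurableC.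
exact: (measurable_open_vec (closed_openC cK)).
Qed.

Lemma compact_closed_rV (K : set E) : compact K -> closed K.
Proof. by move=> cK; apply: compact_closed => //; exact: norm_hausdorff. Qed.

Lemma le_coord_norm (x : E) i : `|x 0 i| <= `|x|.
Proof.
rewrite [leRHS]/Num.norm /= mx_normrE; apply/bigmax_geP; right => /=.
by exists (0, i).
Qed.

Lemma compact_cube (K : set E) : compact K ->
  exists2 L : R, 0 < L & @vec R d @^-1` K `<=` cube L.
Proof.
move=> /compact_bounded[M [Mr hM]]; pose L := Num.max M 0 + 1.
have L0 : 0 < L by rewrite ltr_wpDl// le_max lexx orbT.
exists (L + 1) => [|t Kt i]; first by rewrite addr_gt0.
have ML : M < L by rewrite (le_lt_trans (_ : M <= Num.max M 0)) ?ltrDl// le_max lexx.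
have /= h := hM _ ML _ Kt.
rewrite -ltr_norml; apply: (@le_lt_trans _ _ L); last by rewrite ltrDl.
apply: le_trans h; rewrite -vecE; exact: le_coord_norm.
Qed.

Lemma compact_bound_normc (K : set E) (f : E -> C) : compact K -> continuous f ->
  exists2 M : R, 0 <= M & forall x, K x -> normc (f x) <= M.
Proof.
move=> cK cf.
have cn : continuous (fun x => normc (f x)) by move=> x; exact: (cvgC_normc (cf x)).
have := continuous_compact (continuous_subspaceT cn) cK.
move=> /compact_bounded[M [_ hM]].
exists (Num.max M 0 + 1); first by rewrite addr_ge0// le_max lexx orbT.
move=> x Kx; rewrite -[normc _]ger0_norm ?normc_ge0//.
apply: (hM (Num.max M 0 + 1)); last by exists x.
by rewrite (le_lt_trans (_ : M <= Num.max M 0)) ?ltrDl// le_max lexx.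
Qed.

Variable Omega : set E.
Hypothesis Omega_open : open Omega.

Lemma CcM (a th : E -> C) : continuous a -> Cc Omega th ->
  Cc Omega (fun x => a x * th x).
Proof.
move=> ca [cth [K [cK KO th0]]]; split; last first.
  by exists K; split => // x /th0 ->; rewrite mulr0.
by move=> x; exact: (cvgCM (ca x) (cth x)).
Qed.

(* A is only continuous on Omega, and its product with th is extended by zero. *)
Lemma CcM_within (a th : E -> C) : {within Omega, continuous a} -> Cc Omega th ->
  Cc Omega (fun x => a x * th x).
Proof.
move=> /subspace_continuousP ca [cth [K [cK KO th0]]]; split; last first.
  by exists K; split => // x /th0 ->; rewrite mulr0.
move=> x; have [Ox|nOx] := pselect (Omega x).
  have := ca x Ox; rewrite within_interior => [h|].
    exact: (cvgCM h (cth x)).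
  by move: Omega_open; rewrite openE; exact.
have nKx : ~ K x by move=> /KO.
have : (\forall y \near x, a y * th y = 0).
  have oK : open (~` K) by apply: closed_openC; exact: compact_closed_rV.
  apply: filterS (open_nbhs_nbhs (conj oK nKx)) => y /= /th0 ->.
  by rewrite mulr0.
move=> /cvg_near_cst h.
have e : a x * th x = 0 by rewrite th0// mulr0.
by rewrite -e in h; exact: h.
Qed.

Variables (r : nat) (w : E -> 'cV[C]_r).
Hypothesis w_L2 : L2loc Omega w.

(** [w] is measurable only on [Omega], but the product vanishes off a compact subset of it:
    restricting to [Omega] gives measurability, and bounding [th] on that compact set gives the
    integral. *)
Lemma CcL2loc (th : E -> C) (j : 'I_r) : Cc Omega th ->
  let v := fun t => th (vec t) * w (vec t) j 0 in
  cmeas v /\ leb.-integrable setT (fun t => (csq (v t))%:E).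
Proof.
move=> [cth [K [cK KO th0]]] v.
have [mw wK] := w_L2.
have mO : measurable (@vec R d @^-1` Omega) by exact: measurable_open_vec.
have mK : measurable (@vec R d @^-1` K).
  by apply: measurable_closed_vec; exact: compact_closed_rV.
have [m1 m2] := mw j.
have [t1 t2] := continuous_cmeas cth.
have mv : cmeas v.
  have patch_v (p : C -> R) : p 0 = 0 -> (fun t => p (v t)) =
      (fun t => p (v t)) \_ (@vec R d @^-1` Omega).
    move=> p0; apply/funext => t; rewrite patchE; case: ifPn => // /negP.
    rewrite inE => nO; rewrite /v th0 ?mul0r ?p0// => /KO.
    exact: nO.
  split.
    rewrite (patch_v (@complex.Re R))//; apply/(measurable_restrictT _ _).1 => //.
    under eq_fun do rewrite ReM.
    apply: measurable_funB; apply: measurable_funM => //; exact: measurable_funTS.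
  rewrite (patch_v (@complex.Im R))//; apply/(measurable_restrictT _ _).1 => //.
  under eq_fun do rewrite ImM.
  apply: measurable_funD; apply: measurable_funM => //; exact: measurable_funTS.
split => //.
have [M M0 thM] := compact_bound_normc cK cth.
apply: ge0_integrable; [exact: measurable_csq|move=> t; exact: csq_ge0|].
have lK := wK K cK KO.
have mS : measurable_fun (@vec R d @^-1` K)
    (fun t => (\sum_j csq (w (vec t) j 0))%:E).
  apply/measurable_EFinP; apply: measurable_sum => k.
  have [a1 a2] := mw k.
  apply: measurable_funD; apply: measurable_funX.
    by apply: measurable_funS a1 => //; exact: preimage_subset.
  by apply: measurable_funS a2 => //; exact: preimage_subset.
have e : (\int[leb]_t (csq (v t))%:E =
    \int[leb]_(t in @vec R d @^-1` K) (csq (v t))%:E)%E.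
  rewrite [RHS]integral_mkcond; apply: eq_integral => t _; rewrite patchE.
  case: ifPn => // /negP; rewrite inE => nK.
  by rewrite /v th0// mul0r csq0.
have ub : (\int[leb]_(t in @vec R d @^-1` K) (csq (v t))%:E <=
    (M ^+ 2)%:E * nnint K (fun x => (\sum_j csq (w x j 0))%R))%E.
  rewrite /nnint -ge0_integralZl//; last 2 first.
    by move=> t _; rewrite lee_fin; apply: sumr_ge0 => k _; exact: csq_ge0.
    by rewrite lee_fin sqr_ge0.
  apply: ge0_le_integral => //.
  - by move=> t _; rewrite lee_fin csq_ge0.
  - apply/measurable_EFinP; apply: measurable_funTS; exact: measurable_csq.
  - by apply: emeasurable_funM => //; exact: measurable_cst.
  move=> t Kt; rewrite -EFinM lee_fin /v csqM.
  apply: ler_pM; rewrite ?csq_ge0//.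
    by rewrite csqE lerXn2r ?nnegrE ?normc_ge0//; exact: thM.
  by rewrite (bigD1 j)//= lerDl; apply: sumr_ge0 => k _; exact: csq_ge0.
rewrite e (le_lt_trans ub)// lte_mul_pinfty// lee_fin sqr_ge0//.
Qed.

End SupportedFunctions.

(** * The localised sequence *)

Section ComplexInverse.
Variable R : realType.
Local Notation C := R[i].

Lemma invc_csq (z : C) : z^-1 = z^* * ((csq z)^-1)%:C.
Proof.
have [->|z0] := eqVneq z 0; first by rewrite invr0 rmorph0 mul0r.
apply: (mulfI z0); rewrite mulfV// mulrA -csq_mulJ -rmorphM mulfV//.
apply: contraNneq z0; rewrite csqE => /eqP; rewrite sqrf_eq0 => /eqP h.
by apply/eqP; exact: Normc.eq0_normc.
Qed.

Lemma csq_neq0 (z : C) : z != 0 -> csq z != 0.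
Proof.
apply: contraNneq; rewrite csqE => /eqP; rewrite sqrf_eq0 => /eqP h.
by apply/eqP; exact: Normc.eq0_normc.
Qed.

Lemma cvgCV {T} {F : set_system T} {FF : Filter F} (f : T -> C) (a : C) :
  a != 0 -> f @ F --> a -> (f t)^-1 @[t --> F] --> a^-1.
Proof.
move=> a0 fa; rewrite invc_csq; under eq_fun do rewrite invc_csq.
apply: cvgCM; first exact: cvgCJ.
apply: cvgCR; apply: cvgV; first exact: csq_neq0.
exact: cvgC_csq.
Qed.

Lemma chi1_num_neq0 (y : R) :
  1 - (expR (-1))%:C * cis (- (2 * pi * y)) != 0 :> C.
Proof.
rewrite subr_eq0; apply/eqP => h.
have := congr1 (@Normc.normc R) h.
rewrite Normc.normc1 Normc.normcM normc_cis mulr1 normcC ger0_norm ?expR_ge0//.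
by apply/eqP; rewrite gt_eqF// -[ltRHS]expR0 ltr_expR ltrN10.
Qed.

Lemma chi1_den_neq0 (y : R) : 1 +i* (2 * pi * y) != 0 :> C.
Proof. by rewrite eq_complex /= oner_eq0. Qed.

Lemma chi1_neq0 (y : R) : chi1 y != 0.
Proof. by rewrite mulf_neq0 ?invr_eq0 ?chi1_num_neq0 ?chi1_den_neq0. Qed.

Lemma cvg_chi1 {T} {F : set_system T} {FF : Filter F} (h : T -> R) (y : R) :
  h @ F --> y -> chi1 (h t) @[t --> F] --> chi1 y.
Proof.
move=> hy; have c2 : 2 * pi * h t @[t --> F] --> 2 * pi * y.
  by apply: cvgM => //; exact: cvg_cst.
have c3 : (- expR (-1))%:C * cis (- (2 * pi * h t)) @[t --> F] -->
    ((- expR (-1))%:C * cis (- (2 * pi * y)) : C).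
  exact: (cvgCM (cvg_cst _) (cvgC_cis (cvgN c2))).
have c4 : 1 +i* (2 * pi * h t) @[t --> F] --> (1 +i* (2 * pi * y) : C).
  by apply/cvgC_ReIm; split => //=; exact: cvg_cst.
have e z : chi1 z = (1 + (- expR (-1))%:C * cis (- (2 * pi * z))) *
    (1 +i* (2 * pi * z))^-1 by rewrite /chi1 rmorphN mulNr.
rewrite e; under eq_fun do rewrite e.
exact: (cvgCM (cvgCD (cvg_cst _) c3) (cvgCV (chi1_den_neq0 y) c4)).
Qed.

Lemma continuous_invchi d :
  continuous (fun x : 'rV[R]_d => (\prod_i chi1 (x 0 i))^-1).
Proof.
have n0 (x : 'rV[R]_d) : \prod_i chi1 (x 0 i) != 0.
  by apply/prodf_neq0 => i _; exact: chi1_neq0.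
move=> x.
have hc i : (y : 'rV[R]_d) 0 i @[y --> x] --> x 0 i by exact: coord_continuous.
have h i : chi1 ((y : 'rV[R]_d) 0 i) @[y --> x] --> chi1 (x 0 i).
  exact: (cvg_chi1 (hc i)).
exact: (cvgCV (n0 x) (cvgC_prod (P := xpredT) (fun i _ => h i))).
Qed.

End ComplexInverse.

Section LocalizedFourier.
Variables (R : realType) (d : nat).
Local Notation RT := (measurableTypeR R).
Local Notation C := R[i].
Local Notation E := 'rV[R]_d.
Local Notation leb := (leb R d).

Lemma cvgR_sum {T} {F : set_system T} {FF : Filter F} I (s : seq I)
    (h : I -> T -> R) (a : I -> R) :
  (forall i, h i @ F --> a i) ->
  \sum_(i <- s) h i t @[t --> F] --> \sum_(i <- s) a i.
Proof.
move=> hi; elim: s => [|i s IH].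
  rewrite big_nil (_ : (fun t => _) = cst 0); first exact: cvg_cst.
  by apply/funext => t; rewrite big_nil.
rewrite big_cons (_ : (fun t => _) = fun t => h i t + \sum_(j <- s) h j t).
  by apply: cvgD; [exact: hi|exact: IH].
by apply/funext => t; rewrite big_cons.
Qed.

Lemma cvg_dotp (f g : E -> E) (x : E) : {for x, continuous f} ->
  {for x, continuous g} -> dotp (f y) (g y) @[y --> x] --> dotp (f x) (g x).
Proof.
move=> cf cg.
have h (k : E -> E) i : {for x, continuous k} -> k y 0 i @[y --> x] --> k x 0 i.
  move=> ck; have cc : {for k x, continuous (fun y : E => y 0 i)}.
    exact: coord_continuous.
  exact: (continuous_comp ck cc).
have hm i : f y 0 i * g y 0 i @[y --> x] --> f x 0 i * g x 0 i.
  exact: (cvgM (h f i cf) (h g i cg)).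
exact: (cvgR_sum hm).
Qed.

Lemma dotp_vec (s t : d.-tuple RT) : dotp (vec s) (vec t) = dott s t.
Proof. by apply: eq_bigr => i _; rewrite !vecE. Qed.

Lemma fourier_vec (f : E -> C) t : fourier f (vec t) = FT (fun s => f (vec s)) t.
Proof. by apply: eq_CInt => s; rewrite dotp_vec. Qed.

Variables (Omega : set E) (r : nat) (u : nat -> E -> 'cV[C]_r).
Hypotheses (Omega_open : open Omega) (u0 : weakly_to0 Omega u).

Definition loc (th : E -> C) (j : 'I_r) (N : nat) : d.-tuple RT -> C :=
  fun t => th (vec t) * u N (vec t) j 0.

Lemma Cc_cube th : Cc Omega th ->
  exists2 L : R, 0 < L & forall t, ~ cube L t -> th (vec t) = 0.
Proof.
move=> [_ [K [cK _ th0]]]; have [L L0 KL] := compact_cube cK.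
by exists L => // t nL; apply: th0 => Kt; apply: nL; exact: KL.
Qed.

Lemma loc_L2 th j N : Cc Omega th ->
  [/\ cmeas (loc th j N), CI leb (loc th j N),
      cmeas (FT (loc th j N)) &
      leb.-integrable setT (fun t => (csq (FT (loc th j N) t))%:E)].
Proof.
move=> cth; have [mv iv] := CcL2loc Omega_open (u0.1 N) j cth.
have [L L0 thL] := Cc_cube cth.
have v0 t : ~ cube L t -> loc th j N t = 0 by move=> h; rewrite /loc thL// mul0r.
split; [exact: mv|exact: CI_of_csq mv iv v0|exact: cmeas_FT|].
exact: integrable_csq_FT L0 mv iv v0.
Qed.

(** For fixed [t] the transform is the pairing of [u N] with one vector field: the conjugate of exp
    (-2 pi i x.t) th(x) in component [j] and 0 elsewhere, which is bounded with compact support and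
    hence an admissible L^2 test. *)
Lemma FT_loc_cvg0 th j t : Cc Omega th ->
  FT (loc th j N) t @[N --> \oo] --> (0 : C).
Proof.
move=> [cth sth]; have [_ w0] := u0.
pose e (x : E) : C := cis (- (2 * pi * dotp x (vec t))).
have ce : continuous e.
  move=> x.
  have cd : dotp y (vec t) @[y --> x] --> dotp x (vec t).
    have c1 : {for x, continuous (@id E)} by exact: cvg_id.
    have c2 : {for x, continuous (fun _ : E => vec t)} by exact: cst_continuous.
    exact: (cvg_dotp c1 c2).
  exact: (cvgC_cis (cvgN (cvgM (cvg_cst (2 * pi)) cd))).
pose g0 (x : E) : C := (e x * th x)^*.
have cg0 : continuous g0.
  by move=> x; exact: (cvgCJ (cvgCM (ce x) (cth x))).
have sg0 : supported_in Omega g0.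
  have [K [cK KO th0]] := sth; exists K; split => // x /th0 h.
  by rewrite /g0 h mulr0 rmorph0.
pose g (x : E) : 'cV[C]_r := \col_k (if k == j then g0 x else 0).
have gE k : (fun x => g x k 0) = if k == j then g0 else cst 0.
  by apply/funext => x; rewrite mxE; case: ifP.
have h1 k : cmeasurable setT (fun x => g x k 0).
  rewrite gE; case: ifP => _; first exact: continuous_cmeas.
  by split; exact: measurable_cst.
have h3 k : supported_in Omega (fun x => g x k 0).
  rewrite gE; case: ifP => // _; exists set0; split => //; exact: compact0.
have [K [cK KO g0K]] := sg0.
have [M M0 gM] := compact_bound_normc cK cg0.
have [L L0 KL] := compact_cube cK.
have h2 : (nnint setT (fun x => (\sum_k csq (g x k 0))%R) < +oo)%E.
  have I1 := integrable_obox (fun=> - L) (fun=> L) (M ^+ 2) :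
    leb.-integrable setT _.
  apply: (le_lt_trans _ (integrable_lty measurableT I1)).
  rewrite /nnint preimage_setT; apply: ge0_le_integral => //.
  - by move=> s _; rewrite lee_fin; apply: sumr_ge0 => k _; exact: csq_ge0.
  - apply/measurable_EFinP; apply: measurable_sum => k.
    exact: measurable_csq (h1 k).
  - by case/integrableP : I1.
  move=> s _; rewrite lee_fin (bigD1 j)//= big1 => [|k kj]; last first.
    by rewrite mxE (negbTE kj) csq0.
  rewrite addr0 mxE eqxx indicE.
  have [Ks|nKs] := pselect (K (vec s)).
    rewrite mem_set ?mulr1; last exact: KL.
    by rewrite csqE lerXn2r ?nnegrE ?normc_ge0//; exact: gM.
  by rewrite g0K// csq0 mulr_ge0// sqr_ge0.
have := w0 g h1 h2 h3.
apply: cvg_trans; apply: near_eq_cvg; apply: nearW => N /=.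
apply: eq_CInt => s; rewrite (bigD1 j)//= big1 => [|k kj]; last first.
  by rewrite mxE (negbTE kj) rmorph0 mulr0.
by rewrite addr0 mxE eqxx conjCK /e dotp_vec /loc; ring.
Qed.

Variable (eps : nat -> R).
Variable mu : 'I_r -> 'I_r -> (E * (E * \bar R) -> C) -> C.
Hypothesis muH : one_scale_Hmeasure Omega u eps mu.

Lemma FT_loc_bounded th j : Cc Omega th -> exists B : R, forall N,
  (\int[leb]_t (csq (FT (loc th j N) t))%:E <= B%:E)%E.
Proof.
move=> cth; have [_ _ h] := muH.
have c1 : {within @K0oo R d, continuous (fun=> 1 : C)}.
  by apply: continuous_subspaceT => x; exact: cvg_cst.
have {h} := h th th cth cth (fun=> 1) c1 j j.
move=> /cvgC_ReIm[+ _] => /cvgP /cvg_seq_bounded[M [_ hM]].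
exists (M + 1) => N.
have [_ _ mF IF] := loc_L2 j N cth.
have e : \int[leb]_t csq (FT (loc th j N) t) = \int[leb]_t Re
    (fourier (fun x => th x * u N x j 0) (vec t) *
     (fourier (fun x => th x * u N x j 0) (vec t))^* * 1).
  by apply: eq_Rintegral => t _; rewrite mulr1 !fourier_vec -csq_mulJ.
have le1 : `|\int[leb]_t csq (FT (loc th j N) t)| <= M + 1.
  by rewrite e; apply: (hM (M + 1)); rewrite // ltrDl ltr01.
have fin : (\int[leb]_t (csq (FT (loc th j N) t))%:E)%E \is a fin_num.
  exact: integrable_fin_num.
by rewrite -(fineK fin) lee_fin; apply: le_trans le1; exact: ler_norm.
Qed.

Lemma FT_loc_sup_bounded th j : Cc Omega th -> exists M : R, forall N t,
  csq (FT (loc th j N) t) <= M.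
Proof.
move=> cth.
pose th' (x : E) := (\prod_i chi1 (x 0 i))^-1 * th x.
have cth' : Cc Omega th' by apply: CcM => //; exact: continuous_invchi.
have [B hB] := FT_loc_bounded j cth'.
pose M := 2 * (fine (leb (obox (fun=> 0) (fun=> 1))) + B).
exists (M ^+ 2) => N t; have [_ Iv _ IF] := loc_L2 j N cth'.
have e : loc th j N = fun s => chi s * loc th' j N s.
  apply/funext => s; rewrite /loc /th' mulrA mulrA.
  have -> : chi s = \prod_i chi1 (vec s 0 i).
    by apply: eq_bigr => i _; rewrite vecE.
  rewrite mulfV ?mul1r//; apply/prodf_neq0 => i _; exact: chi1_neq0.
have h := FT_sup_bound t Iv IF.
have fin : (\int[leb]_t (csq (FT (loc th' j N) t))%:E)%E \is a fin_num.
  exact: integrable_fin_num.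
have hB' : \int[leb]_t csq (FT (loc th' j N) t) <= B.
  by rewrite -lee_fin /Rintegral fineK.
have h' : normc (FT (loc th j N) t) <= M.
  by rewrite e; apply: (le_trans h); rewrite /M ler_pM2l// lerD2l.
by rewrite csqE lerXn2r ?nnegrE ?normc_ge0// (le_trans _ h') ?normc_ge0.
Qed.

Definition kap (t : d.-tuple RT) : R := (1 + dott t t)^-1.

Lemma dott_ge0 (t : d.-tuple RT) : 0 <= dott t t.
Proof. by apply: sumr_ge0 => i _; rewrite -expr2 sqr_ge0. Qed.

Lemma kap01 t : 0 <= kap t <= 1.
Proof.
have := dott_ge0 t => h; rewrite /kap invr_ge0 addr_ge0//=.
by rewrite invf_le1 ?lerDl// ltr_pwDl.
Qed.

Lemma measurable_kap : measurable_fun setT kap.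
Proof.
have -> : kap = fun t => (1 + dotp (vec t) (vec t))^-1.
  by apply/funext => t; rewrite /kap dotp_vec.
suff ck : continuous (fun x : E => (1 + dotp x x)^-1).
  exact: (measurable_continuous_vec ck).
move=> x; have n0 : 1 + dotp x x != 0.
  rewrite gt_eqF// ltr_pwDl//; apply: sumr_ge0 => i _.
  by rewrite -expr2 sqr_ge0.
have c1 : {for x, continuous (@id E)} by exact: cvg_id.
have c2 : dotp y y @[y --> x] --> dotp x x by exact: (cvg_dotp c1 c1).
have cd : 1 + dotp y y @[y --> x] --> 1 + dotp x x.
  exact: (cvgD (cvg_cst (1 : R)) c2).
exact: (cvgV n0 cd).
Qed.

Lemma weighted_loc_cvg0 th j : Cc Omega th ->
  (\int[leb]_t (kap t * csq (FT (loc th j N) t))%:E @[N --> \oo] --> 0)%E.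
Proof.
move=> cth; have [B hB] := FT_loc_bounded j cth.
have [M hM] := FT_loc_sup_bounded j cth.
apply: (@weighted_L2_cvg0 _ _ _ _ B M) => //.
- by move=> N; have [] := loc_L2 j N cth.
- move=> t; rewrite -[X in _ --> X](csq0 R); exact: (cvgC_csq (FT_loc_cvg0 j t cth)).
- exact: measurable_kap.
- exact: kap01.
move=> e e0; exists (e^-1 + 1) => t nt.
have [i hi] : exists i, e^-1 + 1 <= `|tnth t i|.
  apply: contra_notP nt => /forallNP h i; rewrite -ltr_norml ltNge.
  by apply/negP; exact: h.
rewrite /kap invf_ple ?posrE//; last by rewrite ltr_pwDl// dott_ge0.
apply: (@le_trans _ _ (1 + tnth t i ^+ 2)).
  have e1 : 0 < e^-1 by rewrite invr_gt0.
  by rewrite -real_normK ?num_real//; nra.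
rewrite lerD2l /dott (bigD1 i)//= expr2 lerDl; apply: sumr_ge0 => k _.
by rewrite -expr2 sqr_ge0.
Qed.

End LocalizedFourier.

(** * Smooth bumps *)

Section DerivativeSequences.
Variable R : realType.
Local Notation C := R[i].

Lemma is_derive_cvgP (f : R -> R) (x df : R) :
  is_derive x (1 : R) f df <->
  h^-1 * (f (h + x) - f x) @[h --> (0 : R)^'] --> df.
Proof.
have e : (fun h : R => h^-1 *: ((f \o shift x) (h *: (1 : R)) - f x)) =
    (fun h => h^-1 * (f (h + x) - f x)).
  by apply/funext => h /=; rewrite /GRing.scale /= mulr1.
split=> [[df1 df2]|h].
  by rewrite -df2 -e; exact: df1.
by split; [rewrite /derivable e; apply/cvg_ex; exists df|
  rewrite /derive e; apply: cvg_lim].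
Qed.

Lemma is_derive_near (f g : R -> R) (x df : R) :
  (\forall y \near x, f y = g y) ->
  is_derive x (1 : R) g df -> is_derive x (1 : R) f df.
Proof.
move=> fg /is_derive_cvgP dg; apply/is_derive_cvgP.
have fx : f x = g x by exact: nbhs_singleton fg.
apply: cvg_trans dg; apply: near_eq_cvg.
have c : h + x @[h --> (0 : R)^'] --> x.
  rewrite -[X in _ --> X](add0r x); apply: cvgD; last exact: cvg_cst.
  exact: cvg_within.
have fg' : \forall h \near (0 : R)^', f (h + x) = g (h + x) by exact: (c _ fg).
by apply: filterS fg' => h ->; rewrite fx.
Qed.

(** The difference quotient is at most M |h|. Meant for the junction point of [eta], where no
    formula can be differentiated. *)
Lemma is_derive0_quadratic (f : R -> R) (x M : R) :
  (forall y, `|f y - f x| <= M * (y - x) ^+ 2) -> is_derive x (1 : R) f 0.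
Proof.
move=> hM; apply/is_derive_cvgP.
have c : M * `|h| @[h --> (0 : R)^'] --> (0 : R).
  have : `|h| @[h --> (0 : R)] --> `|0 : R| by exact: norm_continuous.
  rewrite normr0 => cn.
  have cn' : `|h| @[h --> (0 : R)^'] --> (0 : R).
    by apply: cvg_trans cn; apply: cvg_app; exact: nbhs_dnbhs.
  have : M * `|h| @[h --> (0 : R)^'] --> M * 0 by exact: (cvgM (cvg_cst M) cn').
  by rewrite mulr0.
apply/norm_cvg0P; apply: (squeeze_cvgr _ (cvg_cst 0) c).
near=> h; rewrite normr_ge0 /= normrM normfV.
have h0 : 0 < `|h| by rewrite normr_gt0; near: h; exact: nbhs_dnbhs_neq.
rewrite mulrC ler_pdivrMr// (le_trans (hM _))// addrK -mulrA -expr2.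
by rewrite real_normK ?num_real.
Unshelve. all: by end_near. Qed.

(** A smooth function of one variable packaged with explicit derivatives: [F k] is the k-th
    derivative of [F 0]. Carrying the whole sequence turns iterated partial derivatives of products
    into shifts of indices. *)
Definition dseq (F : nat -> R -> C) := forall k (x : R),
  is_derive x (1 : R) (fun y => Re (F k y)) (Re (F k.+1 x)) /\
  is_derive x (1 : R) (fun y => Im (F k y)) (Im (F k.+1 x)).

Lemma dseq_continuous F k : dseq F -> continuous (F k).
Proof.
move=> dF x; apply/cvgC_ReIm; have [[d1 _] [d2 _]] := dF k x.
by split; [move/derivable1_diffP/differentiable_continuous: d1|
  move/derivable1_diffP/differentiable_continuous: d2].
Qed.

(** Pascal's rule: the inductive step of the Leibniz formula, separated from differentiation. *)
Lemma Leibniz_shift (f g : nat -> C) n :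
  \sum_(k < n.+1) 'C(n, k)%:R * (f k.+1 * g (n - k)%N + f k * g (n - k).+1) =
  \sum_(k < n.+2) 'C(n.+1, k)%:R * (f k * g (n.+1 - k)%N).
Proof.
rewrite [RHS]big_ord_recl /= bin0.
under [X in _ = _ + X]eq_bigr => k _.
  rewrite /bump /= add1n binS subSS natrD mulrDl.
  over.
rewrite big_split /= addrA.
have -> : 1%:R * (f 0 * g (n.+1 - 0)%N) +
    \sum_(i < n.+1) 'C(n, i.+1)%:R * (f i.+1 * g (n - i)%N) =
    \sum_(k < n.+1) 'C(n, k)%:R * (f k * g (n - k).+1).
  rewrite big_ord_recr /= bin_small// mul0r addr0.
  rewrite [RHS]big_ord_recl /= bin0 !subn0; congr (_ + _).
  by apply: eq_bigr => i _; rewrite /bump /= add1n subnSK.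
under eq_bigr do rewrite mulrDr.
by rewrite big_split /= addrC.
Qed.

Definition mulseq (F G : nat -> R -> C) n (x : R) : C :=
  \sum_(k < n.+1) 'C(n, k)%:R * (F k x * G (n - k)%N x).

Lemma dseqM F G : dseq F -> dseq G -> dseq (mulseq F G).
Proof.
move=> dF dG n x; rewrite /mulseq.
rewrite -(Leibniz_shift (F ^~ x) (G ^~ x) n).
have natE (k : nat) : k%:R = (k%:R)%:C :> C by rewrite rmorph_nat.
split.
  have -> : (fun y => Re (\sum_(k < n.+1) 'C(n, k)%:R * (F k y * G (n - k)%N y))) =
     \sum_(k < n.+1) (fun y => 'C(n, k)%:R * (Re (F k y) * Re (G (n - k)%N y) -
        Im (F k y) * Im (G (n - k)%N y))).
    apply/funext => y; rewrite Re_sum fct_sumE; apply: eq_bigr => k _.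
    by rewrite natE ReM /= mul0r subr0 ReM.
  rewrite Re_sum; apply: is_derive_sum => k.
  have [f1 f2] := dF k x; have [g1 g2] := dG (n - k)%N x.
  apply: is_derive_eq; rewrite natE ReM /= mul0r subr0 ReD !ReM.
  by rewrite /GRing.scale /=; ring.
have -> : (fun y => Im (\sum_(k < n.+1) 'C(n, k)%:R * (F k y * G (n - k)%N y))) =
   \sum_(k < n.+1) (fun y => 'C(n, k)%:R * (Re (F k y) * Im (G (n - k)%N y) +
      Im (F k y) * Re (G (n - k)%N y))).
  apply/funext => y; rewrite Im_sum fct_sumE; apply: eq_bigr => k _.
  by rewrite natE ImM /= mul0r addr0 ImM.
rewrite Im_sum; apply: is_derive_sum => k.
have [f1 f2] := dF k x; have [g1 g2] := dG (n - k)%N x.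
apply: is_derive_eq; rewrite natE ImM /= mul0r addr0 ImD !ImM.
by rewrite /GRing.scale /=; ring.
Qed.

Lemma dseq_affine F (c e : R) : dseq F ->
  dseq (fun n x => (c ^+ n)%:C * F n (c * x + e)).
Proof.
move=> dF n x; have [d1 d2] := dF n (c * x + e).
have da : is_derive x (1 : R) (fun y : R => c * y + e) c.
  by apply: is_derive_eq; rewrite /GRing.scale /= mulr1 addr0.
have D1 := @is_derive1_comp _ (fun y => Re (F n y)) (fun y => c * y + e) x
  _ _ d1 da.
have D2 := @is_derive1_comp _ (fun y => Im (F n y)) (fun y => c * y + e) x
  _ _ d2 da.
split.
  have -> : (fun y => Re ((c ^+ n)%:C * F n (c * y + e))) =
      (fun y => c ^+ n * Re (F n (c * y + e))).
    by apply/funext => y; rewrite ReM /= mul0r subr0.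
  apply: is_derive_eq; rewrite ReM /= mul0r subr0 exprSr.
  by rewrite /GRing.scale /=; ring.
have -> : (fun y => Im ((c ^+ n)%:C * F n (c * y + e))) =
    (fun y => c ^+ n * Im (F n (c * y + e))).
  by apply/funext => y; rewrite ImM /= mul0r addr0.
apply: is_derive_eq; rewrite ImM /= mul0r addr0 exprSr.
by rewrite /GRing.scale /=; ring.
Qed.

(* The n-th derivative of [exp(-1/t)] on [t > 0] is [p_n(1/t) exp(-1/t)]. *)
Fixpoint etapoly n : {poly R} :=
  if n is m.+1 then 'X^2 * (etapoly m - (etapoly m)^`()) else 1.

Definition eta n (t : R) : R :=
  if 0 < t then (etapoly n).[t^-1] * expR (- t^-1) else 0.

(** Each y^i exp (- y) is at most i!, because exp y dominates the term y^i / i! of its series. *)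
Lemma poly_expN_bounded (p : {poly R}) :
  exists M : R, forall y, 0 <= y -> `|p.[y]| * expR (- y) <= M.
Proof.
exists (\sum_(i < size p) `|p`_i| * (i`!)%:R) => y y0.
rewrite horner_coef.
apply: (@le_trans _ _ (\sum_(i < size p) (`|p`_i| * (y ^+ i * expR (- y))))).
  under [leRHS]eq_bigr do rewrite mulrA.
  rewrite -mulr_suml ler_wpM2r ?expR_ge0// (le_trans (ler_norm_sum _ _ _))//.
  by apply: ler_sum => i _; rewrite normrM (ger0_norm (exprn_ge0 _ y0)).
apply: ler_sum => i _; rewrite ler_wpM2l//.
rewrite expRN ler_pdivrMr ?expR_gt0//.
case: (nat_of_ord i) => [|k].
  by rewrite expr0 mul1r -expR0 ler_expR.
have := expR_ge1Dxn k y0.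
have f0 : 0 < (k.+1)`!%:R :> R by rewrite ltr0n fact_gt0.
move=> h; rewrite mulrC -ler_pdivrMr//; apply: le_trans h.
by rewrite lerDr.
Qed.

(** With y = 1/t this says that y^2 p(y) exp (- y) is bounded for y >= 0. It is the flatness at 0
    that makes every derivative of [eta] vanish there. *)
Lemma eta_quadratic n : exists M : R, forall t, `|eta n t| <= M * t ^+ 2.
Proof.
have [M hM] := poly_expN_bounded ('X^2 * etapoly n).
have M0 : 0 <= M.
  by apply: le_trans (hM 0 (lexx _)); rewrite mulr_ge0// expR_ge0.
exists M => t; rewrite /eta; case: ifPn => t0; last first.
  by rewrite normr0 mulr_ge0// sqr_ge0.
have ti0 : 0 <= t^-1 by rewrite invr_ge0 ltW.
have := hM _ ti0; rewrite hornerM hornerXn normrM normrX.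
rewrite (ger0_norm ti0) => h.
rewrite normrM (ger0_norm (expR_ge0 _)).
have t2 : 0 < t ^+ 2 by rewrite exprn_gt0.
by rewrite -ler_pdivrMr// mulrC mulrA -exprVn.
Qed.

Lemma is_derive_eta n (t : R) : is_derive t (1 : R) (eta n) (eta n.+1 t).
Proof.
have [t0|t0|<-] := ltgtP 0 t.
- apply: (@is_derive_near _ (fun s => (etapoly n).[s^-1] * expR (- s^-1))).
    near=> s; rewrite /eta ifT//.
    by near: s; exact: lt_nbhsr.
  have tn0 : t != 0 by rewrite gt_eqF.
  have di : is_derive t (1 : R) (fun s : R => s^-1) (- t ^- 2).
    have d1 := is_deriveV tn0 (is_derive_id t (1 : R)).
    apply: (@is_derive_eq _ _ _ _ _ _ _ _ d1).
    by rewrite /GRing.scale /= mulr1.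
  have dp := @is_derive1_comp _ (horner (etapoly n)) (fun s => s^-1) t
    _ _ _ di.
  have de : is_derive t (1 : R) (fun s : R => expR (- s^-1)) (t ^- 2 * expR (- t^-1)).
    have dn : is_derive t (1 : R) (fun s : R => - s^-1) (t ^- 2).
      by apply: is_derive_eq; rewrite opprK.
    have := @is_derive1_comp _ (@expR R) (fun s => - s^-1) t _ _ _ dn.
    by move=> h; apply: is_derive_eq; rewrite mulrC.
  apply: is_derive_eq.
  rewrite /eta t0 /= hornerM hornerXn hornerD hornerN /GRing.scale /= exprVn.
  ring.
- have -> : eta n.+1 t = 0 by rewrite /eta ifF// lt_gtF.
  apply: (@is_derive_near _ (cst 0)).
  near=> s; rewrite /eta ifF//; apply/negbTE; rewrite -leNgt ltW//.
  by near: s; exact: lt_nbhsl.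
- have e0 k : eta k 0 = 0 by rewrite /eta ltxx.
  rewrite e0; have [M hM] := eta_quadratic n.
  apply: (@is_derive0_quadratic _ _ M) => y.
  by rewrite e0 !subr0.
Unshelve. all: by end_near. Qed.

Lemma dseq_eta : dseq (fun n t => (eta n t)%:C).
Proof. by move=> n t; split; [exact: is_derive_eta|exact: is_derive_cst]. Qed.

End DerivativeSequences.

Section OneVariableFourier.
Variable R : realType.
Local Notation C := R[i].
Local Notation leb1 := (@lebesgue_measure R).

Lemma integrable_cs (h : R -> R) (a b : R) : continuous h ->
  (forall x, ~ (a < x < b) -> h x = 0) ->
  leb1.-integrable setT (fun x => (h x)%:E).
Proof.
move=> ch h0.
have -> : (fun x => (h x)%:E) = (EFin \o h) \_ `[a, b].
  apply/funext => x; rewrite patchE; case: ifPn => // /negP.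
  rewrite inE /= in_itv /= => nx; rewrite h0// => /andP[ax xb]; apply: nx.
  by rewrite !ltW.
rewrite -integrable_mkcond//.
apply: continuous_compact_integrable; first exact: segment_compact.
exact: continuous_subspaceT.
Qed.

Lemma CI_cs (f : R -> C) (a b : R) : continuous f ->
  (forall x, ~ (a < x < b) -> f x = 0) -> CI leb1 f.
Proof.
move=> cf f0; split.
  apply: (@integrable_cs (fun x => Re (f x)) a b) => [x|x /f0 -> //].
  by have /cvgC_ReIm[] := cf x.
apply: (@integrable_cs (fun x => Im (f x)) a b) => [x|x /f0 -> //].
by have /cvgC_ReIm[] := cf x.
Qed.

(** The derivative in x is dominated by |2 pi y p(y)| + |2 pi y q(y)|, whatever x. One real form
    covers both parts of [fhat]: (p, q) is (Re, Im) of the weighted function for the real part and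
    (Im, - Re) for the imaginary part. *)
Lemma is_derive_cos_sin_integral (p q : R -> R) (x : R) :
  leb1.-integrable setT (fun y => (p y)%:E) ->
  leb1.-integrable setT (fun y => (q y)%:E) ->
  leb1.-integrable setT (fun y => (2 * pi * y * p y)%:E) ->
  leb1.-integrable setT (fun y => (2 * pi * y * q y)%:E) ->
  is_derive x (1 : R)
    (fun x => \int[leb1]_y (p y * cos (2 * pi * y * x) + q y * sin (2 * pi * y * x)))
    (\int[leb1]_y (2 * pi * y * q y * cos (2 * pi * y * x) -
                   2 * pi * y * p y * sin (2 * pi * y * x))).
Proof.
move=> Ip Iq Ip' Iq'.
pose f (z y : R) := p y * cos (2 * pi * y * z) + q y * sin (2 * pi * y * z).
have df (y z : R) : is_derive z (1 : R) (f ^~ y)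
    (2 * pi * y * q y * cos (2 * pi * y * z) -
     2 * pi * y * p y * sin (2 * pi * y * z)).
  have dl : is_derive z (1 : R) (fun z => 2 * pi * y * z) (2 * pi * y).
    by apply: is_derive_eq; rewrite /GRing.scale /= mulr1.
  have dc := @is_derive1_comp _ cos (fun z => 2 * pi * y * z) z _ _ _ dl.
  have ds := @is_derive1_comp _ sin (fun z => 2 * pi * y * z) z _ _ _ dl.
  by apply: is_derive_eq; rewrite /GRing.scale /=; ring.
have mc (c : R) : measurable_fun setT (fun y : R => cos (2 * pi * y * c)).
  apply: (measurableT_comp (continuous_measurable_fun (@continuous_cos R))).
  by apply: measurable_funM => //; apply: measurable_funM.
have ms (c : R) : measurable_fun setT (fun y : R => sin (2 * pi * y * c)).
  apply: (measurableT_comp (continuous_measurable_fun (@continuous_sin R))).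
  by apply: measurable_funM => //; apply: measurable_funM.
have cos1 (y : R) : `|cos y| <= 1 by rewrite ler_norml cos_geN1 cos_le1.
have sin1 (y : R) : `|sin y| <= 1 by rewrite ler_norml sin_geN1 sin_le1.
have If z : leb1.-integrable setT (EFin \o f z).
  have Ipq := integrableD measurableT (integrable_norm Ip) (integrable_norm Iq).
  apply: (le_integrable _ _ _ Ipq) => //.
    have /measurable_EFinP mp := measurable_int _ Ip.
    have /measurable_EFinP mq := measurable_int _ Iq.
    apply/measurable_EFinP; apply: measurable_funD; apply: measurable_funM.
    - exact: mp.
    - exact: mc.
    - exact: mq.
    - exact: ms.
  move=> y _; rewrite /= lee_fin [leRHS]ger0_norm ?addr_ge0//.
  rewrite (le_trans (ler_normD _ _))// !normrM lerD// ler_piMr//.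
pose G (y : R) := `|2 * pi * y * p y| + `|2 * pi * y * q y|.
have IG : leb1.-integrable setT (EFin \o G).
  exact: (integrableD measurableT (integrable_norm Ip') (integrable_norm Iq')).
have G0 y : 0 <= G y by rewrite addr_ge0.
have dE y z : partial1of2 f z y = 2 * pi * y * q y * cos (2 * pi * y * z) -
     2 * pi * y * p y * sin (2 * pi * y * z).
  by rewrite /partial1of2 derive1E; have [] := df y z.
have Gub z y : (`]x - 1, x + 1[%classic : set R) z -> setT y ->
    `|partial1of2 f z y| <= G y.
  move=> _ _; rewrite dE /G (le_trans (ler_normB _ _))// addrC.
  by apply: lerD; rewrite normrM ler_piMr.
have xI : (`]x - 1, x + 1[%classic : set R) x.
  by rewrite /= in_itv /= ltrBlDr ltrDl ltr01.
have derf z y : (`]x - 1, x + 1[%classic : set R) z -> setT y ->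
    derivable (f ^~ y) z 1.
  by move=> _ _; have [] := df y z.
have h1 := derivable_under_integral measurableT xI (fun z _ => If z) derf G0 IG Gub.
have h2 := differentiation_under_integral measurableT xI (fun z _ => If z) derf G0 IG Gub.
split; first exact: h1.
rewrite -derive1E h2; apply: eq_Rintegral => y _; exact: dE.
Qed.

Definition fwt (w : R -> C) n (y : R) : C := (0 -i* (2 * pi * y)) ^+ n * w y.

(** The n-th derivative of the Fourier transform of [w]: each derivative brings down a factor -2 pi
    i y, collected in [fwt]. *)
Definition fhat (w : R -> C) n (x : R) : C :=
  CInt leb1 (fun y => cis (- (2 * pi * y * x)) * fwt w n y).

Lemma fwtS w n y : fwt w n.+1 y = (0 -i* (2 * pi * y)) * fwt w n y.
Proof. by rewrite /fwt exprS mulrA. Qed.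

Variables (w : R -> C) (a b : R).
Hypotheses (cw : continuous w) (w0 : forall x, ~ (a < x < b) -> w x = 0).

Lemma continuous_fwt n : continuous (fwt w n).
Proof.
move=> y; elim: n => [|n IH].
  rewrite (_ : fwt w 0 = w); first exact: cw.
  by apply/funext => z; rewrite /fwt expr0 mul1r.
have h : (0 -i* (2 * pi * z)) @[z --> y] --> (0 -i* (2 * pi * y) : C).
  apply/cvgC_ReIm; split => /=; first exact: cvg_cst.
  by apply: cvgN; apply: cvgM; [exact: cvg_cst|exact: cvg_id].
rewrite (_ : fwt w n.+1 = fun z => (0 -i* (2 * pi * z)) * fwt w n z).
  exact: (cvgCM h IH).
by apply/funext => z; rewrite fwtS.
Qed.

Lemma CI_fwt n : CI leb1 (fwt w n).
Proof.
apply: (@CI_cs _ a b); first exact: continuous_fwt.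
by move=> x /w0; rewrite /fwt => ->; rewrite mulr0.
Qed.

Lemma CI_fhat n x : CI leb1 (fun y => cis (- (2 * pi * y * x)) * fwt w n y).
Proof.
have I := CI_fwt n; apply: (CI_le _ I) => [|y].
  apply: cmeasM; last exact: CI_meas I.
  apply: cmeas_cis; apply: measurable_funN.
  by apply: measurable_funM => //; apply: measurable_funM.
by rewrite Normc.normcM normc_cis mul1r.
Qed.

Lemma dseq_fhat : dseq (fhat w).
Proof.
move=> n x.
have [Ip Iq] := CI_fwt n; have [Ip' Iq'] := CI_fwt n.+1.
have e1 y : Re (fwt w n.+1 y) = 2 * pi * y * Im (fwt w n y).
  by rewrite fwtS ReM /= mul0r sub0r mulNr opprK.
have e2 y : Im (fwt w n.+1 y) = - (2 * pi * y * Re (fwt w n y)).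
  by rewrite fwtS ImM /= mul0r add0r mulNr.
have Iq2 : leb1.-integrable setT (fun y => (2 * pi * y * Im (fwt w n y))%:E).
  by under eq_fun do rewrite -e1.
have Ip2 : leb1.-integrable setT (fun y => (2 * pi * y * Re (fwt w n y))%:E).
  have -> : (fun y => (2 * pi * y * Re (fwt w n y))%:E) =
      (fun y => - (Im (fwt w n.+1 y))%:E)%E.
    by apply/funext => y; rewrite e2 -EFinN opprK.
  exact: integrableN.
have IN (h : R -> R) : leb1.-integrable setT (fun y => (h y)%:E) ->
    leb1.-integrable setT (fun y => (- h y)%:E).
  by move=> ih; under eq_fun do rewrite EFinN; exact: integrableN.
have reE m z : Re (fhat w m z) = \int[leb1]_y (Re (fwt w m y) *
    cos (2 * pi * y * z) + Im (fwt w m y) * sin (2 * pi * y * z)).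
  apply: eq_Rintegral => y _; rewrite ReM /= cosN sinN; ring.
have imE m z : Im (fhat w m z) = \int[leb1]_y (Im (fwt w m y) *
    cos (2 * pi * y * z) + - Re (fwt w m y) * sin (2 * pi * y * z)).
  apply: eq_Rintegral => y _; rewrite ImM /= cosN sinN; ring.
split.
  rewrite (funext (reE n)).
  have h := is_derive_cos_sin_integral x Ip Iq Ip2 Iq2.
  apply: is_derive_eq; rewrite reE; apply: eq_Rintegral => y _.
  by rewrite e1 e2; ring.
rewrite (funext (imE n)).
have Ip3 : leb1.-integrable setT (fun y => (2 * pi * y * - Re (fwt w n y))%:E).
  by under eq_fun do rewrite mulrN; exact: IN.
have h := is_derive_cos_sin_integral x Iq (IN _ Ip) Iq2 Ip3.
apply: is_derive_eq; rewrite imE; apply: eq_Rintegral => y _.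
by rewrite e1 e2; ring.
Qed.

End OneVariableFourier.

Section Bump.
Variable R : realType.
Local Notation C := R[i].

(** The derivatives of eta(k (x - a)) eta(k (b - x)), a bump supported in [a, b]. The steepness [k]
    is 1 for fixed cut-offs and tends to infinity to approximate the indicator of ]a, b[. *)
Definition bumpseq (a b k : R) : nat -> R -> C :=
  mulseq (fun n x => (k ^+ n)%:C * (eta n (k * x + - (k * a)))%:C)
         (fun n x => ((- k) ^+ n)%:C * (eta n (- k * x + k * b))%:C).

Lemma dseq_bump a b k : dseq (bumpseq a b k).
Proof.
apply: dseqM.
  exact: (dseq_affine (F := fun n t => (eta n t)%:C) k _ (@dseq_eta R)).
exact: (dseq_affine (F := fun n t => (eta n t)%:C) (- k) _ (@dseq_eta R)).
Qed.

Lemma bumpseq_out a b k n x : 0 < k -> ~ (a < x < b) -> bumpseq a b k n x = 0.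
Proof.
move=> k0 nx; rewrite /bumpseq /mulseq big1// => j _.
have etaN m t : t <= 0 -> eta m t = 0 by rewrite /eta leNgt => /negbTE ->.
have [xa|ax] := leP x a.
  by rewrite etaN ?mulr0 ?mul0r ?mulr0// -mulrBr mulr_ge0_le0 ?(ltW k0) ?subr_le0.
have bx : b <= x by rewrite leNgt; apply/negP => xb; apply: nx; rewrite ax.
rewrite [X in _ * (_ * (_ * X%:C))]etaN ?mulr0// mulNr addrC -mulrBr.
by rewrite mulr_ge0_le0 ?(ltW k0) ?subr_le0.
Qed.

Definition bump (a b k x : R) : R := eta 0 (k * (x - a)) * eta 0 (k * (b - x)).

Lemma bumpseq0 a b k x : bumpseq a b k 0 x = (bump a b k x)%:C.
Proof.
rewrite /bumpseq /mulseq big_ord1 bin0 mul1r !expr0 !mul1r -rmorphM /bump.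
by congr ((eta 0 _ * eta 0 _)%:C); ring.
Qed.

Lemma eta0E (t : R) : 0 < t -> eta 0 t = expR (- t^-1).
Proof. by move=> t0; rewrite /eta t0 hornerC mul1r. Qed.

Lemma eta0_01 (t : R) : 0 <= eta 0 t <= 1.
Proof.
have [t0|t0] := ltP 0 t.
  rewrite eta0E// expR_ge0 /= -expR0 ler_expR oppr_le0 invr_ge0 ltW//.
by rewrite /eta ifF ?lexx ?ler01// ltNge t0.
Qed.

Lemma bump01 a b k x : 0 <= bump a b k x <= 1.
Proof.
have /andP[h1 h2] := eta0_01 (k * (x - a)).
have /andP[h3 h4] := eta0_01 (k * (b - x)).
by rewrite /bump mulr_ge0//= mulr_ile1.
Qed.

Lemma bump_gt0 a b x : a < x < b -> 0 < bump a b 1 x.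
Proof.
move=> /andP[ax xb]; rewrite /bump !mul1r mulr_gt0// eta0E ?subr_gt0//;
  exact: expR_gt0.
Qed.

Lemma bump_cvg a b x : bump a b n.+1%:R x @[n --> \oo] --> inb a b x.
Proof.
have h (t : R) : 0 < t -> eta 0 (n.+1%:R * t) @[n --> \oo] --> (1 : R).
  move=> t0.
  have -> : (fun n => eta 0 (n.+1%:R * t)) =
      (fun n => expR (- (t^-1 * n.+1%:R^-1))).
    apply/funext => n; rewrite eta0E ?mulr_gt0//.
    by rewrite invfM mulrC.
  rewrite -[X in _ --> X](@expR0 R); apply: continuous_cvg.
    exact: continuous_expR.
  rewrite -[X in _ --> X]oppr0; apply: cvgN.
  rewrite -[X in _ --> X](mulr0 t^-1); apply: cvgM; first exact: cvg_cst.
  exact: cvg_harmonic.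
rewrite /inb; have [/andP[ax xb]|nx] := boolP (a < x < b).
  rewrite -[X in _ --> X](mulr1 (1 : R)).
  by apply: cvgM; apply: h; rewrite subr_gt0.
have e n : bump a b n.+1%:R x = 0.
  have := @bumpseq_out a b n.+1%:R 0 x (ltr0Sn _ _); rewrite bumpseq0.
  by move=> /(_ (fun h => negP nx h)) /(congr1 (@complex.Re R)).
under eq_fun do rewrite e; exact: cvg_cst.
Qed.

End Bump.

(** * Tensor products *)

Section Tensor.
Variables (R : realType) (d : nat).
Local Notation C := R[i].
Local Notation E := 'rV[R]_d.
Local Notation RT := (measurableTypeR R).
Implicit Types (F : 'I_d -> nat -> R -> C) (a : 'I_d -> nat) (x : E).

(** [a] records the order of derivation in each variable, so a partial derivative only raises one
    entry of [a]. *)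
Definition tens F a x : C := \prod_i F i (a i) (x 0 i).

Lemma is_derive_line (f : E -> R) (x v : E) (g : R -> R) (y df : R) :
  (forall h, f (h *: v + x) = g (h + y)) ->
  is_derive y (1 : R) g df -> is_derive x v f df.
Proof.
move=> fg /is_derive_cvgP dg.
have fx : f x = g y by have := fg 0; rewrite scale0r !add0r.
have e : (fun h : R => h^-1 *: ((f \o shift x) (h *: v) - f x)) =
    (fun h => h^-1 * (g (h + y) - g y)).
  by apply/funext => h /=; rewrite fg fx.
by split; [rewrite /derivable e; apply/cvg_ex; exists df|
  rewrite /derive e; apply: cvg_lim].
Qed.

Definition incr a (i : 'I_d) : 'I_d -> nat := fun j => (a j + (i == j))%N.

Lemma tens_line F a x i h :
  tens F a (h *: basis_vec R i + x) =
  (\prod_(j | j != i) F j (a j) (x 0 j)) * F i (a i) (h + x 0 i).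
Proof.
rewrite /tens (bigD1 i)//= mulrC !mxE !eqxx mulr1; congr (_ * _).
by apply: eq_bigr => j ji; rewrite !mxE eqxx /= (negbTE ji) mulr0 add0r.
Qed.

Lemma is_derive_tens F a x i : (forall j, dseq (F j)) ->
  is_derive x (basis_vec R i) (fun y => Re (tens F a y)) (Re (tens F (incr a i) x)) /\
  is_derive x (basis_vec R i) (fun y => Im (tens F a y)) (Im (tens F (incr a i) x)).
Proof.
move=> dF; set c := \prod_(j | j != i) F j (a j) (x 0 j).
have eT : tens F (incr a i) x = c * F i (a i).+1 (x 0 i).
  rewrite /tens (bigD1 i)//= mulrC /incr eqxx addn1; congr (_ * _).
  by apply: eq_bigr => j ji; rewrite eq_sym (negbTE ji) addn0.
have [d1 d2] := dF i (a i) (x 0 i).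
split.
  apply: (is_derive_line (g := fun y => Re c * Re (F i (a i) y) -
      Im c * Im (F i (a i) y)) (y := x 0 i)) => [h|].
    by rewrite tens_line ReM.
  by apply: is_derive_eq; rewrite eT ReM.
apply: (is_derive_line (g := fun y => Re c * Im (F i (a i) y) +
    Im c * Re (F i (a i) y)) (y := x 0 i)) => [h|].
  by rewrite tens_line ImM.
by apply: is_derive_eq; rewrite eT ImM.
Qed.

Lemma partials_tens F a s : (forall j, dseq (F j)) ->
  partials s (tens F a) = tens F (fun j => (a j + count_mem j s)%N).
Proof.
move=> dF; elim: s => [|i s IH] /=.
  by congr tens; apply/funext => j; rewrite addn0.
rewrite /partials /= -/(partials s _) IH; apply/funext => x.
have [[_ e1] [_ e2]] := is_derive_tens (fun j => (a j + count_mem j s)%N) x i dF.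
rewrite /partial e1 e2.
have -> : (fun j => (a j + ((i == j) + count_mem j s))%N) =
    incr (fun j => (a j + count_mem j s)%N) i.
  by apply/funext => j; rewrite /incr addnCA addnC.
by case: (tens _ _ x).
Qed.

Lemma continuous_tens F a : (forall j, dseq (F j)) -> continuous (tens F a).
Proof.
move=> dF x.
have hj j : F j (a j) ((y : E) 0 j) @[y --> x] --> F j (a j) (x 0 j).
  have cc : {for x, continuous (fun y : E => y 0 j)} by exact: coord_continuous.
  have cj : {for x 0 j, continuous (F j (a j))} by exact: dseq_continuous.
  exact: (continuous_comp cc cj).
exact: (cvgC_prod (P := xpredT) (fun j _ => hj j)).
Qed.

Lemma smooth_tens F a : (forall j, dseq (F j)) -> smooth (tens F a).
Proof.
move=> dF s; rewrite partials_tens//; split; first exact: continuous_tens.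
move=> i x.
by have [[h1 _] [h2 _]] := is_derive_tens (fun j => (a j + count_mem j s)%N) x i dF.
Qed.

Lemma mpartial_tens m (al : mindex d m) F : (forall j, dseq (F j)) ->
  mpartial al (tens F (fun=> 0%N)) = tens F (fun j => al j : nat).
Proof.
move=> dF; rewrite /mpartial partials_tens//; congr tens; apply/funext => j.
rewrite add0n count_flatten -map_comp sumnE big_map.
have e i : (count_mem j \o (fun i => nseq (al i) i)) i =
    (if i == j then al i : nat else 0)%N.
  by rewrite /= count_nseq /=; case: eqVneq => _; rewrite ?mul1n ?mul0n.
under eq_bigr do rewrite e.
by rewrite -big_mkcond /= big_enum_cond big_pred1_eq.
Qed.

Definition cbox (p q : 'I_d -> R) : set E :=
  [set x | forall i, p i <= x 0 i <= q i].

Lemma compact_cbox (p q : 'I_d -> R) : compact (cbox p q).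
Proof.
have := @rV_compact R d (fun i => `[p i, q i]%classic)
  (fun i => @segment_compact _ _ _).
congr compact; apply/seteqP; split => x h i; have := h i;
  by rewrite /= in_itv.
Qed.

Lemma tens_out F a (p q : 'I_d -> R) :
  (forall i n y, ~ (p i < y < q i) -> F i n y = 0) ->
  forall x, ~ (forall i, p i < x 0 i < q i) -> tens F a x = 0.
Proof.
move=> F0 x /existsNP[i hi]; rewrite /tens (bigD1 i)//= F0 ?mul0r//.
Qed.

Lemma tens_cbox F a (p q : 'I_d -> R) :
  (forall i n y, ~ (p i < y < q i) -> F i n y = 0) ->
  forall x, ~ cbox p q x -> tens F a x = 0.
Proof.
move=> F0 x nx; apply: (tens_out _ F0) => h; apply: nx => i.
by have /andP[h1 h2] := h i; rewrite !ltW.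
Qed.

Lemma Cc_tens Omega F a (p q : 'I_d -> R) : (forall j, dseq (F j)) ->
  (forall i n y, ~ (p i < y < q i) -> F i n y = 0) ->
  cbox p q `<=` Omega -> Cc Omega (tens F a).
Proof.
move=> dF F0 pq; split; first exact: continuous_tens.
by exists (cbox p q); split => //; [exact: compact_cbox|exact: tens_cbox].
Qed.

Lemma test_tens Omega F a (p q : 'I_d -> R) : (forall j, dseq (F j)) ->
  (forall i n y, ~ (p i < y < q i) -> F i n y = 0) ->
  cbox p q `<=` Omega -> test Omega (tens F a).
Proof.
move=> dF F0 pq; split; first exact: smooth_tens.
by exists (cbox p q); split => //; [exact: compact_cbox|exact: tens_cbox].
Qed.

Lemma continuous_enorm : continuous (@enorm R d).
Proof.
move=> x; have c1 : {for x, continuous (@id E)} by exact: cvg_id.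
have c2 : dotp y y @[y --> x] --> dotp x x by exact: (cvg_dotp c1 c1).
exact: (cvg_comp _ _ c2 (@sqrt_continuous R _)).
Qed.

Lemma schwartz_tens F a (p q : 'I_d -> R) : (forall j, dseq (F j)) ->
  (forall i n y, ~ (p i < y < q i) -> F i n y = 0) -> schwartz (tens F a).
Proof.
move=> dF F0; split; first exact: smooth_tens.
move=> s N; rewrite partials_tens//.
pose b j := (a j + count_mem j s)%N.
have ct : continuous (fun x : E => (enorm x ^+ N)%:C * tens F b x).
  move=> x; have cp : (enorm y ^+ N) @[y --> x] --> (enorm x ^+ N).
    exact: (cvg_comp _ _ (@continuous_enorm x) (@exprn_continuous R N _)).
  have cb : tens F b y @[y --> x] --> tens F b x by exact: continuous_tens.
  have cq : (enorm y ^+ N)%:C @[y --> x] --> (enorm x ^+ N)%:C by exact: (cvgCR cp).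
  exact: (cvgCM cq cb).
have [M M0 hM] := compact_bound_normc (@compact_cbox p q) ct.
exists M => x; have [Kx|nKx] := pselect (cbox p q x).
  have := hM x Kx; rewrite Normc.normcM normcC ger0_norm//.
  by rewrite exprn_ge0// sqrtr_ge0.
by rewrite (tens_cbox _ F0 nKx) Normc.normc0 mulr0.
Qed.

(** In several variables: multiplication by the monomial (-2 pi i y)^be before the transform is the
    derivative of order [be] after it. *)
Lemma FT_tens (w : 'I_d -> R -> C) (p q : 'I_d -> R) (be : 'I_d -> nat) :
  (forall i, continuous (w i)) ->
  (forall i y, ~ (p i < y < q i) -> w i y = 0) ->
  CI (leb R d) (fun t => \prod_i fwt (w i) (be i) (tnth t i)) /\
  FT (fun t : d.-tuple RT => \prod_i fwt (w i) (be i) (tnth t i)) =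
    (fun s => tens (fun i => fhat (w i)) be (vec s)).
Proof.
move=> cw w0.
have CIw i := @CI_fwt R (w i) (p i) (q i) (cw i) (w0 i) (be i).
split; first exact: (CI_tensor CIw).1.
apply/funext => s.
have [_ e] := CI_tensor (fun i =>
  @CI_fhat R (w i) (p i) (q i) (cw i) (w0 i) (be i) (tnth s i)).
rewrite /tens; under [RHS]eq_bigr do rewrite vecE.
rewrite -[RHS]e; apply: eq_CInt => t.
rewrite /dott mulr_sumr -sumrN cis_sum -big_split; apply: eq_bigr => i _ /=.
by congr (cis _ * _); ring.
Qed.

Lemma fwt0 (w : R -> C) y : fwt w 0 y = w y.
Proof. by rewrite /fwt expr0 mul1r. Qed.

End Tensor.

(** * The equation in Fourier variables *)

Lemma cvgR_prod (R : realType) {T} {F : set_system T} {FF : Filter F} I (s : seq I)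
    (h : I -> T -> R) (a : I -> R) :
  (forall i, h i @ F --> a i) ->
  \prod_(i <- s) h i t @[t --> F] --> \prod_(i <- s) a i.
Proof.
move=> hi; elim: s => [|i s IH].
  rewrite big_nil (_ : (fun t => _) = cst 1); first exact: cvg_cst.
  by apply/funext => t; rewrite big_nil.
rewrite big_cons (_ : (fun t => _) = fun t => h i t * \prod_(j <- s) h j t).
  by apply: cvgM; [exact: hi|exact: IH].
by apply/funext => t; rewrite big_cons.
Qed.

Section WeakIdentity.
Variables (R : realType) (d m l q r : nat).
Local Notation C := R[i].
Local Notation E := 'rV[R]_d.
Local Notation RT := (measurableTypeR R).
Local Notation leb := (leb R d).

Variables (Omega : set E) (Omega_open : open Omega).
Variables (u : nat -> E -> 'cV[C]_r) (u0 : weakly_to0 Omega u).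
Variable A : mindex d m -> E -> 'M[C]_(q, r).
Hypothesis A_continuous : forall a : mindex d m, (l <= mlen a <= m)%N ->
  {within Omega, continuous (A a)}.
Variables (N : nat) (e : R) (f : 'I_q -> (E -> C) -> C).
Hypothesis u_solves : solves Omega l e A (u N) f.
Variables (lo hi : 'I_d -> R).
Hypothesis lohi : cbox lo hi `<=` Omega.
Variable i : 'I_q.

Definition boxseq (j : 'I_d) : nat -> R -> C := bumpseq (lo j) (hi j) 1.
Definition boxtest : E -> C := tens boxseq (fun=> 0%N).

Lemma dseq_boxseq j : dseq (boxseq j). Proof. exact: dseq_bump. Qed.

Lemma boxseq_out j n y : ~ (lo j < y < hi j) -> boxseq j n y = 0.
Proof. by apply: bumpseq_out; exact: ltr01. Qed.

(** Only the bump is differentiated, [be] times; it also cuts the coefficient off, so that the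
    product is continuous on the whole space. *)
Definition theta (al be : mindex d m) (k : 'I_r) (x : E) : C :=
  A al x i k * tens boxseq (fun j => be j : nat) x.

Lemma Cc_theta al be k : (l <= mlen al <= m)%N -> Cc Omega (theta al be k).
Proof.
move=> hal; apply: (CcM_within Omega_open).
  move=> x; have := A_continuous hal (x := x) => h.
  have ce : {for A al x, continuous (fun M : 'M[C]_(q, r) => M i k)}.
    exact: coord_continuous.
  exact: (cvg_comp _ _ h ce).
by apply: (Cc_tens _ dseq_boxseq boxseq_out).
Qed.

Definition leibniz (al be : mindex d m) : C := \prod_j 'C(al j, be j)%:R.

Definition fmono (ga : 'I_d -> nat) (t : d.-tuple RT) : C :=
  \prod_j (0 -i* (2 * pi * tnth t j)) ^+ ga j.

Definition lead (al : mindex d m) : C := (e ^+ (mlen al - l))%:C * (-1) ^+ mlen al.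

(** Component [i] of the double sum of the overview. Here [be] ranges over all multi-indices: if
    some entry of [be] exceeds that of [al], the binomial coefficient vanishes, so the truncated
    subtraction in the exponent is harmless. *)
Definition symbH (t : d.-tuple RT) : C :=
  \sum_(al : mindex d m | (l <= mlen al <= m)%N) \sum_(be : mindex d m) \sum_k
    lead al * leibniz al be * fmono (fun j => (al j - be j)%N) t *
    FT (loc u (theta al be k) k N) t.

Section TestFunction.
Variables (W : 'I_d -> nat -> R -> C) (a b : 'I_d -> R).
Hypotheses (dW : forall j, dseq (W j))
  (W0 : forall j n y, ~ (a j < y < b j) -> W j n y = 0).

Let G : E -> C := tens W (fun=> 0%N).
Let w j := W j 0%N.
Let wcont j : continuous (w j). Proof. exact: dseq_continuous. Qed.
Let wout j y : ~ (a j < y < b j) -> w j y = 0. Proof. exact: W0. Qed.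

Let fG : fourier G = tens (fun j => fhat (w j)) (fun=> 0%N).
Proof.
apply/funext => x; rewrite -(vec_mktuple x) fourier_vec.
have [_ h] := FT_tens (fun=> 0%N) wcont wout.
rewrite -[RHS](congr1 (fun k => k _) h); congr (FT _ _); apply/funext => t.
by apply: eq_bigr => j _; rewrite fwt0 vecE.
Qed.

Let prodseq j := mulseq (boxseq j) (fhat (w j)).

Let dprod j : dseq (prodseq j).
Proof.
apply: dseqM; first exact: dseq_boxseq.
exact: (@dseq_fhat R (w j) (a j) (b j) (@wcont j) (@wout j)).
Qed.

Let prodseq_out j n y : ~ (lo j < y < hi j) -> prodseq j n y = 0.
Proof.
move=> h; rewrite /prodseq /mulseq big1// => k _.
by rewrite boxseq_out// mul0r mulr0.
Qed.

Let prod0 : (fun x => boxtest x * fourier G x) = tens prodseq (fun=> 0%N).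
Proof.
apply/funext => x; rewrite fG /boxtest /tens -big_split /=.
by apply: eq_bigr => j _; rewrite /prodseq /mulseq big_ord1 bin0 mul1r.
Qed.

(** The product of the one-variable Leibniz formulas, expanded by distributivity. Each inner sum is
    first extended to all orders up to m, the added binomials being 0, so that the choices of one
    term per variable are exactly the multi-indices. *)
Let tens_prodseq (al : mindex d m) x : tens prodseq (fun j => al j : nat) x =
  \sum_(be : mindex d m) leibniz al be * (tens boxseq (fun j => be j : nat) x *
    tens (fun j => fhat (w j)) (fun j => (al j - be j)%N) x).
Proof.
pose F j (k : nat) := 'C(al j, k)%:R *
  (boxseq j k (x 0 j) * fhat (w j) (al j - k)%N (x 0 j)).
have -> : tens prodseq (fun j => al j : nat) x = \prod_j \sum_(k < m.+1) F j k.
  apply: eq_bigr => j _; rewrite /prodseq /mulseq.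
  rewrite (big_ord_widen_cond m.+1 xpredT (F j)); last exact: ltn_ord.
  rewrite big_mkcond; apply: eq_bigr => k _; rewrite /= /F.
  by case: ltnP => // h; rewrite bin_small// mul0r.
rewrite bigA_distr_bigA; apply: eq_bigr => be _.
by rewrite /F !big_split.
Qed.

Let fwt_fmono (ga : 'I_d -> nat) (t : d.-tuple RT) :
  \prod_j fwt (w j) (ga j) (tnth t j) = fmono ga t * G (vec t).
Proof.
rewrite /G /tens /fmono -big_split; apply: eq_bigr => j _.
by rewrite /= vecE.
Qed.

(** After Leibniz, each term integrates theta u against a derivative of F(G). That derivative is the
    transform of a monomial times G, so [FT_dual] moves the transform onto theta u. *)
Let lead_term (al : mindex d m) : (l <= mlen al <= m)%N ->
  CI leb (fun t => \sum_(be : mindex d m) \sum_k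
     lead al * leibniz al be * (FT (loc u (theta al be k) k N) t *
     (fmono (fun j => (al j - be j)%N) t * G (vec t)))) /\
  lead al * cint (fun x => (A al x *m u N x) i 0 * mpartial al
    (fun x => boxtest x * fourier G x) x) =
  CInt leb (fun t => \sum_(be : mindex d m) \sum_k
     lead al * leibniz al be * (FT (loc u (theta al be k) k N) t *
     (fmono (fun j => (al j - be j)%N) t * G (vec t)))).
Proof.
move=> hal.
have hft (be : mindex d m) := FT_tens (fun j => (al j - be j)%N) wcont wout.
have Iloc be k : CI leb (loc u (theta al be k) k N).
  by have [] := loc_L2 Omega_open u0 k N (Cc_theta be k hal).
have eF be : (fun t : d.-tuple RT => \prod_j fwt (w j) (al j - be j) (tnth t j)) =
    (fun t => fmono (fun j => (al j - be j)%N) t * G (vec t)).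
  by apply/funext => t; exact: fwt_fmono.
have dual be k : [/\ CI leb (fun t => loc u (theta al be k) k N t *
      tens (fun j => fhat (w j)) (fun j => (al j - be j)%N) (vec t)),
    CI leb (fun t => FT (loc u (theta al be k) k N) t *
     (fmono (fun j => (al j - be j)%N) t * G (vec t))) &
    CInt leb (fun t => loc u (theta al be k) k N t *
      tens (fun j => fhat (w j)) (fun j => (al j - be j)%N) (vec t)) =
    CInt leb (fun t => FT (loc u (theta al be k) k N) t *
     (fmono (fun j => (al j - be j)%N) t * G (vec t)))].
  have [h1 h2] := hft be; rewrite eF in h1 h2.
  have [g1 g2 g3] := FT_dual (Iloc be k) h1.
  by rewrite h2 in g1 g3.
have I2 be k : CI leb (fun t => lead al * leibniz al be *
   (FT (loc u (theta al be k) k N) t *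
     (fmono (fun j => (al j - be j)%N) t * G (vec t)))).
  by apply: CI_Z; have [] := dual be k.
have I1 be k : CI leb (fun t => lead al * leibniz al be *
   (loc u (theta al be k) k N t *
      tens (fun j => fhat (w j)) (fun j => (al j - be j)%N) (vec t))).
  by apply: CI_Z; have [] := dual be k.
have I2' be : CI leb (fun t => \sum_k lead al * leibniz al be *
   (FT (loc u (theta al be k) k N) t *
     (fmono (fun j => (al j - be j)%N) t * G (vec t)))).
  by apply: CI_sum => k _; exact: I2.
have I1' be : CI leb (fun t => \sum_k lead al * leibniz al be *
   (loc u (theta al be k) k N t *
      tens (fun j => fhat (w j)) (fun j => (al j - be j)%N) (vec t))).
  by apply: CI_sum => k _; exact: I1.
split; first by apply: CI_sum => be _; exact: I2'.
rewrite CInt_sum; last by move=> be _; exact: I2'.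
have -> : \sum_(be : mindex d m) CInt leb (fun t => \sum_k
     lead al * leibniz al be * (FT (loc u (theta al be k) k N) t *
     (fmono (fun j => (al j - be j)%N) t * G (vec t)))) =
   \sum_(be : mindex d m) CInt leb (fun t => \sum_k lead al * leibniz al be *
   (loc u (theta al be k) k N t *
      tens (fun j => fhat (w j)) (fun j => (al j - be j)%N) (vec t))).
  apply: eq_bigr => be _; rewrite CInt_sum; last by move=> k _; exact: I2.
  rewrite CInt_sum; last by move=> k _; exact: I1.
  apply: eq_bigr => k _; have [d1 d2 d3] := dual be k.
  by rewrite !CInt_Z// d3.
rewrite -CInt_sum; last by move=> be _; exact: I1'.
rewrite prod0 mpartial_tens//.
pose Q t := \sum_(be : mindex d m) \sum_k leibniz al be *
   (loc u (theta al be k) k N t *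
      tens (fun j => fhat (w j)) (fun j => (al j - be j)%N) (vec t)).
have IQ : CI leb Q.
  apply: CI_sum => be _; apply: CI_sum => k _; apply: CI_Z.
  by have [] := dual be k.
transitivity (lead al * CInt leb Q).
  congr (_ * _); apply: eq_CInt => t; rewrite tens_prodseq mulr_sumr.
  apply: eq_bigr => be _; rewrite mxE mulr_suml; apply: eq_bigr => k _.
  by rewrite /loc /theta; ring.
rewrite -CInt_Z//; apply: eq_CInt => t; rewrite /Q mulr_sumr.
apply: eq_bigr => be _; rewrite mulr_sumr; apply: eq_bigr => k _.
by rewrite mulrA.
Qed.

(** Pairing [h] with G is, by definition of the transform of a distribution, applying phi f to F(G),
    that is f to phi F(G). This last function is an admissible test in the equation because the bump
    confines it to the box. *)
Lemma weak_identity (h : E -> C) : is_fourier (localize boxtest (f i)) h ->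
  [/\ CI leb (fun t => h (vec t) * G (vec t)),
      CI leb (fun t => symbH t * G (vec t)) &
      CInt leb (fun t => h (vec t) * G (vec t)) =
      CInt leb (fun t => symbH t * G (vec t))].
Proof.
move=> [_ hF]; have [I1 e1] := hF G (schwartz_tens _ dW W0).
have HG t : symbH t * G (vec t) =
    \sum_(al : mindex d m | (l <= mlen al <= m)%N) \sum_(be : mindex d m) \sum_k
     lead al * leibniz al be * (FT (loc u (theta al be k) k N) t *
     (fmono (fun j => (al j - be j)%N) t * G (vec t))).
  rewrite mulr_suml; apply: eq_bigr => al _.
  rewrite mulr_suml; apply: eq_bigr => be _.
  by rewrite mulr_suml; apply: eq_bigr => k _; ring.
have -> : (fun t => symbH t * G (vec t)) = _ := funext HG.
split; [exact: I1|by apply: CI_sum => al hal; have [] := lead_term hal|].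
rewrite CInt_sum; last by move=> al hal; have [] := lead_term hal.
transitivity (cint (fun xi => h xi * G xi)); first by [].
rewrite -e1 /localize -u_solves; last first.
  by rewrite prod0; exact: (test_tens _ dprod prodseq_out).
by apply: eq_bigr => al hal; have [_ <-] := lead_term hal.
Qed.

End TestFunction.

Lemma cmeas_symbH : cmeas symbH.
Proof.
apply: cmeas_sum => al hal; apply: cmeas_sum => be _; apply: cmeas_sum => k _.
apply: cmeasM; last by have [] := loc_L2 Omega_open u0 k N (Cc_theta be k hal).
apply: cmeasM; first exact: cmeas_cst.
apply: cmeas_prod => j _.
elim: (al j - be j)%N => [|n IH].
  by rewrite (_ : (fun t => _) = cst 1); [exact: cmeas_cst|exact/funext].
rewrite (_ : (fun t => _) = fun t : d.-tuple RT => (0 -i* (2 * pi * tnth t j)) *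
    (0 -i* (2 * pi * tnth t j)) ^+ n); last first.
  by apply/funext => t; rewrite exprS.
apply: cmeasM => //; split => /=; first exact: measurable_cst.
apply: measurable_funN; apply: measurable_funM => //.
exact: measurable_tnth.
Qed.

(** On each cube, the difference is multiplied by a bump [g0] that is positive inside, which makes
    it integrable. Its integrals against smooth approximations of indicators of boxes vanish by
    [weak_identity]; in the limit so do those over boxes, and [g0] can be divided out. *)
Lemma ae_symbH (h : E -> C) : is_fourier (localize boxtest (f i)) h ->
  {ae leb, forall t, h (vec t) = symbH t}.
Proof.
move=> hF.
pose D t := h (vec t) - symbH t.
have cube_ae (M : nat) : {ae leb, forall t, cube M%:R t -> D t = 0}.
  pose B (j : 'I_d) : nat -> R -> C := bumpseq (- M%:R) M%:R 1.
  pose g0 (t : d.-tuple RT) : R := \prod_j bump (- M%:R) M%:R 1 (tnth t j).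
  have tens_g0 t : tens B (fun=> 0%N) (vec t) = (g0 t)%:C.
    rewrite /tens /g0 rmorph_prod; apply: eq_bigr => j _.
    by rewrite /B bumpseq0 vecE.
  have B0 j n y : ~ (- M%:R < y < M%:R) -> B j n y = 0.
    by apply: bumpseq_out; exact: ltr01.
  have [J1 J2 J3] := weak_identity (fun=> @dseq_bump R _ _ _) B0 hF.
  have ID : CI leb (fun t => D t * (g0 t)%:C).
    have := CI_D J1 (CI_Z (-1) J2); congr (CI leb); apply/funext => t.
    by rewrite tens_g0 /D; ring.
  (* Re and Im of D * g0 are treated simultaneously through the linear form p. *)
  have part (p : C -> R) : (forall z (c : R), p (z * c%:C) = p z * c) ->
     leb.-integrable setT (fun t => (p (D t * (g0 t)%:C))%:E) ->
     (forall g : d.-tuple RT -> R, CI leb (fun t => D t * (g t)%:C) ->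
        CInt leb (fun t => D t * (g t)%:C) = 0 ->
        \int[leb]_t p (D t * (g t)%:C) = 0) ->
     ae_eq leb setT (fun t => (p (D t * (g0 t)%:C))%:E) (cst 0%E).
    move=> plin pint pz.
    apply: (@ae_eq0_oboxes _ _ _ (fun=> - M%:R) (fun=> M%:R)) => //.
      move=> t nt; suff -> : g0 t = 0 by rewrite plin mulr0.
      have [j hj] : exists j, ~ (- M%:R < tnth t j < M%:R) by apply/existsNP.
      have : (bump (- M%:R) M%:R 1 (tnth t j))%:C = 0 :> C.
        by rewrite -bumpseq0 bumpseq_out// ltr01.
      by move=> /(congr1 (@complex.Re R)) /= bj; rewrite /g0 (bigD1 j)//= bj mul0r.
    move=> a b.
    (* Smooth functions with values in [0, 1] tending pointwise to the indicator of the box; their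
       products with [g0] are again tensor products allowed in [weak_identity]. *)
    pose gk (k : nat) (t : d.-tuple RT) : R :=
      \prod_j bump (a j) (b j) k.+1%:R (tnth t j).
    have gk01 k t : 0 <= gk k t <= 1.
      rewrite /gk; elim/big_ind: _ => [|x y /andP[x0 x1] /andP[y0 y1]|j _].
      - by rewrite ler01 lexx.
      - by rewrite mulr_ge0//= mulr_ile1.
      - exact: bump01.
    have mgk k : measurable_fun setT (gk k).
      rewrite /gk; apply: measurable_prod => j _.
      have cb : continuous (bump (a j) (b j) k.+1%:R).
        move=> x; have /cvgC_ReIm[c0 _] := @dseq_continuous R _ 0
          (@dseq_bump R (a j) (b j) k.+1%:R) x.
        move: c0; rewrite bumpseq0 /=; apply: cvg_trans; apply: near_eq_cvg.
        by apply: nearW => y; rewrite bumpseq0.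
      apply: (measurableT_comp _ (measurable_tnth j)).
      exact: continuous_measurable_fun.
    have gk_cvg t : gk k t @[k --> \oo] --> (\1_(obox a b) t : R).
      have -> : (\1_(obox a b) t : R) = \prod_j inb (a j) (b j) (tnth t j).
        rewrite indicE; case: (boolP (t \in _)) => [|/negP]; rewrite ?inE => ht.
          by rewrite big1// => j _; rewrite /inb ht.
        have [j hj] : exists j, ~ (a j < tnth t j < b j) by apply/existsNP.
        by rewrite (bigD1 j)//= /inb (negbTE (introN idP hj)) mul0r.
      exact: (@cvgR_prod R nat \oo _ _ (index_enum 'I_d)
          (fun j k => bump (a j) (b j) k.+1%:R (tnth t j))
          (fun j => inb (a j) (b j) (tnth t j))
          (fun j => @bump_cvg R (a j) (b j) (tnth t j))).
    have zero k : \int[leb]_t (p (D t * (g0 t)%:C) * gk k t) = 0.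
      pose W j := mulseq (B j) (bumpseq (a j) (b j) k.+1%:R).
      have dW j : dseq (W j) by apply: dseqM; exact: dseq_bump.
      have W0 j n y : ~ (- M%:R < y < M%:R) -> W j n y = 0.
        move=> ny; rewrite /W /mulseq big1// => x _.
        by rewrite B0// mul0r mulr0.
      have [K1 K2 K3] := weak_identity dW W0 hF.
      have tens_W t : tens W (fun=> 0%N) (vec t) = (g0 t * gk k t)%:C.
        rewrite rmorphM /g0 /gk !rmorph_prod -big_split; apply: eq_bigr => j _.
        by rewrite /W /mulseq big_ord1 bin0 mul1r /B !bumpseq0 vecE.
      have De : (fun t => D t * (g0 t * gk k t)%:C) =
          (fun t => h (vec t) * tens W (fun=> 0%N) (vec t) +
            -1 * (symbH t * tens W (fun=> 0%N) (vec t))).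
        by apply/funext => t; rewrite tens_W /D; ring.
      rewrite -[RHS](pz (fun t => g0 t * gk k t)).
      - by apply: eq_Rintegral => t _; rewrite -plin rmorphM mulrA.
      - by rewrite De; apply: CI_D => //; exact: CI_Z.
      - by rewrite De CInt_D ?CInt_Z//; [rewrite K3; ring|exact: CI_Z].
    pose P t := p (D t * (g0 t)%:C).
    have mP : measurable_fun setT P by apply/measurable_EFinP; exact: measurable_int pint.
    have c1 k : measurable_fun setT (fun t => (P t * gk k t)%:E).
      by apply/measurable_EFinP; exact: measurable_funM.
    have c2 : measurable_fun setT (fun t => (P t * \1_(obox a b) t)%:E).
      apply/measurable_EFinP; apply: measurable_funM => //.
      by apply: measurable_indic; exact: measurable_obox.
    have c3 : {ae leb, forall t, setT t ->
        (P t * gk k t)%:E @[k --> \oo] --> (P t * \1_(obox a b) t)%:E}.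
      apply: aeW => t _; apply: cvg_EFin; first exact: nearW.
      by apply: cvgM; [exact: cvg_cst|exact: gk_cvg].
    have c4 : {ae leb, forall t k, setT t ->
        (`|(P t * gk k t)%:E| <= (`|P t|)%:E)%E}.
      apply: aeW => t k _; rewrite /= lee_fin normrM ler_piMr//.
      by have /andP[g1 g2] := gk01 k t; rewrite ger0_norm.
    have [c5 _] := dominated_convergence measurableT c1 c2 c3 (integrable_norm pint) c4.
    have -> : (fun k => \int[leb]_t (P t * gk k t)%:E)%E = cst 0%E.
      apply/funext => k; have c6 : leb.-integrable setT (fun t => (P t * gk k t)%:E).
        apply: (le_integrable _ (c1 k) _ (integrable_norm pint)) => // t _.
        rewrite /= lee_fin normrM normr_id ler_piMr//.
        by have /andP[g1 g2] := gk01 k t; rewrite ger0_norm.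
      have fin := integrable_fin_num measurableT c6.
      by rewrite -(fineK fin) -[fine _]/(\int[leb]_t (P t * gk k t)) zero.
    move=> c6; have c7 : 0%E = (\int[leb]_t (P t * \1_(obox a b) t)%:E)%E.
      exact: (cvg_unique _ (cvg_cst 0%E) c6).
    rewrite [RHS]c7.
    rewrite integral_mkcond; apply: eq_integral => t _.
    by rewrite patchE indicE; case: ifP => _; rewrite ?mulr1 ?mulr0.
  have aeRe := part (@complex.Re R) _ ID.1 _.
  have aeIm := part (@complex.Im R) _ ID.2 _.
  have lin1 z (c : R) : Re (z * c%:C) = Re z * c by rewrite ReM /= mulr0 subr0.
  have lin2 z (c : R) : Im (z * c%:C) = Im z * c by rewrite ImM /= mulr0 add0r.
  have z1 (g : d.-tuple RT -> R) : CI leb (fun t => D t * (g t)%:C) ->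
     CInt leb (fun t => D t * (g t)%:C) = 0 ->
     \int[leb]_t Re (D t * (g t)%:C) = 0 by move=> _ /(congr1 (@complex.Re R)).
  have z2 (g : d.-tuple RT -> R) : CI leb (fun t => D t * (g t)%:C) ->
     CInt leb (fun t => D t * (g t)%:C) = 0 ->
     \int[leb]_t Im (D t * (g t)%:C) = 0 by move=> _ /(congr1 (@complex.Im R)).
  apply: filterS2 (aeRe lin1 z1) (aeIm lin2 z2) => t /(_ I) h1 /(_ I) h2 ct.
  have g0t : 0 < g0 t by apply: prodr_gt0 => j _; exact: bump_gt0.
  have n0 : (g0 t)%:C != 0 :> C by rewrite eq_complex /= eqxx andbT gt_eqF.
  apply: (mulIf n0); rewrite mul0r; apply: complexP.
    by case: h1.
  by case: h2.
have := ae_foralln cube_ae; apply: filterS => t ht.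
have [M hM] := cube_tuple t.
by apply/eqP; rewrite -subr_eq0; apply/eqP; exact: ht hM.
Qed.

End WeakIdentity.

(** * Pointwise estimate of the symbol *)

Section PointwiseBound.
Variables (R : realType) (d m l : nat).
Local Notation C := R[i].
Local Notation E := 'rV[R]_d.
Local Notation RT := (measurableTypeR R).
Implicit Types (x : E) (t : d.-tuple RT) (al be : mindex d m) (e : R).

Lemma dotp_ge0 x : 0 <= dotp x x.
Proof. by apply: sumr_ge0 => j _; rewrite -expr2 sqr_ge0. Qed.

Lemma enorm_ge0 x : 0 <= enorm x. Proof. exact: sqrtr_ge0. Qed.

Lemma enorm_sqr x : enorm x ^+ 2 = dotp x x.
Proof. exact/sqr_sqrtr/dotp_ge0. Qed.

Lemma enormZ (c : R) x : 0 <= c -> enorm (c *: x) = c * enorm x.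
Proof.
move=> c0; have -> : dotp (c *: x) (c *: x) = c ^+ 2 * dotp x x -> 
  enorm (c *: x) = c * enorm x => //; last first.
  rewrite /dotp mulr_sumr; apply: eq_bigr => j _; rewrite !mxE.
  by rewrite expr2 mulrACA.
by move=> h; rewrite /enorm h sqrtrM ?sqr_ge0// sqrtr_sqr ger0_norm.
Qed.

Lemma coord_le_enorm x j : `|x 0 j| <= enorm x.
Proof.
rewrite -[leLHS]sqrtr_sqr ler_sqrt ?dotp_ge0//.
rewrite /dotp (bigD1 j)//= -expr2 lerDl.
by apply: sumr_ge0 => k _; rewrite -expr2 sqr_ge0.
Qed.

Lemma normr_prod_le (ga : 'I_d -> nat) x :
  `|\prod_j x 0 j ^+ ga j| <= enorm x ^+ (\sum_j ga j).
Proof.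
rewrite normr_prod expr_sum; apply: ler_prod => j _.
rewrite normr_ge0/= normrX; apply: lerXn2r; rewrite ?nnegrE ?enorm_ge0//.
exact: coord_le_enorm.
Qed.

Lemma monoZ al (c : R) x : mono al (c *: x) = c ^+ mlen al * mono al x.
Proof.
rewrite /mono /mlen expr_sum -big_split; apply: eq_bigr => j _.
by rewrite mxE exprMn.
Qed.

(** After factoring out s^l this is (c s)^(k-l) <= 1 + (c s)^(m-l): the term 1 dominates if c s <=
    1, the other one if c s > 1. It bounds the symbols, the terms of the weight and the lower-order
    terms alike. *)
Lemma pow_le_sum (s c : R) (k : nat) : 0 <= s -> 0 <= c -> (l <= k <= m)%N ->
  c ^+ (k - l) * s ^+ k <= s ^+ l + c ^+ (m - l) * s ^+ m.
Proof.
move=> s0 c0 /andP[lk km].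
have -> : c ^+ (k - l) * s ^+ k = s ^+ l * (c * s) ^+ (k - l).
  by rewrite exprMn mulrCA -exprD subnKC.
have -> : c ^+ (m - l) * s ^+ m = s ^+ l * (c * s) ^+ (m - l).
  by rewrite exprMn mulrCA -exprD subnKC// (leq_trans lk).
rewrite -{2}[s ^+ l]mulr1 -mulrDr; apply: ler_wpM2l; first exact: exprn_ge0.
have cs0 : 0 <= c * s by rewrite mulr_ge0.
have [cs1|cs1] := leP (c * s) 1.
  by rewrite (le_trans (exprn_ile1 _ cs0 cs1))// lerDl exprn_ge0.
rewrite (@le_trans _ _ ((c * s) ^+ (m - l)))//; last by rewrite lerDr.
by rewrite ler_eXn2l// leq_sub2r.
Qed.

Lemma normr_symb_le1 al x : (l <= mlen al <= m)%N -> `|symb l al x| <= 1.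
Proof.
move=> hal; rewrite /symb normrM normfV.
have D0 : 0 <= enorm x ^+ l + enorm x ^+ m by rewrite addr_ge0// exprn_ge0// enorm_ge0.
have h : `|mono al x| <= enorm x ^+ l + enorm x ^+ m.
  apply: (le_trans (normr_prod_le _ x)).
  have := pow_le_sum (enorm_ge0 x) ler01 hal.
  by rewrite !expr1n !mul1r.
rewrite (ger0_norm D0).
(* At the origin the denominator vanishes when l > 0, and the quotient is then 0 by convention. *)
have [D1|D1] := eqVneq (enorm x ^+ l + enorm x ^+ m) 0.
  by rewrite D1 invr0 mulr0 ler01.
by rewrite ler_pdivrMr ?mul1r// lt0r D1.
Qed.

(** The D of the overview. Multiplied by e^l it becomes (e s)^l + (e s)^m, the denominator of [symb]
    at the rescaled frequency. *)
Definition den e (s : R) : R := s ^+ l + e ^+ (m - l) * s ^+ m.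

Definition zidx : mindex d m := [ffun => ord0].

(** The part of the bounds on squared coefficients that depends neither on the scale nor on the
    frequency: the squared binomial and the powers of 2 pi brought by the monomial of order al -
    be. *)
Definition kcoef al be : R :=
  csq (leibniz R al be) * ((2 * pi) ^+ (\sum_j (al j - be j)%N)) ^+ 2.

Definition hcoef e al be t : C :=
  lead l e al * leibniz R al be * fmono (fun j => (al j - be j)%N) t.

(* The symbol of p_1, placed at be = 0 so that it can be compared with hcoef. *)
Definition pcoef e al be t : C := if be == zidx then
  (0 +i* (2 * pi)) ^+ mlen al * (symb l al (e *: vec t))%:C else 0.

Lemma csqR (a : R) : csq (a%:C : C) = a ^+ 2.
Proof. by rewrite /csq /= expr0n /= addr0. Qed.

Lemma csqX (z : C) n : csq (z ^+ n) = csq z ^+ n.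
Proof.
elim: n => [|n IH]; last by rewrite !exprS csqM IH.
by rewrite !expr0 -[1]/((1 : R)%:C) csqR expr1n.
Qed.

Lemma csq_prod I (s : seq I) (F : I -> C) :
  csq (\prod_(j <- s) F j) = \prod_(j <- s) csq (F j).
Proof.
elim: s => [|j s IH]; last by rewrite !big_cons csqM IH.
by rewrite !big_nil -[1]/((1 : R)%:C) csqR expr1n.
Qed.

Lemma kcoef_ge0 al be : 0 <= kcoef al be.
Proof. by rewrite mulr_ge0 ?csq_ge0 ?sqr_ge0. Qed.

Lemma csq_fmono_le (ga : 'I_d -> nat) t : csq (fmono ga t) <=
  ((2 * pi) ^+ (\sum_j ga j)) ^+ 2 * (enorm (vec t) ^+ (\sum_j ga j)) ^+ 2.
Proof.
rewrite /fmono csq_prod.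
have -> : \prod_j csq ((0 -i* (2 * pi * tnth t j) : C) ^+ ga j) =
    ((2 * pi) ^+ (\sum_j ga j)) ^+ 2 * (\prod_j vec t 0 j ^+ ga j) ^+ 2.
  rewrite expr_sum -!prodrXl -big_split; apply: eq_bigr => j _.
  rewrite csqX /csq /= expr0n /= add0r sqrrN vecE.
  by rewrite -[RHS]exprMn -[in RHS]exprMn exprAC.
apply: ler_wpM2l; first exact: sqr_ge0.
rewrite -[leLHS]real_normK ?num_real//; apply: lerXn2r; last exact: normr_prod_le.
  by rewrite nnegrE.
by rewrite nnegrE exprn_ge0// enorm_ge0.
Qed.

Lemma csq_lead e al : csq (lead l e al) = (e ^+ (mlen al - l)) ^+ 2.
Proof.
rewrite /lead csqM csqX csqR -[X in csq X](rmorphN1 (real_complex R)) csqR.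
by rewrite sqrrN expr1n expr1n mulr1.
Qed.

Lemma leibniz_zidx al : leibniz R al zidx = 1.
Proof. by rewrite /leibniz big1// => j _; rewrite ffunE bin0. Qed.

Lemma sum_zidx al : (\sum_j (al j - zidx j) = mlen al)%N.
Proof. by apply: eq_bigr => j _; rewrite ffunE subn0. Qed.

Lemma kcoef_zidx al : kcoef al zidx = ((2 * pi) ^+ mlen al) ^+ 2.
Proof. by rewrite /kcoef leibniz_zidx sum_zidx -[1]/((1 : R)%:C) csqR expr1n mul1r. Qed.

Lemma enorm_vec t : enorm (vec t) ^+ 2 = dott t t.
Proof. by rewrite enorm_sqr dotp_vec. Qed.

Lemma csq_2pi al : csq ((0 +i* (2 * pi) : C) ^+ mlen al) = ((2 * pi) ^+ mlen al) ^+ 2.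
Proof. by rewrite csqX /csq /= expr0n /= add0r -!exprM mulnC. Qed.

(** At low frequencies 2 [kap] is at least 1, so the plain bound |symb| <= 1 already has the
    decaying form required of an error term. *)
Lemma pcoef_le e al be t : (l <= mlen al <= m)%N -> enorm (vec t) < 1 ->
  csq (pcoef e al be t) <= kcoef al be * (2 * kap t).
Proof.
move=> hal t1; have /andP[k0 _] := kap01 t; rewrite /pcoef.
case: eqVneq => [->|_]; last first.
  by rewrite -[0]/((0 : R)%:C) csqR expr0n mulr_ge0 ?kcoef_ge0 ?mulr_ge0.
rewrite csqM csq_2pi kcoef_zidx csqR; apply: ler_wpM2l; first exact: sqr_ge0.
have h1 : symb l al (e *: vec t) ^+ 2 <= 1.
  rewrite -[leLHS]real_normK ?num_real// -[leRHS](expr1n _ 2).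
  by apply: lerXn2r; rewrite ?nnegrE ?normr_symb_le1.
have h2 : 1 <= 2 * kap t.
  rewrite /kap ler_pdivlMr; last by rewrite ltr_pwDl// -enorm_vec sqr_ge0.
  have : enorm (vec t) ^+ 2 <= 1 by rewrite exprn_ile1 ?enorm_ge0 ?ltW.
  by rewrite enorm_vec; lra.
exact: (le_trans h1 h2).
Qed.

Lemma den_ge e s : 0 <= e -> 1 <= s -> s ^+ l <= den e s.
Proof.
move=> e0 s1; rewrite /den lerDl mulr_ge0 ?exprn_ge0//.
exact: le_trans ler01 s1.
Qed.

Lemma den_ge1 e s : 0 <= e -> 1 <= s -> 1 <= den e s.
Proof. by move=> e0 s1; rewrite (le_trans _ (den_ge e0 s1))// exprn_ege1. Qed.

Lemma fmonoE al t : fmono (fun j => al j : nat) t =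
  (0 -i* (2 * pi)) ^+ mlen al * (mono al (vec t))%:C.
Proof.
rewrite /fmono /mono /mlen rmorph_prod expr_sum -big_split; apply: eq_bigr => j _.
rewrite rmorphXn /= -exprMn vecE; congr (_ ^+ _).
by apply: complexP; rewrite ?ReM ?ImM /=; ring.
Qed.

(** The sign (-1)^|al| of the weak formulation cancels the one in (-2 pi i)^|al|, and e^(|al|-l) is
    what remains of e^|al| after dividing by the factor e^l between the two denominators. *)
Lemma hcoef_zidx e al t : (l <= mlen al <= m)%N -> 0 < e -> 1 <= enorm (vec t) ->
  hcoef e al zidx t / (den e (enorm (vec t)))%:C = pcoef e al zidx t.
Proof.
move=> /andP[lk km] e0 t1; rewrite /hcoef /pcoef eqxx leibniz_zidx mulr1.
have -> : fmono (fun j => (al j - zidx j)%N) t = fmono (fun j => al j : nat) t.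
  by congr (fmono _ t); apply/funext => j; rewrite ffunE subn0.
rewrite fmonoE /lead /symb monoZ (enormZ _ (ltW e0)).
set s := enorm _ in t1 *; have s0 : 0 < s by exact: lt_le_trans ltr01 t1.
have D0 : den e s != 0 by rewrite gt_eqF// (lt_le_trans ltr01)// den_ge1// ltW.
have el0 : e ^+ l != 0 by rewrite gt_eqF// exprn_gt0.
have -> : (e * s) ^+ l + (e * s) ^+ m = e ^+ l * den e s.
  rewrite /den !exprMn mulrDr; congr (_ + _).
  by rewrite mulrA -exprD subnKC// (leq_trans lk).
have -> : e ^+ mlen al * mono al (vec t) / (e ^+ l * den e s) =
    e ^+ (mlen al - l) * (mono al (vec t) / den e s).
  by rewrite -{1}(subnKC lk) exprD; field; rewrite el0 D0.
have -> : (0 -i* (2 * pi) : C) = - (0 +i* (2 * pi)).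
  by apply: complexP => //=; rewrite oppr0.
rewrite (exprNn (0 +i* (2 * pi))) !rmorphM fmorphV /=.
have sg : (-1 : C) ^+ mlen al * (-1) ^+ mlen al = 1 by rewrite -expr2 sqrr_sign.
transitivity (((-1) ^+ mlen al * (-1) ^+ mlen al) * ((0 +i* (2 * pi)) ^+ mlen al *
  ((e ^+ (mlen al - l))%:C * ((mono al (vec t))%:C * ((den e s)%:C)^-1))) : C).
  by ring.
by rewrite sg mul1r.
Qed.

(** If [be] is not below [al] the binomial is 0. Otherwise |al - be| < |al|, so the quotient by D is
    at most 1/s up to constants, and 1/s^2 <= 2 / (1 + s^2) because s >= 1. *)
Lemma hcoef_le e al be t : (l <= mlen al <= m)%N -> 0 < e -> be != zidx ->
  1 <= enorm (vec t) ->
  csq (hcoef e al be t / (den e (enorm (vec t)))%:C) <= kcoef al be * (2 * kap t).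
Proof.
move=> hal e0 be0 t1; have /andP[k0 _] := kap01 t.
have [/forallP bal|/forallPn[j]] := boolP [forall j, be j <= al j]%N; last first.
  rewrite -ltnNge => hj; rewrite /hcoef /leibniz (bigD1 j)//= bin_small//.
  rewrite mulr0n mul0r mulr0 !mul0r -[0]/((0 : R)%:C) csqR expr0n.
  by rewrite mulr_ge0 ?kcoef_ge0 ?mulr_ge0.
set s := enorm _ in t1 *; have s0 : 0 < s by exact: lt_le_trans ltr01 t1.
set n := (\sum_j (al j - be j))%N.
have nk : (n < mlen al)%N.
  have [j hj] : exists j, be j != ord0.
    apply/existsP; apply: contraNT be0 => /existsPn h.
    by apply/eqP/ffunP => j; rewrite ffunE; apply/eqP; have := h j; rewrite negbK.
  rewrite /n /mlen (bigD1 j)//= [ltnRHS](bigD1 j)//= -addSn leq_add//.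
    by rewrite ltn_subrL lt0n hj (leq_trans _ (bal j))// lt0n.
  by apply: leq_sum => k _; exact: leq_subr.
have D1 := den_ge1 (ltW e0) t1; have D0 : 0 < den e s by exact: lt_le_trans ltr01 D1.
rewrite /hcoef (csqM _ (_^-1)) (csqM _ (fmono _ _)) (csqM (lead _ _ _)) csq_lead.
rewrite -fmorphV csqR.
set a := csq (leibniz R al be).
have a0 : 0 <= a by exact: csq_ge0.
have q1 : e ^+ (mlen al - l) * s ^+ n <= den e s / s.
  rewrite ler_pdivlMr// -mulrA -exprSr.
  apply: (le_trans _ (pow_le_sum (ltW s0) (ltW e0) hal)).
  by apply: ler_wpM2l; [rewrite exprn_ge0// ltW|rewrite ler_weXn2l].
have q2 : (e ^+ (mlen al - l) * s ^+ n / den e s) ^+ 2 <= 2 * kap t.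
  apply: (@le_trans _ _ ((s^-1) ^+ 2)).
    apply: lerXn2r; rewrite ?nnegrE ?invr_ge0 ?(ltW s0)//.
      by rewrite !mulr_ge0 ?invr_ge0 ?exprn_ge0// ltW.
    by rewrite ler_pdivrMr// [leRHS]mulrC.
  rewrite /kap -enorm_vec -/s exprVn ler_pdivlMr; last by rewrite ltr_pwDl ?sqr_ge0.
  rewrite mulrC ler_pdivrMr ?exprn_gt0//.
  by have := exprn_ege1 2 t1; lra.
apply: (@le_trans _ _ ((e ^+ (mlen al - l)) ^+ 2 * a *
    (((2 * pi) ^+ n) ^+ 2 * (s ^+ n) ^+ 2) * (den e s)^-1 ^+ 2)).
  apply: ler_wpM2r; first exact: sqr_ge0.
  by apply: ler_wpM2l; [rewrite mulr_ge0// sqr_ge0|exact: csq_fmono_le].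
rewrite /kcoef -/a -/n.
have -> : (e ^+ (mlen al - l)) ^+ 2 * a * (((2 * pi) ^+ n) ^+ 2 * (s ^+ n) ^+ 2) *
    (den e s)^-1 ^+ 2 = a * ((2 * pi) ^+ n) ^+ 2 *
    (e ^+ (mlen al - l) * s ^+ n / den e s) ^+ 2.
  by rewrite !exprMn; ring.
by apply: ler_wpM2l q2; rewrite mulr_ge0 ?sqr_ge0.
Qed.

Lemma weight_ge1 e x : 0 < e -> 1 <= weight l m e x.
Proof.
move=> e0; rewrite lerDl; apply: sumr_ge0 => k _.
by rewrite mulr_ge0 ?exprn_ge0 ?enorm_ge0// ltW.
Qed.

(** Of the m + 2 copies of D, one absorbs the constant 1, since D >= 1 for |x| >= 1, and each of the
    at most m + 1 powers takes one by [pow_le_sum]. *)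
Lemma weight_le e x : 0 < e -> 1 <= enorm x ->
  weight l m e x <= m.+2%:R * den e (enorm x).
Proof.
move=> e0 x1; have D1 := den_ge1 (ltW e0) x1.
rewrite -[m.+2]add1n natrD mulrDl mul1r; apply: lerD => //.
apply: (@le_trans _ _ (\sum_(l <= s < m.+1) den e (enorm x))).
  rewrite big_nat_cond [leRHS]big_nat_cond; apply: ler_sum => k; rewrite andbT ltnS => hk.
  by apply: pow_le_sum => //; [exact: enorm_ge0|exact: ltW].
rewrite sumr_const_nat -[leLHS]mulr_natl; apply: ler_wpM2r; last by rewrite ler_nat leq_subr.
exact: le_trans ler01 D1.
Qed.

(** The common shape of the two sums to be compared: with [hcoef] it unfolds to [symbH], with
    [pcoef] it is the symbol of [p1] applied to the transforms. *)
Definition lsum r (c : mindex d m -> mindex d m -> C)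
    (V : mindex d m -> mindex d m -> 'I_r -> C) : C :=
  \sum_(al : mindex d m | (l <= mlen al <= m)%N) \sum_(be : mindex d m) \sum_k
    c al be * V al be k.

Lemma csq_lsum r : exists2 K : R, 0 <= K & forall c (V : _ -> _ -> 'I_r -> C)
    (b : mindex d m -> mindex d m -> R),
  (forall al be, (l <= mlen al <= m)%N -> csq (c al be) <= b al be) ->
  csq (lsum c V) <= K * \sum_(al : mindex d m | (l <= mlen al <= m)%N)
     \sum_(be : mindex d m) \sum_k b al be * csq (V al be k).
Proof.
pose K1 : R := 2 ^+ size (index_enum (mindex d m : finType)).
pose K2 : R := 2 ^+ size (index_enum 'I_r).
exists (K1 * (K1 * K2)) => [|c V b cb]; first by rewrite !mulr_ge0 ?exprn_ge0.
apply: (le_trans (csq_sum _ _ _)); rewrite -mulrA; apply: ler_wpM2l.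
  exact: exprn_ge0.
rewrite mulr_sumr; apply: ler_sum => al hal.
apply: (le_trans (csq_sum _ _ _)); rewrite -mulrA; apply: ler_wpM2l.
  exact: exprn_ge0.
rewrite mulr_sumr; apply: ler_sum => be _.
apply: (le_trans (csq_sum _ _ _)); apply: ler_wpM2l; first exact: exprn_ge0.
apply: ler_sum => k _; rewrite csqM; apply: ler_wpM2r; first exact: csq_ge0.
exact: cb.
Qed.

Lemma csq_pcoef_le r : exists2 K : R, 0 <= K &
  forall e t (V : _ -> _ -> 'I_r -> C), 0 < e ->
  csq (lsum (fun al be => pcoef e al be t) V) <=
  K * (csq (lsum (fun al be => hcoef e al be t) V / (weight l m e (vec t))%:C) +
    \sum_(al : mindex d m | (l <= mlen al <= m)%N) \sum_(be : mindex d m) \sum_k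
      kcoef al be * (kap t * csq (V al be k))).
Proof.
have [K K0 hK] := csq_lsum r; pose M : R := m.+2%:R.
(* For |xi| >= 1 the symbol sum is the full sum divided by D plus a remainder, and [csqD] doubles
   both squares: weight / D <= M gives 2 M^2, and the remainder, at most 2 K S, gives 4 K. For |xi|
   < 1 the bound 2 K S alone is enough. *)
exists (2 * M ^+ 2 + 4 * K) => [|e t V e0].
  by rewrite addr_ge0// mulr_ge0// ?sqr_ge0.
have /andP[k0 _] := kap01 t.
set S := \sum_(_ | _) _.
have S0 : 0 <= S.
  apply: sumr_ge0 => al _; apply: sumr_ge0 => be _; apply: sumr_ge0 => k _.
  by rewrite mulr_ge0 ?kcoef_ge0// mulr_ge0 ?csq_ge0.
have bound c : (forall al be, (l <= mlen al <= m)%N ->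
    csq (c al be) <= kcoef al be * (2 * kap t)) -> csq (lsum c V) <= K * (2 * S).
  move=> /(hK c V) h; apply: (le_trans h); apply: ler_wpM2l => //.
  rewrite /S mulr_sumr; apply: ler_sum => al _; rewrite mulr_sumr; apply: ler_sum => be _.
  rewrite mulr_sumr; apply: ler_sum => k _.
  by rewrite le_eqVlt; apply/orP; left; apply/eqP; ring.
set H := csq (_ / _); have H0 : 0 <= H by exact: csq_ge0.
have [t1|t1] := ltP (enorm (vec t)) 1.
  have := bound _ (fun al be hal => pcoef_le e be hal t1).
  move=> h; apply: (le_trans h).
  have := mulr_ge0 K0 H0; have := mulr_ge0 (sqr_ge0 M) H0.
  by have := mulr_ge0 K0 S0; have := mulr_ge0 (sqr_ge0 M) S0; lra.
set s := enorm (vec t) in t1 *.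
have D0 : 0 < den e s by exact: lt_le_trans ltr01 (den_ge1 (ltW e0) t1).
have W0 : 0 < weight l m e (vec t) by exact: lt_le_trans ltr01 (weight_ge1 _ e0).
pose c al be := pcoef e al be t - hcoef e al be t / (den e s)%:C.
have hc : csq (lsum c V) <= K * (2 * S).
  apply: bound => al be hal; rewrite /c.
  have [->|be0] := eqVneq be zidx.
    rewrite hcoef_zidx// subrr -[0]/((0 : R)%:C) csqR expr0n.
    by rewrite mulr_ge0 ?kcoef_ge0 ?mulr_ge0.
  rewrite /pcoef (negbTE be0) sub0r -mulN1r csqM -[X in csq X * _](rmorphN1 (real_complex R)).
  by rewrite csqR sqrrN expr1n mul1r; exact: hcoef_le.
set LH := lsum (fun al be => hcoef e al be t) V in H H0 *.
have eP : lsum (fun al be => pcoef e al be t) V = LH / (den e s)%:C + lsum c V.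
  rewrite /LH /lsum mulr_suml -big_split; apply: eq_bigr => al _ /=.
  rewrite mulr_suml -big_split; apply: eq_bigr => be _ /=.
  by rewrite mulr_suml -big_split; apply: eq_bigr => k _ /=; rewrite /c; ring.
have hH : csq (LH / (den e s)%:C) <= M ^+ 2 * H.
  have -> : LH / (den e s)%:C = (weight l m e (vec t) / den e s)%:C *
      (LH / (weight l m e (vec t))%:C).
    rewrite rmorphM fmorphV /= mulrCA -mulrA; congr (LH * _).
    rewrite mulrCA mulrV ?mulr1// unitfE.
    by rewrite eq_complex /= eqxx andbT gt_eqF.
  rewrite csqM csqR; apply: ler_wpM2r => //; apply: lerXn2r; rewrite ?nnegrE//.
    by rewrite divr_ge0// ltW.
  by rewrite ler_pdivrMr//; exact: weight_le.
rewrite eP; apply: (le_trans (csqD _ _)).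
have := mulr_ge0 K0 H0; have := mulr_ge0 (sqr_ge0 M) H0.
by have := mulr_ge0 K0 S0; have := mulr_ge0 (sqr_ge0 M) S0; lra.
Qed.

End PointwiseBound.

(** * The compactification *)

Section Compactification.
Variables (R : realType) (d : nat).
Local Notation C := R[i].
Local Notation E := 'rV[R]_d.
Local Notation RT := (measurableTypeR R).

Lemma continuous_EFin : continuous (@EFin R).
Proof. by move=> x A. Qed.

(** A filter that does not cluster at +oo contains a set missing some neighbourhood of +oo, hence
    contains a real segment, which is compact. *)
Lemma compact_ereal_ge0 : compact [set x : \bar R | (0 <= x)%E].
Proof.
move=> F FF F0; have [h|h] := pselect (cluster F (+oo%E : \bar R)).
  by exists +oo%E; split => //; exact: leey.
have {h}[A [B [FA [nB AB]]]] : exists A B, F A /\ nbhs (+oo%E : \bar R) B /\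
    ~ (A `&` B !=set0).
  apply: contrapT => h'; apply: h => A B FA nB; apply: contrapT => AB.
  by apply: h'; exists A, B.
case: nB => M [_ hM].
have cK : compact (@EFin R @` `[0, Num.max M 0]%classic).
  apply: continuous_compact; last exact: segment_compact.
  exact/continuous_subspaceT/continuous_EFin.
have FK : F (@EFin R @` `[0, Num.max M 0]%classic).
  apply: filterS2 FA F0 => x Ax x0.
  have xM : (x <= M%:E)%E.
    by rewrite leNgt; apply/negP => /hM Bx; apply: AB; exists x.
  case: x Ax x0 xM => // x Ax /=; rewrite !lee_fin => x0 xM; exists x => //=.
  by rewrite in_itv /= x0 le_max xM.
have [x [[y hy <-] cx]] := cK F FF FK; exists y%:E; split => //=.
by move: hy; rewrite /= in_itv /= lee_fin => /andP[].
Qed.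

Lemma compact_sphere : compact [set x : E | enorm x = 1].
Proof.
apply: (subclosed_compact _ (@compact_cbox R d (fun=> -1) (fun=> 1))).
  have := @preimage_closed _ _ (@enorm R d) [set 1] _ (@closed_eq R 1).
  by apply => x _; exact: continuous_enorm.
by move=> x /= x1 j; have := coord_le_enorm x j; rewrite x1 ler_norml.
Qed.

Lemma compact_K0oo : compact (@K0oo R d).
Proof.
have := compact_setX compact_sphere compact_ereal_ge0.
by congr compact; apply/seteqP; split => -[x y].
Qed.

(* The radial profile of symb: for |e| = 1 and t > 0, symb l a (t e) =
   e^a t^(|a|-l) / (1 + t^(m-l)), and t -> 1/t exchanges |a|-l with m-|a|. *)
Definition prof (a b : nat) (t : R) : R := t ^+ a / (1 + t ^+ b).

Lemma cvg_pow (n : nat) (t : R) : s ^+ n @[s --> t] --> t ^+ n.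
Proof. exact: exprn_continuous. Qed.

Lemma cvg_prof (a b : nat) (t : R) : 0 <= t -> prof a b s @[s --> t] --> prof a b t.
Proof.
move=> t0; have n0 : 1 + t ^+ b != 0 by rewrite gt_eqF// ltr_pwDl// exprn_ge0.
apply: cvgM; first exact: cvg_pow.
by apply: cvgV => //; apply: cvgD; [exact: cvg_cst|exact: cvg_pow].
Qed.

Lemma cvg_inv_pinfty : s^-1 @[s --> +oo] --> (0 : R).
Proof.
apply/cvgrPdist_lt => e e0; near=> s.
have s0 : 0 < s by near: s; apply: nbhs_pinfty_gt; exact: num_real.
rewrite sub0r normrN gtr0_norm ?invr_gt0// invf_plt ?posrE//.
by near: s; apply: nbhs_pinfty_gt; exact: num_real.
Unshelve. all: by end_near. Qed.

Section Symbol.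
Variables (l m : nat) (al : mindex d m).
Hypothesis hal : (l <= mlen al <= m)%N.
Let a := (mlen al - l)%N.
Let b := (m - l)%N.
Let c := (m - mlen al)%N.

Let symb_ray (e : E) (t : R) : enorm e = 1 -> 0 < t ->
  symb l al (t *: e) = mono al e * prof a b t.
Proof.
move=> e1 t0; case/andP: hal => lk km.
rewrite /symb monoZ enormZ ?(ltW t0)// e1 mulr1 /prof.
have tl : t ^+ l != 0 by rewrite gt_eqF// exprn_gt0.
have -> : t ^+ mlen al = t ^+ l * t ^+ a by rewrite -exprD subnKC.
have -> : t ^+ l + t ^+ m = t ^+ l * (1 + t ^+ b).
  by rewrite mulrDr mulr1 -exprD subnKC// (leq_trans lk).
have n0 : 1 + t ^+ b != 0 by rewrite gt_eqF// ltr_pwDl// exprn_ge0 ?ltW.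
by field; rewrite tl n0.
Qed.

Let prof_inv (t : R) : 0 < t -> prof a b t = prof c b t^-1.
Proof.
move=> t0; case/andP: hal => lk km; rewrite /prof !exprVn.
have -> : t ^+ b = t ^+ a * t ^+ c by rewrite -exprD /a /b /c; congr (_ ^+ _); lia.
have a0 : 0 < t ^+ a by rewrite exprn_gt0.
have c0 : 0 < t ^+ c by rewrite exprn_gt0.
move: (t ^+ a) (t ^+ c) a0 c0 => x y x0 y0.
have xy : 1 + x * y != 0 by rewrite gt_eqF// ltr_pwDl//; apply: mulr_ge0; exact: ltW.
field; rewrite (gt_eqF x0) (gt_eqF y0) /= ?xy ?[x * y + 1]addrC ?xy//.
Qed.

Let prof_oo : prof a b t @[t --> +oo] --> prof c b 0.
Proof.
have h : prof c b t^-1 @[t --> +oo] --> prof c b 0.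
  exact: (cvg_comp _ _ cvg_inv_pinfty (@cvg_prof c b 0 (lexx 0))).
apply: cvg_trans h; apply: near_eq_cvg; near=> t.
by rewrite prof_inv//; near: t; apply: nbhs_pinfty_gt; exact: num_real.
Unshelve. all: by end_near. Qed.

Definition eprof (x : \bar R) : R := match x with
  | r%:E => prof a b r | +oo%E => prof c b 0 | -oo%E => 0 end.

Lemma extK_symb p : K0oo p -> extK (symb l al) p = mono al p.1 * eprof p.2.
Proof.
case: p => e [r| |] [/= e1 r0] //; rewrite /extK /=.
  move: r0; rewrite lee_fin => r0; case: eqVneq => [->|r1].
    apply/cvg_lim => //.
    have h : mono al e * prof a b t @[t --> 0^'+] --> mono al e * prof a b 0.
      apply: cvgM; first exact: cvg_cst.
      exact: cvg_at_right_filter (@cvg_prof a b 0 (lexx 0)).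
    apply: cvg_trans h; apply: near_eq_cvg; near=> t.
    by rewrite symb_ray//; near: t; exact: nbhs_right_gt.
  by rewrite symb_ray// lt0r r1.
apply/cvg_lim => //.
have h : mono al e * prof a b t @[t --> +oo] --> mono al e * prof c b 0.
  by apply: cvgM; [exact: cvg_cst|exact: prof_oo].
apply: cvg_trans h; apply: near_eq_cvg; near=> t.
by rewrite symb_ray//; near: t; apply: nbhs_pinfty_gt; exact: num_real.
Unshelve. all: by end_near. Qed.

Lemma cvg_eprof (x : \bar R) : (0 <= x)%E -> eprof y @[y --> x] --> eprof x.
Proof.
case: x => [r| |] // h.
  by rewrite lee_fin in h; move=> U /(@cvg_prof a b r h).
move=> U nU.
have [M [_ hM]] : exists M, M \is Num.real /\ forall t, M < t -> U (prof a b t).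
  exact: prof_oo nU.
exists M; split; first exact: num_real.
move=> -[y| |] //=; first by rewrite lte_fin; exact: hM.
by move=> _; exact: nbhs_singleton.
Qed.

Lemma continuous_mono : continuous (mono al : E -> R).
Proof.
move=> x; apply: (@cvgR_prod R E (nbhs x) _ _ (index_enum 'I_d)
  (fun j (y : E) => y 0 j ^+ al j) (fun j => x 0 j ^+ al j)) => j.
have h : (y : E) 0 j @[y --> x] --> x 0 j by exact: coord_continuous.
exact: (cvg_comp _ _ h (@exprn_continuous R (al j) (x 0 j))).
Qed.

Lemma continuous_extK_symb : {within @K0oo R d, continuous (extK (symb l al))}.
Proof.
apply: (@subspace_eq_continuous _ _ _ (fun p : E * \bar R => mono al p.1 * eprof p.2)).
  by move=> p; rewrite inE => /extK_symb h; exact: (esym h).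
apply/subspace_continuousP => p [_ p2].
apply: cvg_within_filter.
have h1 : mono al (q : E * \bar R).1 @[q --> p] --> mono al p.1.
  exact: (cvg_comp _ _ (@cvg_fst _ _ (nbhs p.1) (nbhs p.2) _) (@continuous_mono p.1)).
have h2 : eprof (q : E * \bar R).2 @[q --> p] --> eprof p.2.
  exact: (cvg_comp _ _ (@cvg_snd _ _ (nbhs p.1) (nbhs p.2) _) (cvg_eprof p2)).
exact: (cvgM h1 h2).
Qed.

End Symbol.

(** At the origin [polar 0] is (0, 0), off the sphere, and the limit along its ray is that of the
    constant [g 0]; so no frequency has to be excluded. *)
Lemma extK_polar (g : E -> R) x : extK g (polar x) = g x.
Proof.
rewrite /extK /polar /=; case: eqVneq => [x0|x0]; last first.
  by rewrite scalerA mulfV// scale1r.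
have -> : x = 0.
  apply/rowP => j; rewrite mxE; apply/eqP; rewrite -normr_le0.
  by rewrite (le_trans (coord_le_enorm x j))// x0.
rewrite scaler0; have -> : (fun t : R => g (t *: 0)) = cst (g 0).
  by apply/funext => t; rewrite scaler0.
by apply: lim_cst.
Qed.

End Compactification.

(** * Passage to the limit *)

Section PolarMeasurability.
Variables (R : realType) (d : nat).
Local Notation C := R[i].
Local Notation E := 'rV[R]_d.
Local Notation RT := (measurableTypeR R).

Lemma closed_rV1 (x : E) : closed [set x].
Proof. by apply: compact_closed_rV; exact: compact_set1. Qed.

Lemma near_neq0 (x : E) : x != 0 -> \forall y \near x, y != 0.
Proof.
move=> x0; have : open (~` [set (0 : E)]) by exact/closed_openC/closed_rV1.
rewrite openE => /(_ x)/(_ (fun h => negP x0 (introT eqP h))).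
by apply: filterS => y /eqP.
Qed.

(** A superlevel set is an open set up to the origin, whose singleton is measurable. Needed because
    [polar] is discontinuous at 0. *)
Lemma measurable_off0 (h : E -> R) : (forall x, x != 0 -> {for x, continuous h}) ->
  measurable_fun setT (fun t => h (vec t) : RT).
Proof.
move=> ch.
have := @measurability _ _ (d.-tuple RT) RT setT (fun t => h (vec t)) _
  (RGenOInfty.measurableE R).
apply.
move=> _ [_ [y ->] <-]; rewrite setTI.
pose S : set E := [set x | y < h x].
have -> : (fun t => h (vec t) : RT) @^-1` `]y, +oo[%classic =
    (@vec R d @^-1` (S `&` ~` [set 0])) `|` (@vec R d @^-1` (S `&` [set 0])).
  apply/seteqP; split => t /=; rewrite in_itv /= andbT.
    by move=> yt; have [t0|t0] := pselect (vec t = 0); [right|left].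
  by case=> -[].
apply: measurableU.
  apply: measurable_open_vec; rewrite openE => x [Sx /eqP x0].
  have h1 : \forall z \near x, y < h z.
    exact: (ch x x0 [set z | y < z] (open_nbhs_nbhs (conj (@open_gt _ y) Sx))).
  by apply: filterS2 h1 (near_neq0 x0) => z Sz /eqP z0; split.
have [S0|S0] := pselect (S 0).
  have -> : S `&` [set 0] = [set 0] by apply/seteqP; split => [x []|x ->].
  exact: (measurable_closed_vec (@closed_rV1 0)).
have -> : S `&` [set 0] = set0 by apply/seteqP; split => // x [] /[swap] ->.
by rewrite preimage_set0; exact: measurable0.
Qed.

Lemma cmeas_off0 (g : E -> C) : (forall x, x != 0 -> {for x, continuous g}) ->
  cmeas (fun t => g (vec t)).
Proof.
move=> cg; split.
  apply: (@measurable_off0 (fun x => Re (g x))) => x x0.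
  by have /cvgC_ReIm[] := cg x x0.
apply: (@measurable_off0 (fun x => Im (g x))) => x x0.
by have /cvgC_ReIm[] := cg x x0.
Qed.

Lemma enorm_eq0 (x : E) : (enorm x == 0) = (x == 0).
Proof.
apply/eqP/eqP => [x0|->].
  apply/rowP => j; rewrite mxE; apply/eqP; rewrite -normr_le0.
  by rewrite (le_trans (coord_le_enorm x j))// x0.
by rewrite -[0 in LHS](scale0r (0 : E)) enormZ// mul0r.
Qed.

Lemma K0oo_polar (x : E) : x != 0 -> K0oo (polar x).
Proof.
move=> x0; split => /=; last by rewrite lee_fin enorm_ge0.
by rewrite enormZ ?invr_ge0 ?enorm_ge0// mulVf// enorm_eq0.
Qed.

Lemma cvg_polar (c : R) (x : E) : c != 0 -> x != 0 ->
  polar (c *: (y : E)) @[y --> x] --> polar (c *: x).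
Proof.
move=> c0 x0; have n0 : enorm (c *: x) != 0.
  by rewrite enorm_eq0 scaler_eq0 negb_or c0.
have h0 : c *: (y : E) @[y --> x] --> c *: x.
  have h : (y : E) @[y --> x] --> x by exact: cvg_id.
  exact: (cvgZ (cvg_cst c) h).
have h1 : enorm (c *: (y : E)) @[y --> x] --> enorm (c *: x).
  exact: (cvg_comp _ _ h0 (@continuous_enorm R d _)).
have h2 : (enorm (c *: (y : E)))^-1 @[y --> x] --> (enorm (c *: x))^-1.
  exact: (cvgV n0 h1).
have h3 : (enorm (c *: (y : E)))^-1 *: (c *: (y : E)) @[y --> x] -->
    (enorm (c *: x))^-1 *: (c *: x) by exact: (cvgZ h2 h0).
have h4 : (enorm (c *: (y : E)))%:E @[y --> x] --> (enorm (c *: x))%:E.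
  exact: (cvg_comp _ _ h1 (@continuous_EFin R _)).
exact: (cvg_pair h3 h4).
Qed.

Lemma cmeas_polar (psi : E * \bar R -> C) (c : R) : {within @K0oo R d, continuous psi} ->
  c != 0 -> cmeas (fun t => psi (polar (c *: vec t))).
Proof.
move=> /subspace_continuousP cpsi c0.
apply: (@cmeas_off0 (fun x => psi (polar (c *: x)))) => x x0 A nA.
have cx0 : c *: x != 0 by rewrite scaler_eq0 negb_or c0.
have h1 : \forall q \near polar (c *: x), K0oo q -> A (psi q).
  exact: cpsi _ (K0oo_polar cx0) A nA.
have h2 : \forall y \near x, K0oo (polar (c *: y)) -> A (psi (polar (c *: y))).
  exact: cvg_polar c0 x0 _ h1.
have h3 := near_neq0 x0.
apply: filterS2 h2 h3 => y /= h y0; apply: (h); apply: K0oo_polar.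
by rewrite scaler_eq0 negb_or c0.
Qed.

End PolarMeasurability.

Section ProductLimit.
Context {dd : measure_display} {T : measurableType dd} {R : realType}
  (leb : {measure set T -> \bar R}).
Local Notation C := R[i].

(** The inequality 2 |P| |F| <= la |P|^2 + |F|^2 / la, with a free parameter to be tuned in the
    limit; its factor 2 cancels the one lost in [normc_CInt]. *)
Lemma CI_prod3 (P F w : T -> C) (M : R) :
  cmeas P -> cmeas F -> cmeas w ->
  leb.-integrable setT (fun t => (csq (P t))%:E) ->
  leb.-integrable setT (fun t => (csq (F t))%:E) ->
  (forall t, normc (w t) <= M) ->
  CI leb (fun t => P t * F t * w t) /\
  forall la : R, 0 < la -> normc (CInt leb (fun t => P t * F t * w t)) <=
    M * (la * \int[leb]_t csq (P t) + la^-1 * \int[leb]_t csq (F t)).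
Proof.
move=> mP mF mw IP IF wM.
pose G (la : R) t := M * (la / 2 * csq (P t) + la^-1 / 2 * csq (F t)).
have mPFw : cmeas (fun t => P t * F t * w t) by do 2 apply: cmeasM => //.
have IZ (la : R) (h : T -> R) : leb.-integrable setT (fun t => (h t)%:E) ->
    leb.-integrable setT (fun t => (la * h t)%:E).
  move=> Ih; have := integrableZl measurableT la Ih.
  by apply: eq_integrable.
have ID la : leb.-integrable setT
    (fun t => (la / 2 * csq (P t) + la^-1 / 2 * csq (F t))%:E).
  have := integrableD measurableT (IZ (la / 2) _ IP) (IZ (la^-1 / 2) _ IF).
  by apply: eq_integrable.
have IG la : leb.-integrable setT (fun t => (G la t)%:E) by exact: IZ.
have le la t : 0 < la -> normc (P t * F t * w t) <= G la t.
  move=> la0; rewrite !Normc.normcM mulrC /G !csqE.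
  have w0 := normc_ge0 (w t); have M0 := le_trans w0 (wM t).
  apply: ler_pM => //; first by rewrite mulr_ge0 ?normc_ge0.
  have : 0 <= la / 2 * (normc (P t) - la^-1 * normc (F t)) ^+ 2.
    by rewrite mulr_ge0 ?sqr_ge0// divr_ge0// ltW.
  have -> : la / 2 * (normc (P t) - la^-1 * normc (F t)) ^+ 2 =
    la / 2 * normc (P t) ^+ 2 + la^-1 / 2 * normc (F t) ^+ 2 -
    normc (P t) * normc (F t) by field; rewrite gt_eqF.
  by rewrite subr_ge0.
have ci : CI leb (fun t => P t * F t * w t).
  by apply: (CI_dom mPFw (IG 1)) => t; exact: le.
split=> // la la0; apply: (le_trans (normc_CInt ci (IG la) (fun t => le la t la0))).
rewrite /G RintegralZl//; last exact: ID.
rewrite RintegralD//; [|exact: IZ|exact: IZ].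
rewrite !RintegralZl//.
by rewrite le_eqVlt; apply/orP; left; apply/eqP; field; rewrite gt_eqF.
Qed.

Lemma cvg_CInt_prod3 (P F w : nat -> T -> C) (M B : R) :
  (forall N, cmeas (P N)) -> (forall N, cmeas (F N)) -> (forall N, cmeas (w N)) ->
  (forall N, leb.-integrable setT (fun t => (csq (P N t))%:E)) ->
  (forall N, leb.-integrable setT (fun t => (csq (F N t))%:E)) ->
  (forall N t, normc (w N t) <= M) -> 0 <= M ->
  (\int[leb]_t (csq (P N t))%:E)%E @[N --> \oo] --> 0%E ->
  (forall N, (\int[leb]_t (csq (F N t))%:E <= B%:E)%E) ->
  CInt leb (fun t => P N t * F N t * w N t) @[N --> \oo] --> (0 : C).
Proof.
move=> mP mF mw IP IF wM M0 P0 FB.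
pose a N := \int[leb]_t csq (P N t).
have a0 N : 0 <= a N by apply: Rintegral_ge0 => t _; exact: csq_ge0.
have ca : a N @[N --> \oo] --> (0 : R) by exact: (fine_cvg P0).
(* The parameter [la] will be 1 / s: then la a <= s, while the other term is at most s B. The added
   1 / (N + 1) keeps s positive if a vanishes. *)
pose s N := Num.sqrt (a N + N.+1%:R^-1).
have s0 N : 0 < s N.
  by rewrite sqrtr_gt0 ltr_wpDl// invr_gt0.
have cs : s N @[N --> \oo] --> (0 : R).
  have h : a N + N.+1%:R^-1 @[N --> \oo] --> (0 : R).
    by rewrite -[X in _ --> X]addr0; apply: cvgD => //; exact: cvg_harmonic.
  rewrite -[X in _ --> X](sqrtr0 R).
  exact: (cvg_comp _ _ h (@sqrt_continuous R 0)).
have FB' N : \int[leb]_t csq (F N t) <= B.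
  by rewrite -lee_fin /Rintegral fineK//; exact: integrable_fin_num.
have le N : normc (CInt leb (fun t => P N t * F N t * w N t)) <= M * (1 + B) * s N.
  have [_ /(_ (s N)^-1)] := CI_prod3 (mP N) (mF N) (mw N) (IP N) (IF N) (wM N).
  rewrite invr_gt0 => /(_ (s0 N)) h; apply: (le_trans h).
  rewrite -mulrA invrK; apply: ler_wpM2l => //; rewrite mulrDl mul1r; apply: lerD.
    rewrite ler_pdivrMl// -expr2 /s sqr_sqrtr.
      by rewrite -/(a N) lerDl invr_ge0.
    by rewrite addr_ge0// invr_ge0.
  by rewrite mulrC; apply: ler_wpM2r => //; exact: ltW.
have cn : normc (CInt leb (fun t => P N t * F N t * w N t)) @[N --> \oo] --> (0 : R).
  apply: (@squeeze_cvgr _ _ _ _ (fun=> 0) (fun N => M * (1 + B) * s N)).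
  - by apply: nearW => N; rewrite normc_ge0 le.
  - exact: cvg_cst.
  - by rewrite -[X in _ --> X](mulr0 (M * (1 + B))); apply: cvgM => //; exact: cvg_cst.
apply/cvgC_ReIm; split; apply/cvgr0Pnorm_le => e e0;
  move/cvgr0Pnorm_le : cn => /(_ e e0); apply: filterS => N;
  rewrite ger0_norm ?normc_ge0//; apply: le_trans; first [exact: normc_Re|exact: normc_Im].
Qed.

End ProductLimit.

Section VanishingIntegrals.
Context {dd : measure_display} {T : measurableType dd} {R : realType}
  (mu : {measure set T -> \bar R}).
Implicit Types f g : nat -> T -> R.

Definition vanishing g := [/\ forall N, measurable_fun setT (g N),
  forall N t, 0 <= g N t & (\int[mu]_t (g N t)%:E)%E @[N --> \oo] --> 0%E].

Lemma vanishing_le f g : (forall N, measurable_fun setT (f N)) ->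
  (forall N t, 0 <= f N t <= g N t) -> vanishing g -> vanishing f.
Proof.
move=> mf fg [mg g0 cg]; split=> // [N t|]; first by have /andP[] := fg N t.
apply: (squeeze_cvge _ (cvg_cst 0%E) cg); apply: nearW => N; apply/andP; split.
  by apply: integral_ge0 => t _; rewrite lee_fin; have /andP[] := fg N t.
apply: ge0_le_integral => //.
- by move=> t _; rewrite lee_fin; have /andP[] := fg N t.
- exact/measurable_EFinP.
- exact/measurable_EFinP.
- by move=> t _; rewrite lee_fin; have /andP[] := fg N t.
Qed.

Lemma vanishing0 : vanishing (fun _ _ => 0).
Proof. by split=> //; under eq_fun do rewrite integral0; exact: cvg_cst. Qed.

Lemma vanishingD f g : vanishing f -> vanishing g ->
  vanishing (fun N t => f N t + g N t).
Proof.
move=> [mf f0 cf] [mg g0 cg]; split.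
- by move=> N; exact: measurable_funD.
- by move=> N t; rewrite addr_ge0.
have -> : (fun N => \int[mu]_t (f N t + g N t)%:E)%E =
    (fun N => \int[mu]_t (f N t)%:E + \int[mu]_t (g N t)%:E)%E.
  apply/funext => N; under eq_integral do rewrite EFinD.
  rewrite ge0_integralD//.
  - by move=> t _; rewrite lee_fin.
  - exact/measurable_EFinP.
  - by move=> t _; rewrite lee_fin.
  - exact/measurable_EFinP.
by rewrite -[X in _ --> X]adde0; exact: cvgeD.
Qed.

Lemma vanishingZ (c : R) f : 0 <= c -> vanishing f ->
  vanishing (fun N t => c * f N t).
Proof.
move=> c0 [mf f0 cf]; split.
- by move=> N; exact: measurable_funM.
- by move=> N t; rewrite mulr_ge0.
have -> : (fun N => \int[mu]_t (c * f N t)%:E)%E =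
    (fun N => c%:E * \int[mu]_t (f N t)%:E)%E.
  apply/funext => N; under eq_integral do rewrite EFinM.
  rewrite ge0_integralZl_EFin//; first by move=> t _; rewrite lee_fin.
  exact/measurable_EFinP.
by rewrite -[X in _ --> X](mule0 c%:E); exact: cvgeZl.
Qed.

Lemma vanishing_sum I (s : seq I) (P : pred I) (F : I -> nat -> T -> R) :
  (forall i, P i -> vanishing (F i)) ->
  vanishing (fun N t => \sum_(i <- s | P i) F i N t).
Proof.
move=> h; elim: s => [|i s IH].
  by under eq_fun do under eq_fun do rewrite big_nil; exact: vanishing0.
under eq_fun do under eq_fun do rewrite big_cons.
by case: (boolP (P i)) => // Pi; apply: vanishingD => //; exact: h.
Qed.

End VanishingIntegrals.

Section BoxIdentity.
Variables (R : realType) (d m l q r : nat).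
Local Notation C := R[i].
Local Notation E := 'rV[R]_d.
Local Notation RT := (measurableTypeR R).
Local Notation leb := (leb R d).

Variables (Omega : set E) (Omega_open : open Omega).
Variables (u : nat -> E -> 'cV[C]_r) (u0 : weakly_to0 Omega u).
Variable A : mindex d m -> E -> 'M[C]_(q, r).
Hypothesis A_continuous : forall a : mindex d m, (l <= mlen a <= m)%N ->
  {within Omega, continuous (A a)}.
Variables (e : nat -> R) (f : nat -> 'I_q -> (E -> C) -> C).
Hypothesis e0 : forall N, 0 < e N.
Hypothesis u_solves : forall N, solves Omega l (e N) A (u N) (f N).
Hypothesis f_to0 : weighted_fourier_to0 Omega l m e f.
Variable mu : 'I_r -> 'I_r -> (E * (E * \bar R) -> C) -> C.
Hypothesis muH : one_scale_Hmeasure Omega u e mu.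
Variables (lo hi : 'I_d -> R).
Hypothesis lohi : cbox lo hi `<=` Omega.
Variable i : 'I_q.

Let V N t al be k := FT (loc u (theta A lo hi i al be k) k N) t.
(** Only be = 0 contributes: this is component [i] of the symbol of [p1] at the rescaled frequency
    applied to the transforms of phi A^al u_N. *)
Let P N t := lsum l (fun al be => pcoef l (e N) al be t) (V N t).

Let Vloc N al be k (hal : (l <= mlen al <= m)%N) :=
  loc_L2 Omega_open u0 k N (Cc_theta Omega_open A_continuous lohi i be k hal).

Lemma measurable_weightV (c : R) : 0 < c ->
  measurable_fun setT (fun t : d.-tuple RT => (weight l m c (vec t))^-1).
Proof.
move=> c0; suff cw : continuous (fun x : E => (weight l m c x)^-1).
  exact: (measurable_continuous_vec cw).
move=> x; have n0 : weight l m c x != 0.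
  by rewrite gt_eqF// (lt_le_trans ltr01)// weight_ge1.
have h k : c ^+ (k - l) * enorm y ^+ k @[y --> x] --> c ^+ (k - l) * enorm x ^+ k.
  have h1 : enorm y ^+ k @[y --> x] --> enorm x ^+ k.
    exact: (cvg_comp _ _ (@continuous_enorm R d x) (@exprn_continuous R k _)).
  exact: (cvgM (cvg_cst _) h1).
have hw : weight l m c y @[y --> x] --> weight l m c x.
  exact: (cvgD (cvg_cst (1 : R)) (@cvgR_sum R E (nbhs x) _ _ (index_iota l m.+1)
    (fun k y => c ^+ (k - l) * enorm y ^+ k)
    (fun k => c ^+ (k - l) * enorm x ^+ k) h)).
exact: (cvgV n0 hw).
Qed.

Let residue N (t : d.-tuple RT) :=
  symbH l u A N (e N) lo hi i t / (weight l m (e N) (vec t))%:C.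

Let cmeas_residue N : cmeas (residue N).
Proof.
apply: cmeasM; first exact: (cmeas_symbH Omega_open u0 A_continuous).
under eq_fun do rewrite -fmorphV; apply: cmeasC.
exact: measurable_weightV.
Qed.

(** The hypothesis concerns some transform [h] of phi f_N; by [ae_symbH] it can be replaced by
    [symbH] under the integral. *)
Let residue_vanishing : vanishing leb (fun N t => csq (residue N t)).
Proof.
have ctest : test Omega (boxtest lo hi).
  exact: (test_tens _ (dseq_boxseq lo hi) (@boxseq_out R d lo hi) lohi).
have [h [hf h0]] := f_to0 ctest.
have mh N j : cmeas (fun t => h N j (vec t) / (weight l m (e N) (vec t))%:C).
  have [[m1 m2] _] := hf N j; apply: cmeasM.
    by split; rewrite preimage_setT in m1 m2.
  under eq_fun do rewrite -fmorphV; apply: cmeasC.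
  exact: measurable_weightV.
have hle : vanishing leb (fun N t => \sum_j
    csq (h N j (vec t) / (weight l m (e N) (vec t))%:C)).
  split.
  - by move=> N; apply: measurable_sum => j; exact: measurable_csq.
  - by move=> N t; apply: sumr_ge0 => j _; exact: csq_ge0.
  by move: h0; rewrite /nnint preimage_setT.
have hi0 : vanishing leb (fun N t =>
    csq (h N i (vec t) / (weight l m (e N) (vec t))%:C)).
  apply: vanishing_le hle; first by move=> N; exact: measurable_csq.
  move=> N t; rewrite csq_ge0/= (bigD1 i)//= lerDl.
  by apply: sumr_ge0 => j _; exact: csq_ge0.
split=> [N|N t|]; [exact: measurable_csq|exact: csq_ge0|].
suff -> : (fun N => \int[leb]_t (csq (residue N t))%:E)%E = (fun N => \int[leb]_t
    (csq (h N i (vec t) / (weight l m (e N) (vec t))%:C))%:E)%E by case: hi0.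
apply/funext => N.
apply: ge0_ae_eq_integral => //.
- by apply/measurable_EFinP; exact: measurable_csq.
- by apply/measurable_EFinP; exact: measurable_csq.
- by move=> t _; rewrite lee_fin; exact: csq_ge0.
- by move=> t _; rewrite lee_fin; exact: csq_ge0.
have := ae_symbH Omega_open u0 A_continuous (u_solves N) lohi (hf N i).
by apply: filterS => t ht _; rewrite /residue ht.
Qed.

Let mpsi (al : mindex d m) N : (l <= mlen al <= m)%N ->
  cmeas (fun t : d.-tuple RT => (symb l al (e N *: vec t))%:C : C).
Proof.
move=> hal; under eq_fun do rewrite -(extK_polar (symb l al)).
apply: (@cmeas_polar R d (fun p => (extK (symb l al) p)%:C)).
  move=> p; exact: (cvgCR (continuous_extK_symb hal (x := p))).
by rewrite gt_eqF.
Qed.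

Let cmeas_P N : cmeas (P N).
Proof.
apply: cmeas_sum => al hal; apply: cmeas_sum => be _; apply: cmeas_sum => k _.
apply: cmeasM; last by have [] := Vloc N be k hal.
rewrite /pcoef; case: (be == zidx d m); last exact: cmeas_cst.
by apply: cmeasM; [exact: cmeas_cst|exact: mpsi].
Qed.

Let P_integrable N : leb.-integrable setT (fun t => (csq (P N t))%:E).
Proof.
have [K K0 hK] := csq_lsum R d m l r.
pose G t := K * \sum_(al : mindex d m | (l <= mlen al <= m)%N)
  \sum_(be : mindex d m) \sum_k kcoef R al (zidx d m) * csq (V N t al be k).
have IZ (la : R) (h : d.-tuple RT -> R) : leb.-integrable setT (fun t => (h t)%:E) ->
    leb.-integrable setT (fun t => (la * h t)%:E).
  by move=> Ih; have := integrableZl measurableT la Ih; apply: eq_integrable.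
have Isum I (s : seq I) (Q : pred I) (h : I -> d.-tuple RT -> R) :
    (forall j, Q j -> leb.-integrable setT (fun t => (h j t)%:E)) ->
    leb.-integrable setT (fun t => (\sum_(j <- s | Q j) h j t)%:E).
  move=> Ih; have := integrable_sum measurableT s Ih.
  by apply: eq_integrable => // t _; rewrite sumEFin.
have IG : leb.-integrable setT (fun t => (G t)%:E).
  pose c al := kcoef R al (zidx d m).
  rewrite /G; apply: (IZ).
  apply: (Isum _ _ _ (fun al t => \sum_be \sum_k c al * csq (V N t al be k))) => al hal.
  apply: (Isum _ _ _ (fun be t => \sum_k c al * csq (V N t al be k))) => be _.
  apply: (Isum _ _ _ (fun k t => c al * csq (V N t al be k))) => k _.
  apply: (IZ _ (fun t => csq (V N t al be k))).
  by have [] := Vloc N be k hal.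
apply: (le_integrable measurableT _ _ IG).
  by apply/measurable_EFinP; exact: measurable_csq.
move=> t _; rewrite /= lee_fin ger0_norm ?csq_ge0//.
apply: (le_trans _ (ler_norm _)).
apply: (hK _ (V N t) (fun al be => kcoef R al (zidx d m))) => al be hal.
rewrite /pcoef; case: ifP => _; last first.
  by rewrite csq0 kcoef_ge0.
rewrite csqM csq_2pi kcoef_zidx csqR ler_piMr ?sqr_ge0//.
rewrite -[leLHS]real_normK ?num_real// -[leRHS](expr1n _ 2).
by apply: lerXn2r; rewrite ?nnegrE ?normr_symb_le1.
Qed.

Let P_vanishing : vanishing leb (fun N t => csq (P N t)).
Proof.
have [K K0 hK] := csq_pcoef_le R d m l r.
have h : vanishing leb (fun N t => K * (csq (residue N t) +
    \sum_(al : mindex d m | (l <= mlen al <= m)%N) \sum_(be : mindex d m) \sum_k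
      kcoef R al be * (kap t * csq (V N t al be k)))).
  apply: vanishingZ => //; apply: vanishingD; first exact: residue_vanishing.
  apply: vanishing_sum => al hal; apply: vanishing_sum => be _.
  apply: vanishing_sum => k _; apply: vanishingZ; first exact: kcoef_ge0.
  split.
  - move=> N; apply: measurable_funM; first exact: measurable_kap.
    by have [_ _ mV _] := Vloc N be k hal; exact: measurable_csq.
  - by move=> N t; have /andP[k0 _] := kap01 t; rewrite mulr_ge0 ?csq_ge0.
  exact: (weighted_loc_cvg0 Omega_open u0 muH k
    (Cc_theta Omega_open A_continuous lohi i be k hal)).
apply: vanishing_le h => [N|N t]; first exact: measurable_csq.
by rewrite csq_ge0 /=; exact: hK.
Qed.

Section Pairing.
Variables (phi : E -> C) (psi : E * \bar R -> C) (M : R) (j : 'I_r).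
Hypothesis cphi : Cc Omega phi.
Hypothesis cpsi : {within @K0oo R d, continuous psi}.
Hypothesis psiM : forall p, normc (psi p) <= M.

Let F N t := (FT (loc u phi j N) t)^*.
Let w N t := psi (polar (e N *: vec t)).

Let M0 : 0 <= M. Proof. exact: le_trans (normc_ge0 _) (psiM (0, 0%E)). Qed.

Let Floc N := loc_L2 Omega_open u0 j N cphi.

Let mF N : cmeas (F N).
Proof. by apply: cmeasJ; have [] := Floc N. Qed.

Let IF N : leb.-integrable setT (fun t => (csq (F N t))%:E).
Proof.
have [_ _ _] := Floc N; apply: eq_integrable => // t _.
by rewrite /F csqJ.
Qed.

Let mw N : cmeas (w N).
Proof. by apply: cmeas_polar => //; rewrite gt_eqF. Qed.

Let paired0 : CInt leb (fun t => P N t * F N t * w N t) @[N --> \oo] --> (0 : C).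
Proof.
have [B hB] := FT_loc_bounded Omega_open u0 muH j cphi.
have [_ _ h] := P_vanishing.
apply: (cvg_CInt_prod3 (M := M) (B := B)) => // N.
  by move=> t; exact: psiM.
apply: le_trans (hB N); rewrite le_eqVlt; apply/orP; left; apply/eqP.
by apply: eq_integral => t _; rewrite /F csqJ.
Qed.

Let th al k := theta A lo hi i al (zidx d m) k.
Let Psi al (k : 'I_r) (z : E * (E * \bar R)) : C :=
  th al k z.1 * (phi z.1)^* * ((extK (symb l al) z.2)%:C * psi z.2).

(** The pairing tends to 0 since [P] does in L^2, and to the sum on the left by the definition of
    the H-measure, with the symbol times [psi] as function on the compactification. The order (k, j)
    of the indices will be reversed by hermitian symmetry, which produces the transpose in the
    theorem. *)
Lemma box_limit : \sum_(al : mindex d m | (l <= mlen al <= m)%N) \sum_k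
  (0 +i* (2 * pi)) ^+ mlen al * conj_radon (mu k j) (Psi al k) = 0.
Proof.
have [_ _ hH] := muH.
pose term N al k t := FT (loc u (th al k) k N) t * F N t *
  ((symb l al (e N *: vec t))%:C * w N t).
have It N al k : (l <= mlen al <= m)%N -> CI leb (term N al k).
  move=> hal; have [_ _ m1 I1] := Vloc N (zidx d m) k hal.
  have [|//] := CI_prod3 (M := M) m1 (mF N) (cmeasM (mpsi N hal) (mw N)) I1 (IF N).
  move=> t; rewrite Normc.normcM normcC -[leRHS]mul1r.
  by apply: ler_pM; rewrite ?normc_ge0 ?normr_symb_le1//; exact: psiM.
have lim al k : (l <= mlen al <= m)%N ->
    CInt leb (term N al k) @[N --> \oo] --> conj_radon (mu k j) (Psi al k).
  move=> hal.
  have c1 : {within @K0oo R d, continuous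
      (fun p => (extK (symb l al) p)%:C * psi p)}.
    move=> p; apply: cvgCM; last exact: cpsi.
    exact: (cvgCR (continuous_extK_symb hal (x := p))).
  have := hH _ _ (Cc_theta Omega_open A_continuous lohi i (zidx d m) k hal) cphi
    _ c1 k j.
  apply: cvg_trans; apply: near_eq_cvg.
  apply: nearW => N; apply: eq_CInt => t.
  by rewrite !fourier_vec extK_polar.
have eP N : CInt leb (fun t => P N t * F N t * w N t) =
    \sum_(al : mindex d m | (l <= mlen al <= m)%N) \sum_k
      (0 +i* (2 * pi)) ^+ mlen al * CInt leb (term N al k).
  transitivity (CInt leb (fun t =>
    \sum_(al : mindex d m | (l <= mlen al <= m)%N) \sum_k
      (0 +i* (2 * pi)) ^+ mlen al * term N al k t)).
    apply: eq_CInt => t; rewrite /P /lsum !mulr_suml; apply: eq_bigr => al hal.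
    rewrite (bigD1 (zidx d m))//= [X in _ + X]big1 ?addr0; last first.
      move=> be be0; rewrite big1// => k _.
      by rewrite /pcoef (negbTE be0) mul0r.
    rewrite !mulr_suml; apply: eq_bigr => k _.
    by rewrite /pcoef eqxx /term /V; ring.
  rewrite CInt_sum; last first.
    by move=> al hal; apply: CI_sum => k _; apply: CI_Z; exact: It.
  apply: eq_bigr => al hal; rewrite CInt_sum; last first.
    by move=> k _; apply: CI_Z; exact: It.
  by apply: eq_bigr => k _; rewrite CInt_Z//; exact: It.
have lim2 : CInt leb (fun t => P N t * F N t * w N t) @[N --> \oo] -->
   \sum_(al : mindex d m | (l <= mlen al <= m)%N) \sum_k
     (0 +i* (2 * pi)) ^+ mlen al * conj_radon (mu k j) (Psi al k).
  rewrite (funext eP); apply: cvgC_sum => al hal; apply: cvgC_sum => k _.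
  by apply: cvgCM; [exact: cvg_cst|exact: lim].
exact: (cvg_unique _ lim2 paired0).
Qed.

End Pairing.

End BoxIdentity.

(** * Radon measures *)

Lemma cvg_maxr (R : realType) {T} {F : set_system T} {FF : Filter F} (f g : T -> R)
    (a b : R) : f @ F --> a -> g @ F --> b -> Num.max (f t) (g t) @[t --> F] --> Num.max a b.
Proof.
have maxE (x y : R) : Num.max x y = (x + y + `|x - y|) / 2.
  by rewrite maxElt; case: ltP => h; [rewrite ltr0_norm|rewrite ger0_norm]; lra.
move=> fa gb; under eq_fun do rewrite maxE; rewrite maxE.
exact: (cvgM (cvgD (cvgD fa gb) (cvg_norm (cvgB fa gb))) (cvg_cst _)).
Qed.

Section RadonAlgebra.
Variables (R : realType) (T : topologicalType) (X : set T).
Local Notation C := R[i].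
Implicit Types (Phi Psi g : T -> C) (L : (T -> C) -> C).

Lemma CcX0 : CcX X (fun=> 0 : C).
Proof.
split; first by apply: continuous_subspaceT => x; exact: cvg_cst.
by exists set0; split => //; exact: compact0.
Qed.

Lemma CcX_lin (a : C) Phi Psi : CcX X Phi -> CcX X Psi ->
  CcX X (fun z => a * Phi z + Psi z).
Proof.
move=> [c1 [K1 [k1 s1 z1]]] [c2 [K2 [k2 s2 z2]]]; split.
  by move=> z; exact: (cvgCD (cvgCM (cvg_cst a) (c1 z)) (c2 z)).
exists (K1 `|` K2); split; first exact: compactU.
  by move=> z [/s1|/s2].
by move=> z Xz /not_orP[n1 n2]; rewrite z1// z2// mulr0 addr0.
Qed.

Lemma CcX_mul g Phi : {within X, continuous g} -> CcX X Phi ->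
  CcX X (fun z => g z * Phi z).
Proof.
move=> cg [c1 [K1 [k1 s1 z1]]]; split; first by move=> z; exact: (cvgCM (cg z) (c1 z)).
by exists K1; split => // z Xz nK; rewrite z1// mulr0.
Qed.

Lemma CcX_comp (h : C -> C) Phi : continuous h -> h 0 = 0 -> CcX X Phi ->
  CcX X (fun z => h (Phi z)).
Proof.
move=> ch h0 [c1 [K1 [k1 s1 z1]]]; split.
  by move=> z; exact: (cvg_comp _ _ (c1 z) (ch _)).
by exists K1; split => // z Xz nK; rewrite z1.
Qed.

Lemma CcX_sum I (s : seq I) (P : pred I) (F : I -> T -> C) :
  (forall i, P i -> CcX X (F i)) -> CcX X (fun z => \sum_(i <- s | P i) F i z).
Proof.
move=> h; elim: s => [|i s IH].
  by under eq_fun do rewrite big_nil; exact: CcX0.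
under eq_fun do rewrite big_cons.
case: (boolP (P i)) => // Pi; have := CcX_lin 1 (h i Pi) IH.
by under eq_fun do rewrite mul1r.
Qed.

Lemma CcX_Z (a : C) Phi : CcX X Phi -> CcX X (fun z => a * Phi z).
Proof. by move=> h; have := CcX_lin a h CcX0; under eq_fun do rewrite addr0. Qed.

Section Linear.
Variable L : (T -> C) -> C.
Hypothesis rL : radon X L.

Lemma radon0 : L (fun=> 0) = 0.
Proof.
have := rL.1 (-1) _ _ CcX0 CcX0.
by under eq_fun do rewrite mulr0 addr0; move=> ->; rewrite mulN1r addNr.
Qed.

Lemma radonZ a Phi : CcX X Phi -> L (fun z => a * Phi z) = a * L Phi.
Proof.
move=> h; have := rL.1 a _ _ h CcX0.
by under eq_fun do rewrite addr0; move=> ->; rewrite radon0 addr0.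
Qed.

Lemma radon_sum I (s : seq I) (P : pred I) (F : I -> T -> C) :
  (forall i, P i -> CcX X (F i)) ->
  L (fun z => \sum_(i <- s | P i) F i z) = \sum_(i <- s | P i) L (F i).
Proof.
move=> h; elim: s => [|i s IH].
  by under eq_fun do rewrite big_nil; rewrite big_nil radon0.
under eq_fun do rewrite big_cons; rewrite big_cons.
case: (boolP (P i)) => // Pi; rewrite -IH.
have := rL.1 1 _ _ (h i Pi) (CcX_sum s h).
by under eq_fun do rewrite mul1r; rewrite mul1r.
Qed.

(** The continuity bound, applied to the difference with M = 0, forces its value to be 0. *)
Lemma radon_eq Phi Psi : CcX X Phi -> CcX X Psi ->
  (forall z, X z -> Phi z = Psi z) -> L Phi = L Psi.
Proof.
move=> h1 h2 e; have h3 := CcX_lin (-1) h1 h2.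
have [K [cK KX hK]] := h3.2.
have [B hB] := rL.2 K cK KX.
have := hB _ h3 hK 0 (lexx 0) => h.
have {h} : normc (L (fun z => -1 * Phi z + Psi z)) <= B * 0.
  by apply: h => z Xz; rewrite e// mulN1r addNr Normc.normc0.
rewrite mulr0 rL.1// => h.
have : normc (-1 * L Phi + L Psi) = 0 by apply/eqP; rewrite eq_le h normc_ge0.
by move=> /Normc.eq0_normc/eqP; rewrite mulN1r addrC subr_eq0 => /eqP.
Qed.

End Linear.

Lemma radon_mul L g : {within X, continuous g} -> radon X L ->
  radon X (fun Phi => L (fun z => g z * Phi z)).
Proof.
move=> cg rL; split.
  move=> a Phi Psi h1 h2; rewrite -rL.1; [|exact: CcX_mul|exact: CcX_mul].
  by congr L; apply/funext => z; ring.
move=> K cK KX; have [B hB] := rL.2 K cK KX.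
have cn : {within K, continuous (fun z => normc (g z))}.
  apply: (continuous_subspaceW KX) => z; exact: (cvgC_normc (cg z)).
have := continuous_compact cn cK => /compact_bounded[M [_ hM]].
pose M1 := Num.max M 0 + 1.
have M1p : 0 <= M1 by rewrite addr_ge0// le_max lexx orbT.
have gM z : K z -> normc (g z) <= M1.
  move=> Kz; rewrite -[normc _]ger0_norm ?normc_ge0//.
  apply: (hM M1); last by exists z.
  by rewrite (le_lt_trans (_ : M <= Num.max M 0)) ?ltrDl// le_max lexx.
exists (B * M1) => Phi h1 hK N N0 hN; rewrite -mulrA; apply: hB.
- exact: CcX_mul.
- by move=> z Xz nK; rewrite hK// mulr0.
- by rewrite mulr_ge0.
move=> z Xz; rewrite Normc.normcM; have [Kz|nK] := pselect (K z).
  by apply: ler_pM; rewrite ?normc_ge0 ?gM ?hN.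
by rewrite hK// Normc.normc0 mulr0 mulr_ge0.
Qed.

Lemma radon_bigsum (I : finType) (F : I -> (T -> C) -> C) : (forall k, radon X (F k)) ->
  radon X (fun Phi => \sum_k F k Phi).
Proof.
move=> h; split.
  move=> a Phi Psi h1 h2; rewrite mulr_sumr -big_split; apply: eq_bigr => k _.
  exact: (h k).1.
move=> K cK KX.
have [B hB] := choice (fun k => (h k).2 K cK KX).
exists (\sum_k B k) => Phi h1 hK M M0 hM.
rewrite mulr_suml; apply: (le_trans (normc_sum _ _ _)).
by apply: ler_sum => k _; exact: hB.
Qed.

(** Hermitian symmetry is given on nonnegative functions. A general [Phi] is a combination, with
    coefficients 1, -1, i, -i, of the positive and negative parts of its real and imaginary parts;
    the two conjugations in [conj_radon] restore these coefficients. *)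
Lemma conj_radon_herm (r : nat) (mu : 'I_r -> 'I_r -> (T -> C) -> C) Phi j k :
  (forall j k, radon X (mu j k)) -> hermitian_nonneg X mu -> CcX X Phi ->
  conj_radon (mu k j) Phi = mu j k Phi.
Proof.
move=> rmu hmu cPhi.
pose pos (x : R) : R := Num.max x 0.
pose h (s : 'I_4) (z : C) : C := (pos (nth 0 [:: Re z; - Re z; Im z; - Im z] s))%:C.
pose c (s : 'I_4) : C := nth 0 [:: 1; -1; 0 +i* 1; - (0 +i* 1)] s.
have pm (x : R) : x = pos x - pos (- x).
  by rewrite /pos !maxElt; case: ltP => h1; case: ltP => h2; lra.
have dec z : z = \sum_s c s * h s z.
  rewrite !big_ord_recl big_ord0 /c /h /=; apply: complexP.
    by rewrite !(ReD, ReM) /= {1}(pm (Re z)); ring.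
  by rewrite !(ImD, ImM) /= {1}(pm (Im z)); ring.
have ch s : continuous (h s).
  have cm (p : C -> R) : continuous p -> continuous (fun z => (pos (p z))%:C : C).
    by move=> cp z; exact: (cvgCR (cvg_maxr (cp z) (cvg_cst (0 : R)))).
  have cI : continuous (@id C) by move=> z; exact: cvg_id.
  have cRe : continuous (fun z : C => Re z) by move=> z; have /cvgC_ReIm[] := cI z.
  have cIm : continuous (fun z : C => Im z) by move=> z; have /cvgC_ReIm[] := cI z.
  have cNRe : continuous (fun z : C => - Re z) by move=> z; exact: (cvgN (cRe z)).
  have cNIm : continuous (fun z : C => - Im z) by move=> z; exact: (cvgN (cIm z)).
  case: s => -[|[|[|[|n]]]] hs; last by exfalso; move: hs.
  - exact: (cm _ cRe).
  - exact: (cm _ cNRe).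
  - exact: (cm _ cIm).
  - exact: (cm _ cNIm).
have pos0 (x : R) : x = 0 -> pos x = 0 by move=> ->; rewrite /pos maxxx.
have h0 s : h s 0 = 0.
  case: s => -[|[|[|[|n]]]] hs; last by exfalso; move: hs.
  - by apply: complexP => //; exact: (pos0 0).
  - by apply: complexP => //; exact: (pos0 (- 0) (oppr0 _)).
  - by apply: complexP => //; exact: (pos0 0).
  - by apply: complexP => //; exact: (pos0 (- 0) (oppr0 _)).
have cF s : CcX X (fun z => h s (Phi z)) by exact: CcX_comp.
have hp s z : 0 <= h s z by rewrite lecR /pos le_max lexx orbT.
have herm s : mu j k (fun z => h s (Phi z)) = (mu k j (fun z => h s (Phi z)))^*.
  by have [e _] := hmu _ (cF s) (fun z _ => hp s (Phi z)); exact: e.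
have -> : mu j k Phi = \sum_s c s * mu j k (fun z => h s (Phi z)).
  rewrite [X in mu j k X](_ : Phi = fun z => \sum_s c s * h s (Phi z)).
    rewrite (radon_sum (rmu j k)); last by move=> s _; exact: CcX_Z.
    by apply: eq_bigr => s _; rewrite (radonZ (rmu j k)).
  by apply/funext => z.
rewrite /conj_radon (_ : (fun z => (Phi z)^*) = fun z => \sum_s (c s)^* * h s (Phi z)).
  rewrite (radon_sum (rmu k j)); last by move=> s _; exact: CcX_Z.
  rewrite rmorph_sum; apply: eq_bigr => s _.
  rewrite (radonZ (rmu k j))// herm.
  exact: (etrans (rmorphM _ _ _) (congr1 (fun w => w * _) (conjCK _))).
apply/funext => z; rewrite {1}(dec (Phi z)) rmorph_sum; apply: eq_bigr => s _.
by rewrite rmorphM; congr (_ * _); exact: conjC_R.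
Qed.

End RadonAlgebra.

(** * Density of the tensor products *)

Section Density.
Variables (R : realType) (d : nat).
Local Notation C := R[i].
Local Notation E := 'rV[R]_d.
Local Notation F := (E * \bar R)%type.

Lemma within_fst (Omega : set E) (K : set F) (a : E -> C) :
  {within Omega, continuous a} ->
  {within Omega `*` K, continuous (fun z : E * F => a z.1)}.
Proof.
move=> /subspace_continuousP ca; apply/subspace_continuousP => z [z1 z2] U nU.
have h : \forall y \near z.1, Omega y -> U (a y) by exact: ca nU.
have h2 : \forall w \near z, Omega w.1 -> U (a w.1).
  exact: (@cvg_fst _ _ (nbhs z.1) (nbhs z.2) _ _ h).
by apply: filterS h2 => w hw [w1 _]; exact: hw.
Qed.

Lemma within_snd (Omega : set E) (K : set F) (a : F -> C) :
  {within K, continuous a} ->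
  {within Omega `*` K, continuous (fun z : E * F => a z.2)}.
Proof.
move=> /subspace_continuousP ca; apply/subspace_continuousP => z [z1 z2] U nU.
have h : \forall y \near z.2, K y -> U (a y) by exact: ca nU.
have h2 : \forall w \near z, K w.2 -> U (a w.2).
  exact: (@cvg_snd _ _ (nbhs z.1) (nbhs z.2) _ _ h).
by apply: filterS h2 => w hw [_ w2]; exact: hw.
Qed.

Variables (Omega : set E) (Omega_open : open Omega).
Let X : set (E * F) := Omega `*` @K0oo R d.

Lemma CcX_prod (a : E -> C) (psi : F -> C) : Cc Omega a ->
  {within @K0oo R d, continuous psi} -> CcX X (fun z => a z.1 * psi z.2).
Proof.
move=> [ca [K [cK KO a0]]] cpsi; split.
  have h1 := within_fst (K := @K0oo R d) (continuous_subspaceT (A := Omega) ca).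
  have h2 := within_snd (Omega := Omega) cpsi.
  by move=> z; exact: (cvgCM (h1 z) (h2 z)).
exists (K `*` @K0oo R d); split.
- by apply: compact_setX => //; exact: compact_K0oo.
- by move=> z [/KO z1 z2]; split.
by move=> z [_ z2] nK; rewrite a0 ?mul0r// => z1; apply: nK.
Qed.

Lemma Cc0 : Cc Omega (fun=> 0 : C).
Proof.
split; first exact: (@cst_continuous E C 0).
by exists set0; split => //; exact: compact0.
Qed.

Lemma CcD (a b : E -> C) : Cc Omega a -> Cc Omega b -> Cc Omega (fun x => a x + b x).
Proof.
move=> [c1 [K1 [k1 s1 z1]]] [c2 [K2 [k2 s2 z2]]]; split.
  by move=> z; exact: (cvgCD (c1 z) (c2 z)).
exists (K1 `|` K2); split; first exact: compactU.
  by move=> z [/s1|/s2].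
by move=> z /not_orP[n1 n2]; rewrite z1// z2// addr0.
Qed.

Lemma Cc_sum I (s : seq I) (P : pred I) (f : I -> E -> C) :
  (forall i, P i -> Cc Omega (f i)) -> Cc Omega (fun z => \sum_(i <- s | P i) f i z).
Proof.
move=> h; elim: s => [|i s IH].
  by under eq_fun do rewrite big_nil; exact: Cc0.
under eq_fun do rewrite big_cons.
by case: (boolP (P i)) => // Pi; apply: CcD => //; exact: h.
Qed.

Implicit Types (x y : E) (r : R).

Definition rbox (x : E) (r : R) (y : E) : R :=
  \prod_j bump (x 0 j - r) (x 0 j + r) 1 (y 0 j).

Lemma boxtest_rbox x r y :
  boxtest (fun j => x 0 j - r) (fun j => x 0 j + r) y = (rbox x r y)%:C.
Proof.
rewrite /boxtest /tens /rbox rmorph_prod; apply: eq_bigr => j _.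
by rewrite /boxseq bumpseq0.
Qed.

Lemma rbox_ge0 x r y : 0 <= rbox x r y.
Proof. by apply: prodr_ge0 => j _; have /andP[] := bump01 (x 0 j - r) (x 0 j + r) 1 (y 0 j). Qed.

Lemma rbox_center x r : 0 < r -> 0 < rbox x r x.
Proof.
by move=> r0; apply: prodr_gt0 => j _; apply: bump_gt0; rewrite ltrDl ltrBlDr ltrDl r0.
Qed.

Lemma continuous_rbox x r : continuous (rbox x r).
Proof.
move=> y; have cy : {for y, continuous (boxtest (fun j => x 0 j - r) (fun j => x 0 j + r))}.
  by apply: continuous_tens; exact: dseq_boxseq.
have /cvgC_ReIm[h _] : boxtest (fun j => x 0 j - r) (fun j => x 0 j + r) z @[z --> y] -->
   (rbox x r y)%:C by rewrite -boxtest_rbox; exact: cy.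
by move: h; under eq_fun do rewrite boxtest_rbox.
Qed.

Lemma rbox_out x r y : rbox x r y != 0 -> cbox (fun j => x 0 j - r) (fun j => x 0 j + r) y.
Proof.
move=> n0 j; have [//|nj] := boolP (x 0 j - r <= y 0 j <= x 0 j + r).
suff e : bump (x 0 j - r) (x 0 j + r) 1 (y 0 j) = 0.
  by move: n0; rewrite /rbox (bigD1 j)//= e mul0r eqxx.
have : (bump (x 0 j - r) (x 0 j + r) 1 (y 0 j))%:C = 0 :> C.
  rewrite -bumpseq0 bumpseq_out// => /andP[/ltW a /ltW b].
  by move: nj; rewrite a b.
by move=> /(congr1 (@complex.Re R)).
Qed.

(** The filter [x \in D] keeps membership at hand when reasoning under the sum. *)
Definition boxsum (rad : E -> R) (D : seq E) (y : E) : R :=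
  \sum_(x <- D | x \in D) rbox x (rad x) y.

Lemma boxsum_ge0 rad D y : 0 <= boxsum rad D y.
Proof. by apply: sumr_ge0 => x _; exact: rbox_ge0. Qed.

Lemma box_cover (K : set E) (N : E -> set E) : compact K ->
  (forall x, K x -> nbhs x (N x)) -> exists (rad : E -> R) (D : seq E),
  (forall x, x \in D -> K x /\
     cbox (fun j => x 0 j - rad x) (fun j => x 0 j + rad x) `<=` N x) /\
  (forall y, K y -> 0 < boxsum rad D y).
Proof.
move=> cK KN.
have step x : exists r, K x -> 0 < r /\
    cbox (fun j => x 0 j - r) (fun j => x 0 j + r) `<=` N x.
  have [Kx|nK] := pselect (K x); last by exists 0.
  have /nbhs_ballP[r /= r0 rN] := KN x Kx.
  (* Halving the radius puts the closed box inside the open ball of the sup norm. *)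
  exists (r / 2) => _; split; first by rewrite divr_gt0.
  move=> y hy; apply: rN; split=> // a j; rewrite (ord1 a) /ball /=.
  rewrite ltr_norml; have := hy j; lra.
have [rad hrad] := choice step.
have := cK; rewrite compact_cover.
move=> /(_ E K (fun x => [set y | 0 < rbox x (rad x) y])) [].
- move=> x Kx; apply: (@open_comp _ _ (rbox x (rad x)) [set z | 0 < z]).
    by move=> y _; exact: continuous_rbox.
  exact: open_gt.
- by move=> x Kx; exists x => //=; apply: rbox_center; have [] := hrad x Kx.
move=> D DK KD; exists rad, (finmap.enum_fset D); split.
  move=> x xD; have Kx : K x by have := DK _ xD; rewrite inE.
  by split => //; have [] := hrad x Kx.
move=> y /KD[x /= xD y0]; rewrite /boxsum -big_seq (big_rem x)//=.
apply: ltr_pwDl => //; apply: sumr_ge0 => z _; exact: rbox_ge0.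
Qed.

(** With c > 0 a lower bound of the box sum S on [K], attained unless [K] is empty, 1 / max (S, c)
    is continuous everywhere, equals 1 / S on [K], and multiplied by S never exceeds 1. *)
Lemma boxsum_normalized (K : set E) rad D : compact K ->
  (forall y, K y -> 0 < boxsum rad D y) ->
  exists eta : E -> R, [/\ continuous eta, forall y, 0 <= eta y,
    forall y, boxsum rad D y * eta y <= 1 &
    forall y, K y -> boxsum rad D y * eta y = 1].
Proof.
move=> cK K0.
have cS : continuous (boxsum rad D).
  have -> : boxsum rad D = fun y => \sum_(x <- D) rbox x (rad x) y.
    by apply/funext => y; rewrite /boxsum -big_seq.
  move=> y.
  exact: (@cvgR_sum R E (nbhs y) _ _ D (fun x => rbox x (rad x))
    (fun x => rbox x (rad x) y) (fun x => @continuous_rbox x (rad x) y)).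
have [c c0 hc] : exists2 c : R, 0 < c & forall y, K y -> c <= boxsum rad D y.
  have [->|/set0P Kn] := eqVneq K set0; first by exists 1.
  have [y0 Ky0 hy] := compact_EVT_min Kn cK (continuous_subspaceT cS).
  exists (boxsum rad D y0); first by apply: K0; rewrite inE in Ky0.
  by move=> y Ky; apply: hy; rewrite inE.
have m0 y : 0 < Num.max (boxsum rad D y) c by rewrite lt_max c0 orbT.
exists (fun y => (Num.max (boxsum rad D y) c)^-1); split.
- move=> y; have n0 : Num.max (boxsum rad D y) c != 0 by rewrite gt_eqF.
  exact: (cvgV n0 (cvg_maxr (cS y) (cvg_cst c))).
- by move=> y; rewrite invr_ge0 ltW.
- by move=> y; rewrite ler_pdivrMr// mul1r le_max lexx.
move=> y Ky; rewrite max_l ?hc// mulfV// gt_eqF// (lt_le_trans c0)//; exact: hc.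
Qed.

Variable L : (E * F -> C) -> C.
Hypothesis rL : radon X L.
Hypothesis L0 : forall lo hi, cbox lo hi `<=` Omega ->
  forall phi psi, Cc Omega phi -> {within @K0oo R d, continuous psi} ->
  L (fun z => boxtest lo hi z.1 * phi z.1 * psi z.2) = 0.

(** Continuity at (x, xi) gives a neighbourhood of x depending on xi; compactness of the
    compactification makes it uniform in xi. *)
Let tube (Phi : E * F -> C) (eps : R) x : {within X, continuous Phi} -> 0 < eps -> Omega x ->
  nbhs x [set y | Omega y /\ forall xi, K0oo xi ->
    normc (Phi (y, xi) - Phi (x, xi)) <= eps].
Proof.
move=> /subspace_continuousP cPhi e0 Ox.
have /compact_near_coveringP/(_ E (nbhs x) (fun y xi => Omega y -> K0oo xi ->
    normc (Phi (y, xi) - Phi (x, xi)) <= eps)) := @compact_K0oo R d.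
have step xi : K0oo xi -> \forall xi' \near xi & y \near x, Omega y -> K0oo xi' ->
    normc (Phi (y, xi') - Phi (x, xi')) <= eps.
  move=> Kxi.
  have h : normc (Phi w - Phi (x, xi)) @[w --> within X (nbhs (x, xi))] --> (0 : R).
    have h1 : Phi w - Phi (x, xi) @[w --> within X (nbhs (x, xi))] -->
        Phi (x, xi) - Phi (x, xi).
      exact: (cvgCD (cPhi (x, xi) (conj Ox Kxi)) (cvg_cst (- Phi (x, xi)))).
    have h2 : normc (Phi w - Phi (x, xi)) @[w --> within X (nbhs (x, xi))] -->
        normc (Phi (x, xi) - Phi (x, xi)) by exact: (cvgC_normc h1).
    have e2 : normc (Phi (x, xi) - Phi (x, xi)) = 0 by rewrite subrr Normc.normc0.
    by rewrite e2 in h2.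
  have e2 : 0 < eps / 2 by rewrite divr_gt0.
  have h1 : \forall w \near (x, xi), X w -> normc (Phi w - Phi (x, xi)) < eps / 2.
    have : \forall w \near within X (nbhs (x, xi)), normc (Phi w - Phi (x, xi)) < eps / 2.
      by apply: (cvgr_lt 0 h).
    by [].
  case: h1 => -[U V] [/= nU nV] UV.
  exists (V, U) => // -[xi' y] [/= Vxi Uy] Oy Kxi'.
  have a1 := UV (y, xi') (conj Uy Vxi) (conj Oy Kxi').
  have a2 := UV (x, xi') (conj (nbhs_singleton nU) Vxi) (conj Ox Kxi').
  have -> : Phi (y, xi') - Phi (x, xi') =
    (Phi (y, xi') - Phi (x, xi)) - (Phi (x, xi') - Phi (x, xi)) by ring.
  apply: (le_trans (le_normcD _ _)); rewrite normcN.
  by move: a1 a2; rewrite /=; lra.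
move=> /(_ _ step) h.
have nO : nbhs x Omega by move: Omega_open; rewrite openE; exact.
by apply: filterS2 h nO => y hy Oy; split => // xi Kxi; exact: hy.
Qed.

Lemma density Phi : CcX X Phi -> L Phi = 0.
Proof.
move=> cPhi; have [wPhi [K [cK KX hK]]] := cPhi.
pose Kx : set E := [set z.1 | z in K].
have cKx : compact Kx.
  apply: continuous_compact => //; apply: continuous_subspaceT => z; exact: cvg_fst.
have KxO x : Kx x -> Omega x by move=> [z /KX[z1 _] <-].
have [rad0 [D0 [hD0 pos0]]] : exists (rad : E -> R) (D : seq E),
  (forall x, x \in D -> Kx x /\
     cbox (fun j => x 0 j - rad x) (fun j => x 0 j + rad x) `<=` Omega) /\
  (forall y, Kx y -> 0 < boxsum rad D y).
  apply: (@box_cover Kx (fun=> Omega)) => // x /KxO.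
  by move: Omega_open; rewrite openE; exact.
have [eta0 [ceta0 eta00 eta01 eta0K]] := boxsum_normalized cKx pos0.
(* This cut-off, equal to 1 on [Kx], is fixed before [eps]: it confines all approximants to the
   compact [Kf], so that the constant [B] does not depend on [eps]. *)
pose zeta y := boxsum rad0 D0 y * eta0 y.
have czeta : Cc Omega (fun y => (zeta y)%:C).
  have -> : (fun y => (zeta y)%:C : C) = (fun y => (eta0 y)%:C * \sum_(x <- D0 | x \in D0)
      boxtest (fun j => x 0 j - rad0 x) (fun j => x 0 j + rad0 x) y).
    apply/funext => y; rewrite /zeta mulrC rmorphM rmorph_sum; congr (_ * _).
    by apply: eq_bigr => x _; rewrite boxtest_rbox.
  apply: CcM; first by move=> y; exact: (cvgCR (ceta0 y)).
  apply: Cc_sum => x xD; have [_ xO] := hD0 x xD.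
  exact: (Cc_tens _ (@dseq_boxseq R d _ _) (@boxseq_out R d _ _) xO).
have [_ [K1 [cK1 K1O zK1]]] := czeta.
pose Kf := K `|` (K1 `*` @K0oo R d).
have cKf : compact Kf.
  by apply: compactU => //; apply: compact_setX => //; exact: compact_K0oo.
have KfX : Kf `<=` X by move=> z [/KX//|[/K1O z1 z2]]; split.
have [B hB] := rL.2 Kf cKf KfX.
have main eps : 0 < eps -> normc (L Phi) <= B * eps.
  move=> e0.
  have [rad [D [hD pos]]] := box_cover cKx (fun x Kxx => tube wPhi e0 (KxO x Kxx)).
  have [eta [ceta eta_0 eta_1 etaK]] := boxsum_normalized cKx pos.
  pose g y : C := (eta y)%:C * (zeta y)%:C.
  have cg : Cc Omega g by apply: CcM => // y; exact: (cvgCR (ceta y)).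
  (* Freezing the first variable of [Phi] at the centre of a small box separates the variables,
     which gives the shape on which [L] vanishes. *)
  pose T (x : E) (z : E * F) : C :=
    boxtest (fun j => x 0 j - rad x) (fun j => x 0 j + rad x) z.1 * g z.1 * Phi (x, z.2).
  have cPx x : x \in D -> {within @K0oo R d, continuous (fun xi => Phi (x, xi))}.
    move=> /hD[/KxO Ox _]; apply/subspace_continuousP => xi Kxi U nU.
    move/subspace_continuousP : wPhi => /(_ (x, xi) (conj Ox Kxi) U nU).
    case=> -[V W] [/= nV nW] VW; apply: filterS nW => xi' Wxi Kxi'.
    exact: VW (x, xi') (conj (nbhs_singleton nV) Wxi) (conj Ox Kxi').
  have bO x : x \in D ->
      cbox (fun j => x 0 j - rad x) (fun j => x 0 j + rad x) `<=` Omega.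
    by move=> /hD[_ h] y /h[].
  have cT x : x \in D -> CcX X (T x).
    move=> xD; pose a y := boxtest (fun j => x 0 j - rad x) (fun j => x 0 j + rad x) y * g y.
    have ca : Cc Omega a by apply: CcM => //; apply: continuous_tens; exact: dseq_boxseq.
    exact: (CcX_prod ca (cPx x xD)).
  pose Psi z := \sum_(x <- D | x \in D) T x z.
  have cPsi : CcX X Psi by exact: CcX_sum.
  have LPsi : L Psi = 0.
    rewrite (radon_sum rL)//; apply: big1 => x xD.
    exact: (L0 (bO x xD) cg (cPx x xD)).
  have cD := CcX_lin (-1) cPsi cPhi.
  have -> : L Phi = L (fun z => -1 * Psi z + Phi z).
    by rewrite rL.1// LPsi mulr0 add0r.
  apply: hB => //.
  - move=> z Xz /not_orP[n1 n2]; rewrite hK// /Psi big1 ?mulr0 ?addr0// => x _.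
    rewrite /T /g zK1 ?mulr0 ?mul0r// => z1; apply: n2; split => //.
    by case: Xz.
  - exact: ltW.
  move=> [y xi] [/= Oy Kxi].
  pose c x : R := rbox x (rad x) y * eta y.
  have sc : \sum_(x <- D | x \in D) c x = boxsum rad D y * eta y.
    by rewrite /boxsum mulr_suml.
  have c0 x : 0 <= c x by rewrite mulr_ge0 ?rbox_ge0.
  have z01 : 0 <= zeta y <= 1 by rewrite mulr_ge0 ?boxsum_ge0//= eta01.
  have eq1 : -1 * Psi (y, xi) + Phi (y, xi) = (zeta y)%:C *
      (\sum_(x <- D | x \in D) (c x)%:C * (Phi (y, xi) - Phi (x, xi))).
    (* Over [Kx] both factors are 1; elsewhere [Phi] itself vanishes. *)
    have e1 : Phi (y, xi) = (zeta y)%:C * ((\sum_(x <- D | x \in D) c x)%:C * Phi (y, xi)).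
      have [Ky|nK] := pselect (Kx y).
        by rewrite sc etaK// /zeta eta0K// !mul1r.
      by rewrite hK ?mulr0//; move=> h; apply: nK; exists (y, xi).
    rewrite {1}e1 /Psi [in RHS](eq_bigr (fun x => (c x)%:C * Phi (y, xi) +
      - ((c x)%:C * Phi (x, xi)))); last by move=> x _; ring.
    rewrite big_split sumrN /= mulrDr addrC; congr (_ + _).
      by rewrite rmorph_sum mulr_suml.
    rewrite mulN1r mulrN; congr (- _); rewrite mulr_sumr; apply: eq_bigr => x _.
    by rewrite /T /g /= boxtest_rbox /c rmorphM; ring.
  rewrite eq1 Normc.normcM normcC.
  case/andP: z01 => z0 z1; rewrite (ger0_norm z0) -[leRHS]mul1r.
  apply: ler_pM => //; first exact: normc_ge0.
  apply: (le_trans (normc_sum _ _ _)).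
  apply: (@le_trans _ _ (\sum_(x <- D | x \in D) c x * eps)).
    apply: ler_sum => x xD; rewrite Normc.normcM normcC (ger0_norm (c0 x)).
    have [r0|n0] := eqVneq (rbox x (rad x) y) 0; first by rewrite /c r0 !mul0r.
    apply: ler_wpM2l => //; have [_ /(_ _ (rbox_out n0))[_]] := hD x xD.
    by apply.
  rewrite -mulr_suml sc -[leRHS]mul1r; apply: ler_wpM2r; first exact: ltW.
  exact: eta_1.
apply: Normc.eq0_normc; apply/eqP; rewrite eq_le normc_ge0 andbT.
(* The constant of a Radon bound comes without a sign. *)
have [B0|B0] := leP B 0.
  by apply: (le_trans (main 1 ltr01)); rewrite mulr1.
apply/ler_addgt0Pl => eps e0; rewrite addr0.
by apply: (le_trans (main (eps / B) (divr_gt0 e0 B0))); rewrite mulrC divfK// gt_eqF.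
Qed.

End Density.

(** * The localisation principle *)

Lemma cvg_subseq (sigma : nat -> nat) : {homo sigma : i j / (i < j)%N} ->
  sigma n @[n --> \oo] --> \oo.
Proof.
move=> inc; have le n : (n <= sigma n)%N.
  by elim: n => // n IH; exact: leq_ltn_trans IH (inc _ _ (ltnSn n)).
by move=> S [N _ hN]; exists N => // n /= Nn; apply: hN; exact: leq_trans Nn (le n).
Qed.

Section Localisation.
Variables (R : realType) (d m l q r : nat).
Local Notation C := R[i].
Local Notation E := 'rV[R]_d.
Local Notation F := (E * \bar R)%type.

Variables (Omega : set E) (Omega_open : open Omega).
Variable A : mindex d m -> E -> 'M[C]_(q, r).
Hypothesis A_continuous : forall a : mindex d m, (l <= mlen a <= m)%N ->
  {within Omega, continuous (A a)}.
Let X : set (E * F) := Omega `*` @K0oo R d.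

Let coef (al : mindex d m) i k (z : E * F) : C :=
  (0 +i* (2 * pi)) ^+ mlen al * (extK (symb l al) z.2)%:C * A al z.1 i k.

Lemma p1E i k z : p1 l A z i k =
  \sum_(al : mindex d m | (l <= mlen al <= m)%N) coef al i k z.
Proof. by rewrite /p1 summxE; apply: eq_bigr => al _; rewrite mxE. Qed.

Lemma continuous_p1 i k : {within X, continuous (fun z => p1 l A z i k)}.
Proof.
have h al : (l <= mlen al <= m)%N -> {within X, continuous (coef al i k)}.
  move=> hal.
  have c1 : {within @K0oo R d, continuous (fun p => (extK (symb l al) p)%:C : C)}.
    by move=> p; exact: (cvgCR (continuous_extK_symb hal (x := p))).
  have c2 : {within Omega, continuous (fun x => A al x i k)}.
    move=> x; have ce : {for A al x, continuous (fun M : 'M[C]_(q, r) => M i k)}.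
      exact: coord_continuous.
    exact: (cvg_comp _ _ (A_continuous hal (x := x)) ce).
  have h1 := within_snd (Omega := Omega) c1.
  have h2 := within_fst (K := @K0oo R d) c2.
  by move=> z; exact: (cvgCM (cvgCM (cvg_cst _) (h1 z)) (h2 z)).
rewrite (_ : (fun z => p1 l A z i k) = fun z =>
  \sum_(al : mindex d m | (l <= mlen al <= m)%N) coef al i k z); last first.
  by apply/funext => z; exact: p1E.
by move=> z; apply: cvgC_sum => al hal; exact: h.
Qed.

Variables (u : nat -> E -> 'cV[C]_r) (u0 : weakly_to0 Omega u).
Variables (e : nat -> R) (f : nat -> 'I_q -> (E -> C) -> C).
Hypothesis e0 : forall N, 0 < e N.
Hypothesis u_solves : forall N, solves Omega l (e N) A (u N) (f N).
Hypothesis f_to0 : weighted_fourier_to0 Omega l m e f.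
Variable mu : 'I_r -> 'I_r -> (E * F -> C) -> C.
Hypothesis muH : one_scale_Hmeasure Omega u e mu.

(** Since [p1] is continuous on the whole product, the entries of p1 mu^T are themselves Radon
    measures and [density] applies to them. On products, [box_limit] concludes once each
    [conj_radon (mu k j)] is rewritten as [mu j k]. *)
Lemma localisation i j Phi : CcX X Phi -> mul_radon_tr (p1 l A) mu i j Phi = 0.
Proof.
have [rmu hmu _] := muH.
apply: (@density R d Omega Omega_open (mul_radon_tr (p1 l A) mu i j)).
  apply: (radon_bigsum (F := fun k Phi => mu j k (fun z => p1 l A z i k * Phi z))) => k.
  by apply: radon_mul => //; exact: continuous_p1.
move=> lo hi lohi phi psi cphi cpsi.
(* polar 0 lies off the compactification, where psi need not be bounded. *)
pose psi' p : C := if `[< @K0oo R d p >] then psi p else 0.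
have psi'E p : K0oo p -> psi' p = psi p by rewrite /psi'; case: asboolP.
have cpsi' : {within @K0oo R d, continuous psi'}.
  apply: (subspace_eq_continuous _ cpsi) => p; rewrite inE => Kp.
  exact: (esym (psi'E p Kp)).
have [M psiM] : exists M, forall p, normc (psi' p) <= M.
  have cn : {within @K0oo R d, continuous (fun p => normc (psi' p))}.
    by move=> p; exact: (cvgC_normc (cpsi' p)).
  have := continuous_compact cn (@compact_K0oo R d) => /compact_bounded[M0 [_ hM]].
  pose M1 := Num.max M0 0 + 1.
  exists M1 => p; have [Kp|nKp] := pselect (@K0oo R d p).
    rewrite -[normc _]ger0_norm ?normc_ge0//.
    apply: (hM M1); last by exists p.
    by rewrite (le_lt_trans (_ : M0 <= Num.max M0 0)) ?ltrDl// le_max lexx.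
  by rewrite /psi'; case: asboolP => // _; rewrite Normc.normc0 addr_ge0// le_max lexx orbT.
(* The H-measure conjugates its second cut-off, so the conjugate of [phi] is inserted there to
   recover [phi]. *)
have cphiJ : Cc Omega (fun x => (phi x)^*).
  have [cp [K [cK KO p0]]] := cphi; split; first by move=> x; exact: (cvgCJ (cp x)).
  by exists K; split => // x /p0 ->; rewrite rmorph0.
have := box_limit Omega_open u0 A_continuous e0 u_solves f_to0 muH lohi i j cphiJ cpsi' psiM.
set Psi := fun al k (z : E * F) => theta A lo hi i al (zidx d m) k z.1 *
  ((phi z.1)^*)^* * ((extK (symb l al) z.2)%:C * psi' z.2).
pose a (al : mindex d m) : C := (0 +i* (2 * pi)) ^+ mlen al.
have cPsi al k : (l <= mlen al <= m)%N -> CcX X (Psi al k).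
  move=> hal; pose th x := theta A lo hi i al (zidx d m) k x * ((phi x)^*)^*.
  have cth : Cc Omega th.
    have ct := Cc_theta Omega_open A_continuous lohi i (zidx d m) k hal.
    have -> : th = fun x => phi x * theta A lo hi i al (zidx d m) k x.
      by apply/funext => x; rewrite /th conjCK mulrC.
    by apply: CcM => //; exact: cphi.1.
  have c1 : {within @K0oo R d, continuous (fun p => (extK (symb l al) p)%:C * psi' p)}.
    move=> p; exact: (cvgCM (cvgCR (continuous_extK_symb hal (x := p))) (cpsi' p)).
  exact: (CcX_prod cth c1).
move=> h0; rewrite -[RHS]h0.
transitivity (\sum_(al : mindex d m | (l <= mlen al <= m)%N)
    \sum_k a al * mu j k (Psi al k)); last first.
  apply: eq_bigr => al hal; apply: eq_bigr => k _; congr (_ * _).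
  by rewrite (conj_radon_herm j k rmu hmu)//; exact: cPsi.
rewrite exchange_big /=; apply: eq_bigr => k _.
transitivity (mu j k (fun z => \sum_(al : mindex d m | (l <= mlen al <= m)%N)
    a al * Psi al k z)); last first.
  rewrite (radon_sum (rmu j k)); last by move=> al hal; apply: CcX_Z; exact: cPsi.
  by apply: eq_bigr => al hal; rewrite (radonZ (rmu j k))//; exact: cPsi.
apply: (radon_eq (rmu j k)).
- apply: CcX_mul; first exact: continuous_p1.
  apply: (CcX_prod (a := fun x => boxtest lo hi x * phi x) _ cpsi).
  by apply: CcM => //; apply: continuous_tens; exact: dseq_boxseq.
- by apply: CcX_sum => al hal; apply: CcX_Z; exact: cPsi.
move=> [x p] [/= Ox Kp]; rewrite p1E mulr_suml; apply: eq_bigr => al hal.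
rewrite /Psi /coef /theta /a /= conjCK psi'E//.
have -> : tens (boxseq lo hi) (fun j0 => zidx d m j0 : nat) x = boxtest lo hi x.
  by apply: eq_bigr => j0 _; rewrite ffunE.
by ring.
Qed.

End Localisation.

Theorem theorem8 (R : realType) (d q r l m : nat) (hl : (l <= m)%N)
  (Omega : set 'rV[R]_d) (Omega_open : open Omega)
  (eps : nat -> R) (eps_gt0 : forall n, 0 < eps n)
  (eps_to0 : eps n @[n --> \oo] --> (0 : R))
  (u : nat -> 'rV[R]_d -> 'cV[R[i]]_r) (u_weakly_to0 : weakly_to0 Omega u)
  (A : mindex d m -> 'rV[R]_d -> 'M[R[i]]_(q, r))
  (A_continuous : forall a : mindex d m, (l <= mlen a <= m)%N ->
     {within Omega, continuous (A a)})
  (f : nat -> 'I_q -> ('rV[R]_d -> R[i]) -> R[i])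
  (f_Hneg_loc : forall n i, Hneg_loc Omega m (f n i))
  (u_solves : forall n, solves Omega l (eps n) A (u n) (f n))
  (f_to0 : weighted_fourier_to0 Omega l m eps f)
  (sigma : nat -> nat) (sigma_incr : {homo sigma : i j / (i < j)%N})
  (mu : 'I_r -> 'I_r -> ('rV[R]_d * ('rV[R]_d * \bar R) -> R[i]) -> R[i])
  (mu_Hmeasure : one_scale_Hmeasure Omega (fun n => u (sigma n))
     (fun n => eps (sigma n)) mu) :
  forall (i : 'I_q) (j : 'I_r) (Phi : 'rV[R]_d * ('rV[R]_d * \bar R) -> R[i]),
    CcX (Omega `*` @K0oo R d) Phi -> mul_radon_tr (p1 l A) mu i j Phi = 0.
Proof.
move=> i j Phi; have cs := cvg_subseq sigma_incr.
have us0 : weakly_to0 Omega (fun n => u (sigma n)).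
  case: u_weakly_to0 => uL uw; split=> [n|g g1 g2 g3]; first exact: uL.
  exact: (cvg_comp _ _ cs (uw g g1 g2 g3)).
have fs0 : weighted_fourier_to0 Omega l m (fun n => eps (sigma n)) (fun n => f (sigma n)).
  move=> phi tphi; have [h [hf h0]] := f_to0 phi tphi.
  exists (fun n => h (sigma n)); split=> [n k|]; first exact: hf.
  exact: (cvg_comp _ _ cs h0).
exact: (localisation Omega_open A_continuous us0 (fun N => eps_gt0 (sigma N))
  (fun N => u_solves (sigma N)) fs0 mu_Hmeasure).
Qed.
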